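(* Let $n>0$ and let $G\le I(H^n)$ be a subgroup that contains a dense subgroup of the group of orientation-preserving isometries of $H^n$. Then the assembler $\mathcal H^n_G$ of polytopes in $n$-dimensional hyperbolic geometry, with volume function given by hyperbolic volume, is an EA-assembler.
   Context: Geometry. $H^n=\{(x_0,\dots,x_n)\in\mathbb R^{n+1}\mid-x_0^2+\sum_{i=1}^nx_i^2=-1,\ x_0>0\}$, and its isometry group $I(H^n)$ consists of the linear maps of $\mathbb R^{n+1}$ preserving $-x_0^2+\sum_{i\ge1}x_i^2$ and the sign of $x_0$. A geometric $n$-simplex in $H^n$ is obtained by taking the convex hull of $n+1$ points of $H^n$ in general position (as points of $\mathbb R^{n+1}$) and projecting it to $H^n$ from the origin. An $n$-polytope is a subset of $H^n$ that is a finite union of geometric $n$-simplices (possibly empty). The assembler $\mathcal H^n_G$: objects are $n$-polytopes $P\subseteq H^n$; morphisms $P\to Q$ with $P\neq\varnothing$ are elements $g\in G$ with $g(P)\subseteq Q$, and there is a unique morphism $\varnothing\to Q$. A family of morphisms is a covering family if the union of the images is the target; morphisms with the same target are disjoint if their images have disjoint interiors. A cover of $P$ is a finite pairwise disjoint covering family. Tuples. For an assembler $\mathcal A$, $\mathcal W(\mathcal A)$ is the category whose objects are finite tuples $\mathcal P=(I,\{P_i\}_{i\in I})$ of objects of $\mathcal A$, and whose morphisms $(I,\{P_i\})\to(J,\{Q_j\})$ are maps $\phi\colon I\to J$ with morphisms $f(i)\colon P_i\to Q_{\phi(i)}$ such that $\{f(i)\}_{i\in\phi^{-1}(j)}$ is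 a cover of $Q_j$ for each $j$; $\sqcup$ is disjoint union of tuples. Two tuples are scissors congruent, $\mathcal P\simeq\mathcal Q$, if there is a span $\mathcal P\leftarrow\mathcal R\to\mathcal Q$ in $\mathcal W(\mathcal A)$. EA-assemblers. A volume function on $\mathcal A$ (with values in an ordered abelian group $\mathbf R$; here $\mathbf R=\mathbb R$) is a function $\mathrm{vol}\colon\mathrm{ob}(\mathcal A)\to\mathbf R_{\ge0}$ with $\mathrm{vol}(P)=\sum_i\mathrm{vol}(P_i)$ for every cover $\{P_i\to P\}_{i\in I}$; extend it to tuples by $\mathrm{vol}(\mathcal P)=\sum_i\mathrm{vol}(P_i)$. An EA-assembler is an assembler with a volume function such that: (E) if $\mathrm{vol}(\mathcal P)<\mathrm{vol}(\mathcal Q)$ there is a tuple $\mathcal P'$ with $\mathcal P\sqcup\mathcal P'\simeq\mathcal Q$; (A) given $\mathcal P$ with $\mathrm{vol}(\mathcal P)>0$, every $\mathcal Q$ admits a (finite) cover $\{\mathcal Q_i\}$ (i.e. a morphism $\bigsqcup_i\mathcal Q_i\to\mathcal Q$ in $\mathcal W(\mathcal A)$) with $2\,\mathrm{vol}(\mathcal Q_i)\le\mathrm{vol}(\mathcal P)$ for each $i$. *)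

(* Defs.v *)
From HB Require Import structures.
From mathcomp Require Import all_boot all_order all_algebra.
From mathcomp Require Import all_classical all_reals all_analysis.
Set Implicit Arguments.
Unset Strict Implicit.
Unset Printing Implicit Defensive.
Import Order.TTheory GRing.Theory Num.Theory.
Import numFieldNormedType.Exports.
Local Open Scope classical_set_scope.
Local Open Scope ring_scope.

(* A category with a notion of covering family and of disjoint morphisms.
   Whether it is an assembler is the predicate [is_assembler] below. *)
Record coverCat := CoverCat {
  ob : Type;
  hom : ob -> ob -> Type;
  idm : forall P, hom P P;
  mcomp : forall P Q S, hom Q S -> hom P Q -> hom P S;
  compA : forall P Q S T (h : hom S T) (g : hom Q S) (f : hom P Q),
    mcomp h (mcomp g f) = mcomp (mcomp h g) f;
  comp1m : forall P Q (f : hom P Q), mcomp (idm Q) f = f;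
  compm1 : forall P Q (f : hom P Q), mcomp f (idm P) = f;
  covering : forall (I : Type) (P : I -> ob) (Q : ob),
    (forall i, hom (P i) Q) -> Prop;
  disjoint_mor : forall P1 P2 Q, hom P1 Q -> hom P2 Q -> Prop
}.

Arguments idm {c} P.
Arguments mcomp {c P Q S}.
Arguments covering {c I P Q}.
Arguments disjoint_mor {c P1 P2 Q}.

Section Assembler.
Variable A : coverCat.

Definition is_initial (O : ob A) : Prop :=
  forall P, exists f : hom O P, forall g : hom O P, g = f.

Definition is_mono (P Q : ob A) (f : hom P Q) : Prop :=
  forall S (a b : hom S P), mcomp f a = mcomp f b -> a = b.

Definition factors_through (P1 P2 Q : ob A) (f : hom P1 Q) (g : hom P2 Q) :
  Prop := exists a : hom P1 P2, f = mcomp g a.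

Definition refines (I J : Type) (P : I -> ob A) (P' : J -> ob A) (Q : ob A)
    (f : forall i, hom (P i) Q) (g : forall j, hom (P' j) Q) : Prop :=
  forall i, exists j, factors_through (f i) (g j).

Definition is_cover (I : finType) (P : I -> ob A) (Q : ob A)
    (f : forall i, hom (P i) Q) : Prop :=
  covering f /\ (forall i j, i != j -> disjoint_mor (f i) (f j)).

(* Zakharevich's axioms.  The site axioms (identity, composition, pullback,
   saturation) are imposed on finite covering families, the only ones that
   covers and [wmor] involve: with "jointly surjective" as the definition of
   covering, infinite families of polytopes are not stable under pullback
   (pull {[-1,0]} + {[1/k,1]}_k back from [-1,1] to [0,1]: the point 0 is
   lost, since {0} is not a polytope). *)
Record is_assembler : Prop := {
  asm_id : forall Q : ob A, covering (fun _ : unit => idm Q);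
  asm_comp : forall (I : finType) (P : I -> ob A) (Q : ob A)
      (f : forall i, hom (P i) Q) (J : I -> finType)
      (S : forall i, J i -> ob A) (g : forall i j, hom (S i j) (P i)),
    covering f -> (forall i, covering (g i)) ->
    covering (fun k : {i : I & J i} =>
      mcomp (f (projT1 k)) (g (projT1 k) (projT2 k)));
  asm_pullback : forall (I : finType) (P : I -> ob A) (Q Q' : ob A)
      (f : forall i, hom (P i) Q) (u : hom Q' Q),
    covering f ->
    exists (J : finType) (S : J -> ob A) (g : forall j, hom (S j) Q'),
      covering g /\ refines (fun j => mcomp u (g j)) f;
  asm_saturated : forall (I J : finType) (P : I -> ob A) (P' : J -> ob A)
      (Q : ob A) (f : forall i, hom (P i) Q) (g : forall j, hom (P' j) Q),
    covering f -> refines f g -> covering g;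
  asm_initial : exists O : ob A, is_initial O /\
    forall (P : void -> ob A) (f : forall i, hom (P i) O), covering f;
  asm_disjoint : forall (P1 P2 Q : ob A) (f : hom P1 Q) (g : hom P2 Q),
    disjoint_mor f g <->
    (* the pullback of f and g is the initial object *)
    (forall S (a : hom S P1) (b : hom S P2),
       mcomp f a = mcomp g b -> is_initial S);
  asm_refine : forall (I J : finType) (P : I -> ob A) (P' : J -> ob A)
      (Q : ob A) (f : forall i, hom (P i) Q) (g : forall j, hom (P' j) Q),
    is_cover f -> is_cover g ->
    exists (K : finType) (S : K -> ob A) (h : forall k, hom (S k) Q),
      [/\ is_cover h, refines h f & refines h g];
  asm_monic : forall (P Q : ob A) (f : hom P Q), is_mono f
}.

(* [wtuple] and [wmor] are the objects and morphisms of the category W(A);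
   [hom_cast] retypes the morphisms in the fibre over j as morphisms to Q_j. *)
Record wtuple := WTuple { idx : finType; part : idx -> ob A }.

Definition hom_cast (J : Type) (Q : J -> ob A) (P : ob A) (j j' : J)
    (e : j = j') (f : hom P (Q j)) : hom P (Q j') :=
  ecast k (hom P (Q k)) e f.

Record wmor (P Q : wtuple) := WMor {
  wfun : idx P -> idx Q;
  wcomp : forall i, hom (part i) (part (wfun i));
  wcover : forall j : idx Q,
    is_cover (fun k : {i : idx P | wfun i == j} =>
      hom_cast (eqP (valP k)) (wcomp (val k)))
}.

Definition tsum (P Q : wtuple) : wtuple :=
  WTuple (fun i : idx P + idx Q =>
    match i with inl i => part i | inr i => part i end).

Definition tbigsum (K : finType) (P : K -> wtuple) : wtuple :=
  WTuple (fun i : {k : K & idx (P k)} => part (projT2 i)).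

Definition scissors_congruent (P Q : wtuple) : Prop :=
  exists S : wtuple, inhabited (wmor S P) /\ inhabited (wmor S Q).

Variables (R : realType) (vol : ob A -> R).

Definition is_volume : Prop :=
  (forall P, 0 <= vol P) /\
  forall (I : finType) (P : I -> ob A) (Q : ob A) (f : forall i, hom (P i) Q),
    is_cover f -> vol Q = \sum_(i : I) vol (P i).

Definition tvol (P : wtuple) : R := \sum_(i : idx P) vol (part i).

Record is_EA_assembler : Prop := {
  EA_assembler : is_assembler;
  EA_volume : is_volume;
  EA_E : forall P Q : wtuple, tvol P < tvol Q ->
    exists P' : wtuple, scissors_congruent (tsum P P') Q;
  EA_A : forall P : wtuple, 0 < tvol P -> forall Q : wtuple,
    exists (K : finType) (Qs : K -> wtuple),
      inhabited (wmor (tbigsum Qs) Q) /\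
      forall k, 2 * tvol (Qs k) <= tvol P
}.

End Assembler.

Section Hyperbolic.
Variables (R : realType) (n : nat).

Definition lorentz (x : 'cV[R]_n.+1) : R :=
  - x ord0 ord0 ^+ 2 + \sum_(i < n) x (lift ord0 i) ord0 ^+ 2.

Definition hspace : set 'cV[R]_n.+1 :=
  [set x | lorentz x = -1 /\ 0 < x ord0 ord0].

(* I(H^n), acting by x |-> A *m x.  The sign of x_0 is only meaningful on
   timelike vectors: no Lorentz boost preserves it on all of R^(n+1). *)
Definition hisom : set 'M[R]_n.+1 :=
  [set A | (forall x : 'cV[R]_n.+1, lorentz (A *m x) = lorentz x) /\
           (forall x : 'cV[R]_n.+1, lorentz x < 0 ->
              Num.sg ((A *m x) ord0 ord0) = Num.sg (x ord0 ord0))].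

(* As the time direction is preserved, orienting H^n amounts to orienting
   R^(n+1). *)
Definition hisom_plus : set 'M[R]_n.+1 := [set A | hisom A /\ 0 < \det A].

Record is_isom_group (G : set 'M[R]_n.+1) : Prop := {
  isog_sub : G `<=` hisom;
  isog_1 : G 1%:M;
  isog_M : forall A B, G A -> G B -> G (A *m B);
  isog_V : forall A, G A -> G (invmx A)
}.

Definition convex_hull (V : 'M[R]_n.+1) : set 'cV[R]_n.+1 :=
  [set V *m a | a in [set a : 'cV[R]_n.+1 |
     (forall i, 0 <= a i ord0) /\ \sum_i a i ord0 = 1]].

Definition radial_proj (C : set 'cV[R]_n.+1) : set 'cV[R]_n.+1 :=
  [set x | hspace x /\ exists2 t : R, 0 < t & C (t *: x)].

(* The vertices are the columns of V; general position is linear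
   independence (affine independence would admit, for n >= 2, n+1 points on a
   common hyperplane of H^n, whose simplex is degenerate). *)
Definition geometric_simplex (S : set 'cV[R]_n.+1) : Prop :=
  exists V : 'M[R]_n.+1,
    [/\ forall j, hspace (col j V), row_free V^T &
        S = radial_proj (convex_hull V)].

Definition is_polytope (P : set 'cV[R]_n.+1) : Prop :=
  exists (k : nat) (S : 'I_k -> set 'cV[R]_n.+1),
    (forall i, geometric_simplex (S i)) /\ P = \bigcup_(i in setT) S i.

Definition polytope : Type := {P : set 'cV[R]_n.+1 | is_polytope P}.

(* Interior for the subspace topology of H^n. *)
Definition hinterior (P : set 'cV[R]_n.+1) : set 'cV[R]_n.+1 :=
  [set x | hspace x /\ within hspace (nbhs x) P].

End Hyperbolic.

(* Integral over R^m with respect to Lebesgue measure of a nonnegative Borel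
   function, as an iterated integral (Tonelli). *)
Fixpoint lebesgue_iint (R : realType) (m : nat) :
    ('cV[R]_m -> \bar R) -> \bar R :=
  match m with
  | 0 => fun f => f 0
  | m'.+1 => fun f =>
      (\int[@lebesgue_measure R]_(t in setT)
         lebesgue_iint (fun v : 'cV[R]_m' =>
           f (col_mx (t%:M : 'cV[R]_1) v)))%E
  end.

Section HyperbolicVolume.
Variables (R : realType) (n : nat).

Definition height (v : 'cV[R]_n) : R :=
  Num.sqrt (1 + \sum_(i < n) v i ord0 ^+ 2).

Definition hpoint (v : 'cV[R]_n) : 'cV[R]_n.+1 :=
  col_mx ((height v)%:M : 'cV[R]_1) v.

(* In the global chart [hpoint] of H^n the metric tensor is
   g_ij = delta_ij - x_i x_j / x_0^2, with sqrt (det g) = 1 / x_0: the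
   hyperbolic volume element is dx_1 ... dx_n / x_0. *)
Definition hvolume (P : set 'cV[R]_n.+1) : R :=
  fine (lebesgue_iint (fun v : 'cV[R]_n =>
    (\1_P (hpoint v) / height v)%:E)).

End HyperbolicVolume.

Section HyperbolicAssembler.
Variables (R : realType) (n : nat) (G : set 'M[R]_n.+1).
Hypothesis hG : is_isom_group G.

Implicit Types P Q S T : polytope R n.

Inductive polyhom P Q : Type :=
  | from_empty of sval P = set0
  | by_isom (A : 'M[R]_n.+1) of G A & sval P !=set0 &
      [set A *m x | x in sval P] `<=` sval Q.

Definition image_hom P Q (f : polyhom P Q) : set 'cV[R]_n.+1 :=
  match f with
  | from_empty _ => set0
  | by_isom A _ _ _ => [set A *m x | x in sval P]
  end.

Lemma image_id P : [set 1%:M *m x | x in sval P] `<=` sval P.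
Proof. by move=> _ [x Px <-]; rewrite mul1mx. Qed.

Lemma nonempty_of_neq P : sval P <> set0 -> sval P !=set0.
Proof. by move=> ne; apply/set0P/eqP. Qed.

Definition polyhom_id P : polyhom P P :=
  match pselect (sval P = set0) with
  | left e => from_empty P e
  | right ne =>
      by_isom (isog_1 hG) (nonempty_of_neq ne) (@image_id P)
  end.

Lemma image_nonempty P Q (A : 'M[R]_n.+1) : sval P !=set0 ->
  [set A *m x | x in sval P] `<=` sval Q -> sval Q <> set0.
Proof.
move=> [x Px] sPQ Q0.
by have := sPQ (A *m x) (ex_intro2 _ _ x Px erefl); rewrite Q0.
Qed.

Lemma image_comp_sub P Q S (A B : 'M[R]_n.+1) :
  [set A *m x | x in sval P] `<=` sval Q ->
  [set B *m x | x in sval Q] `<=` sval S ->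
  [set (B *m A) *m x | x in sval P] `<=` sval S.
Proof.
move=> sA sB _ [x Px <-]; rewrite -mulmxA; apply: sB.
by exists (A *m x) => //; apply: sA; exists x.
Qed.

Definition polyhom_comp P Q S (g : polyhom Q S) (f : polyhom P Q) :
    polyhom P S :=
  match f with
  | from_empty e => from_empty S e
  | by_isom A GA nP sA =>
      match g with
      | from_empty e => False_rect _ (image_nonempty nP sA e)
      | by_isom B GB _ sB =>
          by_isom (isog_M hG GB GA) nP (image_comp_sub sA sB)
      end
  end.

Lemma by_isom_eq P Q (A B : 'M[R]_n.+1) (GA : G A) (GB : G B) nP nP' sA sB :
  A = B -> @by_isom P Q A GA nP sA = @by_isom P Q B GB nP' sB.
Proof. by move=> eAB; subst B; congr by_isom; exact: Prop_irrelevance. Qed.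

Lemma polyhom_compA P Q S T (h : polyhom S T) (g : polyhom Q S)
  (f : polyhom P Q) :
  polyhom_comp h (polyhom_comp g f) = polyhom_comp (polyhom_comp h g) f.
Proof.
case: f => [//|A GA nP sA] /=.
case: g => [e|B GB nQ sB] /=; first by case: (image_nonempty nP sA e).
case: h => [e|C GC nS sC] /=; first by case: (image_nonempty nQ sB e).
by apply: by_isom_eq; rewrite mulmxA.
Qed.

Lemma polyhom_comp1m P Q (f : polyhom P Q) :
  polyhom_comp (polyhom_id Q) f = f.
Proof.
case: f => [//|A GA nP sA] /=; rewrite /polyhom_id.
case: pselect => [e|ne] /=; first by case: (image_nonempty nP sA e).
by apply: by_isom_eq; rewrite mul1mx.
Qed.

Lemma polyhom_compm1 P Q (f : polyhom P Q) :
  polyhom_comp f (polyhom_id P) = f.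
Proof.
rewrite /polyhom_id; case: pselect => [e|ne] /=.
  case: f => [e'|A GA nP sA].
    by congr from_empty; exact: Prop_irrelevance.
  by exfalso; case: nP => x; rewrite e.
case: f => [e|A GA nP sA] /=; first by case: (ne e).
by apply: by_isom_eq; rewrite mulmx1.
Qed.

Definition hyp_assembler : coverCat :=
  @CoverCat (polytope R n) polyhom polyhom_id polyhom_comp
    polyhom_compA polyhom_comp1m polyhom_compm1
    (fun (I : Type) (P : I -> polytope R n) (Q : polytope R n)
         (f : forall i, polyhom (P i) Q) =>
       \bigcup_(i in setT) image_hom (f i) = sval Q)
    (fun P1 P2 Q (f : polyhom P1 Q) (g : polyhom P2 Q) =>
       hinterior (image_hom f) `&` hinterior (image_hom g) = set0).

Definition hyp_vol (P : ob hyp_assembler) : R := hvolume (sval P).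

End HyperbolicAssembler.

(* Main.v *)
Require Import Defs.
From HB Require Import structures.
From mathcomp Require Import all_boot all_order all_algebra.
From mathcomp Require Import all_classical all_reals all_analysis.
From mathcomp Require Import measurable_realfun ring lra.
Set Implicit Arguments.
Unset Strict Implicit.
Unset Printing Implicit Defensive.
Import Order.TTheory GRing.Theory Num.Theory.
Import numFieldNormedType.Exports.
Local Open Scope classical_set_scope.
Local Open Scope ring_scope.

(**
Both volume axioms come from one packing argument. Up to finitely many
hyperplanes through the origin, polytopes form a Boolean algebra, and a
polytope is recovered from its class because it is the closure of its
interior ([polytope_sub]). It is therefore enough to construct pieces up to
such thin sets, which are null for the volume; the assembler axioms
([hyp_is_assembler]) and the additivity of the volume ([hyp_is_volume]) follow
as well. That isometries preserve the volume is seen on cones: the Euclidean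
volume of the part of the cone over [X] between the hyperboloids of radii 1
and 2 is a fixed multiple of the hyperbolic volume of [X]
([thick_cone_volume]), and Lorentz transformations have determinant of absolute
value 1.

For the packing, cut [H^n] into the cubes of a grid in the Klein model, whose
faces are geodesic. Within a ball of radius fixed in advance there is an
integer [M] such that any subset of a cube of a grid [M] times finer can be
moved into any cube of the coarse grid ([move_into_cube]): the transvection
between the centres distorts lengths by a bounded factor, and the room that is
left allows replacing it by an element of the dense subgroup. The number of
cubes replaces the volume: if [X] has less than a certain constant multiple of
the total volume of the [Q j], then for a fine enough grid it touches at most
as many fine cubes as there are coarse cubes inside the [Q j], so that the
pieces of [X] find pairwise different places ([pack_one]). To see this,
compare volumes of cubes by the same movements ([cube_comparison]), and
estimate the cubes that meet the boundary of a polytope by thin slabs around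
its facets ([boundary_cubes_small]).

For [EA_E] the constant is harmless: cut [P] into pieces so small that each
of them is packed into what is left of [Q] by the time its turn comes, the
difference of the volumes being always available ([pack_many]); the final
leftover is the complement. For [EA_A], cubes of a fine grid have small
volume, because many disjoint cubes of comparable volume fit into one ball
([grid_cube_small]); here the dimension must be positive.
*)

(** * Lebesgue measure on column vectors *)

Section VectorMeasurable.
Variables (R : realType) (m : nat).

Let coors : 'I_m -> 'cV[R]_m -> R := fun i v => v i ord0.

Let vec_set0 : g_sigma_preimage coors set0.
Proof. exact: sigma_algebra0. Qed.

Let vec_setC A : g_sigma_preimage coors A -> g_sigma_preimage coors (~` A).
Proof. exact: sigma_algebraC. Qed.

Let vec_bigcup (F : (set 'cV[R]_m)^nat) :
  (forall i, g_sigma_preimage coors (F i)) ->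
  g_sigma_preimage coors (\bigcup_i (F i)).
Proof. exact: sigma_algebra_bigcup. Qed.

HB.instance Definition _ := @isMeasurable.Build default_measure_display
  ('cV[R]_m) (g_sigma_preimage coors) vec_set0 vec_setC vec_bigcup.

Lemma measurable_coor (i : 'I_m) :
  measurable_fun setT (fun v : 'cV[R]_m => v i ord0).
Proof.
move=> _ Y mY; rewrite setTI; apply: sub_sigma_algebra => /=.
rewrite -bigcup_seq/=; exists i => /=; first by rewrite mem_index_enum.
by exists Y => //; rewrite setTI.
Qed.

Lemma measurable_vecP d (T : measurableType d) (f : T -> 'cV[R]_m) :
  (forall i, measurable_fun setT (fun x => f x i ord0)) ->
  measurable_fun setT f.
Proof.
move=> mf; pose S := [set A : set 'cV[R]_m | measurable (f @^-1` A)].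
move=> _ A mA; rewrite setTI.
suff : S A by [].
move: A mA; apply: smallest_sub.
  split.
  - by rewrite /S /= preimage_set0; exact: measurable0.
  - by move=> A; rewrite /S /= setTD preimage_setC; exact: measurableC.
  - by move=> F mF; rewrite /S /= preimage_bigcup; apply: bigcupT_measurable => k; exact: mF.
move=> A /=; rewrite -bigcup_seq => -[i _ [B mB <-]].
rewrite /S /= setTI -comp_preimage.
by have := mf i measurableT B mB; rewrite setTI.
Qed.

End VectorMeasurable.

Section VectorLebesgue.
Variable R : realType.
Local Notation leb := (@lebesgue_measure R).

Definition vcons m (p : R * 'cV[R]_m) : 'cV[R]_m.+1 :=
  col_mx (p.1%:M : 'cV_1) p.2.

Definition vuncons m (x : 'cV[R]_m.+1) : R * 'cV[R]_m :=
  (x ord0 ord0, \col_i x (lift ord0 i) ord0).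

Lemma vcons0 m (p : R * 'cV[R]_m) : vcons p ord0 ord0 = p.1.
Proof.
transitivity ((p.1%:M : 'M[R]_1) ord0 ord0); last by rewrite mxE eqxx mulr1n.
rewrite -(col_mxEu (p.1%:M : 'M[R]_1) p.2 ord0 ord0).
by congr (fun_of_matrix _ _ _); exact/val_inj.
Qed.

Lemma vconsS m (p : R * 'cV[R]_m) i : vcons p (lift ord0 i) ord0 = p.2 i ord0.
Proof.
have <- := col_mxEd (p.1%:M : 'M[R]_1) p.2 i ord0.
by congr (fun_of_matrix _ _ _); exact/val_inj.
Qed.

Lemma vconsK m : cancel (@vcons m) (@vuncons m).
Proof.
move=> [t v]; rewrite /vuncons vcons0; congr (_, _).
by apply/colP => i; rewrite mxE vconsS.
Qed.

Lemma vunconsK m : cancel (@vuncons m) (@vcons m).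
Proof.
move=> x; apply/colP => i; case: (unliftP ord0 i) => [j ->|->].
  by rewrite vconsS /= mxE.
by rewrite vcons0.
Qed.

Lemma measurable_vcons m : measurable_fun setT (@vcons m).
Proof.
apply: measurable_vecP => i; case: (unliftP ord0 i) => [j ->|->].
  under eq_fun do rewrite vconsS.
  exact: (measurableT_comp (measurable_coor j) measurable_snd).
under eq_fun do rewrite vcons0.
exact: measurable_fst.
Qed.

Lemma measurable_vuncons m : measurable_fun setT (@vuncons m).
Proof.
apply/measurable_fun_pairP; split; first exact: measurable_coor.
apply: measurable_vecP => i /=; under eq_fun do rewrite mxE.
exact: measurable_coor.
Qed.

Section Extend.
Variables (m : nat) (nu : {sigma_finite_measure set 'cV[R]_m -> \bar R}).

Definition vextend : set 'cV[R]_m.+1 -> \bar R :=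
  pushforward (leb \x nu)%E (@vcons m).

HB.instance Definition _ := Measure.copy vextend
  (measure_function_pushforward__canonical__measure_function_Measure
     (leb \x nu)%E (@measurable_vcons m)).

Lemma vextend_sigma_finite : sigma_finite setT vextend.
Proof.
have /sigma_finiteP[F [FT ndF Foo]] := sigma_finiteT leb.
have /sigma_finiteP[G [GT ndG Goo]] := sigma_finiteT nu.
exists (fun k => @vuncons m @^-1` (F k `*` G k)).
  rewrite -preimage_bigcup; apply/seteqP; split => // x _ /=.
  have [i _ Fi] : (\bigcup_i F i) (vuncons x).1 by rewrite -FT.
  have [j _ Gj] : (\bigcup_i G i) (vuncons x).2 by rewrite -GT.
  exists (maxn i j) => //; split => /=.
    by move: Fi; apply/subsetPset/ndF/leq_maxl.
  by move: Gj; apply/subsetPset/ndG/leq_maxr.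
move=> k; have [mF Fk] := Foo k; have [mG Gk] := Goo k; split.
  rewrite -[X in measurable X]setTI; apply: measurable_vuncons => //.
  exact: measurableX.
rewrite /vextend /pushforward -comp_preimage.
rewrite (_ : _ \o _ = id); last by apply/funext => p /=; rewrite vconsK.
by rewrite preimage_id product_measure1E// lte_mul_pinfty// ge0_fin_numE.
Qed.

HB.instance Definition _ := Measure_isSigmaFinite.Build _ _ _ vextend
  vextend_sigma_finite.

End Extend.

(** The recursion is that of the iterated integrals, so that Tonelli's theorem
    identifies these with integrals for [vleb]. *)
Fixpoint vleb m : {sigma_finite_measure set 'cV[R]_m -> \bar R} :=
  match m with
  | 0 => [the {sigma_finite_measure set 'cV[R]_0 -> \bar R} of \d_(0 : 'cV[R]_0)]
  | m'.+1 => [the {sigma_finite_measure set 'cV[R]_m'.+1 -> \bar R} of vextend (vleb m')]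
  end.

Local Open Scope ereal_scope.

Lemma integral_vlebS m (f : 'cV[R]_m.+1 -> \bar R) :
  measurable_fun setT f -> (forall x, 0 <= f x) ->
  \int[vleb m.+1]_x f x = \int[leb \x vleb m]_p f (vcons p).
Proof.
move=> mf f0; rewrite /= /vextend ge0_integral_pushforward //.
exact: measurable_vcons.
Qed.

Lemma measurable_vcomp m (f : 'cV[R]_m.+1 -> \bar R) :
  measurable_fun setT f -> measurable_fun setT (f \o @vcons m).
Proof. by move=> mf; apply: measurableT_comp => //; exact: measurable_vcons. Qed.

Lemma tonelli_vleb1 m (f : 'cV[R]_m.+1 -> \bar R) :
  measurable_fun setT f -> (forall x, 0 <= f x) ->
  \int[vleb m.+1]_x f x = \int[leb]_t \int[vleb m]_v f (vcons (t, v)).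
Proof.
move=> mf f0; rewrite integral_vlebS //.
apply: (fubini_tonelli1 (m1 := leb) (m2 := vleb m) _ (measurable_vcomp mf)) => p.
exact: f0.
Qed.

Lemma tonelli_vleb2 m (f : 'cV[R]_m.+1 -> \bar R) :
  measurable_fun setT f -> (forall x, 0 <= f x) ->
  \int[vleb m.+1]_x f x = \int[vleb m]_v \int[leb]_t f (vcons (t, v)).
Proof.
move=> mf f0; rewrite tonelli_vleb1 //.
apply: (fubini_tonelli (m1 := leb) (m2 := vleb m) _ (measurable_vcomp mf)) => p.
exact: f0.
Qed.

Lemma lebesgue_iintE m (f : 'cV[R]_m -> \bar R) :
  measurable_fun setT f -> (forall x, 0 <= f x) ->
  lebesgue_iint f = \int[vleb m]_v f v.
Proof.
elim: m f => [|m IH] f mf f0; first by rewrite /= integral_dirac // diracT mul1e.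
rewrite tonelli_vleb1 //=; apply: eq_integral => t _; rewrite IH //.
exact: (measurableT_comp (measurable_vcomp mf) (pair1_measurable t)).
Qed.

End VectorLebesgue.

(** * The linear change of variables *)

Section LinearChange.
Variable R : realType.
Local Notation leb := (@lebesgue_measure R).
Lemma affine_preimage_ocitv (a b x y : R) : (0 < a)%R ->
  (fun t : R => a * t + b)%R @^-1` `]x, y] = `](x - b) / a, (y - b) / a]%classic.
Proof.
move=> a0; apply/seteqP; split => t /=; rewrite !in_itv /=.
  by rewrite ltr_pdivrMr // ler_pdivlMr // mulrC ltrBlDr lerBrDr.
by rewrite ltr_pdivrMr // ler_pdivlMr // mulrC ltrBlDr lerBrDr.
Qed.

Lemma measurable_affine (a b : R) :
  measurable_fun setT (fun t : R => a * t + b : measurableTypeR R)%R.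
Proof.
by apply: measurable_funD => //; apply: measurable_funM.
Qed.

Local Open Scope ereal_scope.

(** The image of Lebesgue measure under the affine map, multiplied by [a], has
    the values of Lebesgue measure on half-open intervals. *)
Lemma lebesgue_affine (a b : R) (f : R -> \bar R) : (0 < a)%R ->
  measurable_fun setT f -> (forall t, 0 <= f t) ->
  a%:E * \int[leb]_t f (a * t + b)%R = \int[leb]_t f t.
Proof.
move=> a0 mf f0.
have mphi := measurable_affine a b.
pose mu := measure_function_pushforward__canonical__measure_function_Measure leb mphi.
have a0' := ltW a0.
pose nu := mscale (NngNum a0') mu.
have nuE A : measurable A -> leb A = nu A.
  apply: lebesgue_measure_unique => _ [[x y]] _ <- /=.
  rewrite /mscale /= /pushforward affine_preimage_ocitv // !lebesgue_measure_itv /=.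
  rewrite !lte_fin ltr_pM2r ?invr_gt0 // ltrD2r.
  case: ifP => _; last by rewrite mule0.
  rewrite -!EFinD -EFinM; congr EFin.
  by field; rewrite gt_eqF.
transitivity (\int[nu]_t f t); last first.
  by apply: eq_measure_integral => //= A mA _; rewrite nuE.
rewrite /nu ge0_integral_mscale //=; congr (_ * _).
exact/esym/(@ge0_integral_pushforward _ _
  (measurableTypeR R) (measurableTypeR R) R _ mphi leb setT f measurableT mf (fun t _ => f0 t)).
Qed.

Lemma integral_oppr (f : R -> \bar R) :
  measurable_fun setT f -> (forall t, 0 <= f t) ->
  \int[leb]_t f (- t)%R = \int[leb]_t f t.
Proof.
move=> mf f0.
have mphi : measurable_fun setT (-%R : R -> measurableTypeR R).
  exact: (measurable_funN (@measurable_id _ R _)).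
transitivity (\int[pushforward leb (-%R : R -> measurableTypeR R)]_t f t).
  exact/esym/(@ge0_integral_pushforward _ _
  (measurableTypeR R) (measurableTypeR R) R _ mphi leb setT f measurableT mf (fun t _ => f0 t)).
by apply: eq_measure_integral => //= A mA _; exact: lebesgue_measureN.
Qed.

Lemma lebesgue_affine_norm (a b : R) (f : R -> \bar R) : (a != 0)%R ->
  measurable_fun setT f -> (forall t, 0 <= f t) ->
  `|a|%:E * \int[leb]_t f (a * t + b)%R = \int[leb]_t f t.
Proof.
move=> a0 mf f0; case: (ltgtP a 0%R) a0 => // a0 _; last first.
  by rewrite gtr0_norm // lebesgue_affine.
rewrite ltr0_norm //.
have mg : measurable_fun setT (fun t : R => f (- t)%R).
  apply: (measurableT_comp mf); exact: (measurable_funN (@measurable_id _ R _)).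
rewrite -[RHS]integral_oppr // -[RHS](@lebesgue_affine (- a) (- b)) ?oppr_gt0 //.
congr (_ * _); apply: eq_integral => t _; congr f.
by rewrite mulNr opprD !opprK.
Qed.

Lemma lebesgue_translate (b : R) (f : R -> \bar R) :
  measurable_fun setT f -> (forall t, 0 <= f t) ->
  \int[leb]_t f (t + b)%R = \int[leb]_t f t.
Proof.
move=> mf f0; rewrite -[RHS](@lebesgue_affine 1 b) // mul1e.
by apply: eq_integral => t _; rewrite mul1r.
Qed.

Lemma measurable_partial_vleb m (f : 'cV[R]_m.+1 -> \bar R) :
  measurable_fun setT f -> (forall x, 0 <= f x) ->
  measurable_fun setT (fun t : R => \int[vleb R m]_v f (vcons (t, v))).
Proof.
move=> mf f0.
have f0' p : 0 <= (f \o @vcons R m) p by exact: f0.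
have := @measurable_fun_fubini_tonelli_F _ _ (measurableTypeR R) _ R (vleb R m) _
  (measurable_vcomp mf) f0'.
exact.
Qed.

Lemma measurable_vaffine m k (A : 'M[R]_(k, m)) (c : 'cV[R]_k) :
  measurable_fun setT (fun v : 'cV[R]_m => A *m v + c)%R.
Proof.
apply: measurable_vecP => i; under eq_fun do rewrite mxE.
apply: measurable_funD => //.
under eq_fun do rewrite mxE.
apply: measurable_sum => j; apply: measurable_funM => //.
exact: measurable_coor.
Qed.

Lemma measurable_mulmx m k (A : 'M[R]_(k, m)) :
  measurable_fun setT (fun v : 'cV[R]_m => A *m v).
Proof.
by have := measurable_vaffine A 0; under eq_fun do rewrite addr0.
Qed.

Lemma vleb_translate m (c : 'cV[R]_m) (f : 'cV[R]_m -> \bar R) :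
  measurable_fun setT f -> (forall x, 0 <= f x) ->
  \int[vleb R m]_v f (v + c)%R = \int[vleb R m]_v f v.
Proof.
elim: m c f => [|m IH] c f mf f0.
  by apply: eq_integral => v _; congr f; apply/colP => -[].
have mtr : measurable_fun setT (fun v : 'cV[R]_m.+1 => v + c)%R.
  by have := measurable_vaffine 1%:M c; under eq_fun do rewrite mul1mx.
rewrite !tonelli_vleb1 //; last exact: (measurableT_comp mf mtr).
rewrite -[RHS](@lebesgue_translate (vuncons c).1); last 2 first.
  exact: measurable_partial_vleb.
  by move=> t; apply: integral_ge0.
apply: eq_integral => t _.
rewrite -[RHS](@IH (vuncons c).2); last 2 first.
  exact: (measurableT_comp (measurable_vcomp mf) (pair1_measurable _)).
  by [].
apply: eq_integral => v _; congr f; apply/colP => i.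
by case: (unliftP ord0 i) => [j ->|->]; rewrite mxE !(vcons0, vconsS) /= ?mxE.
Qed.

(** The substitution formula for [A]. It passes to products, so that it suffices
    to prove it for the factors of a triangular decomposition. *)
Definition change_of_variables m (A : 'M[R]_m) := forall f : 'cV[R]_m -> \bar R,
  measurable_fun setT f -> (forall x, 0 <= f x) ->
  `|\det A|%:E * \int[vleb R m]_v f (A *m v)%R = \int[vleb R m]_v f v.

Lemma change_of_variablesM m (A B : 'M[R]_m) :
  change_of_variables A -> change_of_variables B -> change_of_variables (A *m B).
Proof.
move=> hA hB f mf f0; rewrite det_mulmx normrM EFinM -muleA.
have mfA : measurable_fun setT (fun v => f (A *m v)).
  by apply: (measurableT_comp mf); exact: measurable_mulmx.
rewrite -[RHS]hA // -[X in _ = _ * X]hB //; congr (_ * (_ * _)).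
by apply: eq_integral => v _; rewrite mulmxA.
Qed.

Lemma block_mul_vcons m (a : R) (b : 'rV[R]_m) (c : 'cV[R]_m) (D : 'M[R]_m) t v :
  (block_mx a%:M b c D : 'M[R]_(1 + m)) *m vcons (t, v) =
  vcons (a * t + (b *m v) ord0 ord0, t *: c + D *m v)%R.
Proof.
rewrite /vcons mul_block_col; congr col_mx.
  by apply/matrixP => i j; rewrite !ord1 !mxE big_ord1 !mxE !eqxx !mulr1n.
by rewrite mul_mx_scalar.
Qed.

(** For a fixed first coordinate the shear translates the remaining ones. *)
Lemma change_of_variables_lower m (c : 'cV[R]_m) :
  change_of_variables (block_mx 1%:M 0 c 1%:M : 'M[R]_(1 + m)).
Proof.
move=> f mf f0; rewrite det_lblock !det1 mul1r normr1 mul1e.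
rewrite !tonelli_vleb1 //; last exact: (measurableT_comp mf (@measurable_mulmx _ _ _)).
apply: eq_integral => t _.
rewrite -[RHS](@vleb_translate _ (t *: c)%R) //; last first.
  exact: (measurableT_comp (measurable_vcomp mf) (pair1_measurable _)).
apply: eq_integral => v _; congr f.
by rewrite block_mul_vcons mul0mx mxE addr0 mul1r mul1mx addrC.
Qed.

(** For fixed remaining coordinates the shear translates the first one. *)
Lemma change_of_variables_upper m (b : 'rV[R]_m) :
  change_of_variables (block_mx 1%:M b 0 1%:M : 'M[R]_(1 + m)).
Proof.
move=> f mf f0; rewrite det_ublock !det1 mul1r normr1 mul1e.
rewrite !tonelli_vleb2 //; last exact: (measurableT_comp mf (@measurable_mulmx _ _ _)).
apply: eq_integral => v _.
rewrite -[RHS](@lebesgue_translate ((b *m v) ord0 ord0)%R) //; last first.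
  exact: (measurableT_comp (measurable_vcomp mf) (pair2_measurable _)).
apply: eq_integral => t _; congr f.
by rewrite block_mul_vcons scaler0 add0r mul1r mul1mx.
Qed.

Lemma change_of_variables_diag m (a : R) (D : 'M[R]_m) : (a != 0)%R ->
  change_of_variables D -> change_of_variables (block_mx a%:M 0 0 D : 'M[R]_(1 + m)).
Proof.
move=> a0 hD f mf f0; rewrite det_ublock det_scalar1 normrM EFinM -muleA.
rewrite !tonelli_vleb1 //; last exact: (measurableT_comp mf (@measurable_mulmx _ _ _)).
have mg := measurable_partial_vleb mf f0.
have g0 t : 0 <= \int[vleb R m]_v f (vcons (t, v)) by apply: integral_ge0.
rewrite -[RHS](@lebesgue_affine_norm a 0) //; congr (_ * _).
rewrite -ge0_integralZl //; last 2 first.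
- apply: (@measurable_partial_vleb _ (fun x => f (_ *m x))) => //.
  exact: (measurableT_comp mf (@measurable_mulmx _ _ _)).
- by move=> t _; apply: integral_ge0.
apply: eq_integral => t _; rewrite -[RHS]hD //; last first.
  exact: (measurableT_comp (measurable_vcomp mf) (pair1_measurable _)).
congr (_ * _); apply: eq_integral => v _; congr f.
by rewrite block_mul_vcons mul0mx mxE scaler0 add0r.
Qed.

(** One step of block elimination: when the corner is invertible, the matrix is a
    lower shear times a block diagonal matrix times an upper shear. *)
Lemma change_of_variables_corner m (A : 'M[R]_(1 + m)) :
  (forall D : 'M[R]_m, D \in unitmx -> change_of_variables D) ->
  A \in unitmx -> (A ord0 ord0 != 0)%R -> change_of_variables A.
Proof.
move=> IH uA a0; set a := A ord0 ord0 in a0.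
have ulA : ulsubmx A = a%:M.
  apply/matrixP => i j; rewrite !ord1 !mxE eqxx mulr1n.
  by congr (A _ _); exact/val_inj.
pose L : 'M[R]_(1 + m) := block_mx 1%:M 0 (a^-1 *: dlsubmx A) 1%:M.
pose U : 'M[R]_(1 + m) := block_mx 1%:M (a^-1 *: ursubmx A) 0 1%:M.
pose D := (drsubmx A - a^-1 *: (dlsubmx A *m ursubmx A))%R.
pose E : 'M[R]_(1 + m) := block_mx a%:M 0 0 D.
have AE : A = L *m E *m U.
  rewrite /L /E /U !mulmx_block !(mul1mx, mulmx1, mul0mx, mulmx0, addr0, add0r).
  rewrite !(mul_scalar_mx, mul_mx_scalar) !scalerA divff // !scale1r.
  rewrite -{1}(submxK A) ulA; congr block_mx.
  by rewrite -scalemxAr addrC subrK.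
have uD : D \in unitmx.
  move: uA; rewrite AE !unitmx_mul => /andP[/andP[_ uE] _].
  by move: uE; rewrite !unitmxE /E det_ublock det_scalar1 unitrM => /andP[].
rewrite AE; apply: change_of_variablesM; last exact: change_of_variables_upper.
apply: change_of_variablesM; first exact: change_of_variables_lower.
by apply: change_of_variables_diag => //; exact: IH.
Qed.

Theorem linear_change_of_variables m (A : 'M[R]_m) :
  A \in unitmx -> change_of_variables A.
Proof.
elim: m A => [|m IH] A uA.
  move=> f mf f0; rewrite det_mx00 normr1 mul1e.
  by apply: eq_integral => v _; congr f; apply/colP => -[].
have [a0|a0] := eqVneq (A ord0 ord0) 0%R; last exact: change_of_variables_corner.
have [i Ai0] : exists i : 'I_m, A (lift ord0 i) ord0 != 0%R.
  apply: contrapT => /forallNP h.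
  have A0 : A *m delta_mx ord0 ord0 = 0%R :> 'cV[R]_m.+1.
    apply/colP => k; rewrite !mxE (bigD1 ord0) //= mxE !eqxx mulr1.
    rewrite big1 ?addr0; last by move=> j /negbTE j0; rewrite mxE j0 mulr0.
    case: (unliftP ord0 k) => [j ->|-> //]; apply/eqP; apply/negPn/negP.
    exact: h.
  have : invmx A *m (A *m delta_mx ord0 ord0) = 0%R :> 'cV[R]_m.+1 by rewrite A0 mulmx0.
  rewrite mulKmx // => /colP/(_ ord0); rewrite !mxE !eqxx => /eqP.
  by rewrite oner_eq0.
(* Adding row [i] to the first one makes the corner nonzero; [S 1] does this, and
   [S (-1)] undoes it. *)
pose S (s : R) : 'M[R]_(1 + m) := block_mx 1%:M (s *: delta_mx ord0 i) 0 1%:M.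
have SS : S (-1)%R *m S 1%R = 1%:M.
  rewrite /S mulmx_block !(mul1mx, mulmx1, mul0mx, mulmx0, addr0, add0r).
  by rewrite scale1r scaleN1r subrr -scalar_mx_block.
rewrite -(mul1mx A) -SS -mulmxA.
apply: change_of_variablesM; first exact: change_of_variables_upper.
apply: change_of_variables_corner => //.
  have [_ uS] := mulmx1_unit SS.
  by rewrite unitmx_mul; apply/andP; split; [exact: uS | exact: uA].
suff -> : (S 1%R *m A) ord0 ord0 = A (lift ord0 i) ord0 by [].
have -> : (S 1%R *m A) ord0 ord0 = (S 1%R *m col ord0 A) ord0 ord0.
  rewrite mxE [RHS]mxE; apply: eq_bigr => k _; congr (_ * _)%R.
  by rewrite mxE.
rewrite -(vunconsK (col ord0 A)) block_mul_vcons vcons0 /=.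
by rewrite scale1r -rowE !mxE a0 mulr0 add0r.
Qed.

End LinearChange.

(** * The substitution t = sqrt (r^2 + s) *)

Section RadialSubstitution.
Variables (R : realType) (s : R).
Hypothesis s0 : 0 <= s.
Local Notation leb := (@lebesgue_measure R).
Implicit Type r : R.

(** The time coordinate of the point of the hyperboloid of radius [r] that lies
    above a vector of squared norm [s]. *)
Definition lift_radius r : R := Num.sqrt (r ^+ 2 + s).
Local Notation phi := lift_radius.
Definition lift_speed r : R := r / phi r.
Local Notation w := lift_speed.

Lemma sqr_lift_radius r : phi r ^+ 2 = r ^+ 2 + s.
Proof. by rewrite sqr_sqrtr // addr_ge0 // sqr_ge0. Qed.

Lemma lift_radius_gt0 r : 0 < r -> 0 < phi r.
Proof. by move=> r0; rewrite sqrtr_gt0 ltr_pwDl // exprn_gt0. Qed.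

Lemma lift_radius_ge0 r : 0 <= phi r.
Proof. exact: sqrtr_ge0. Qed.

Lemma lift_radius_lt r r' : 0 <= r -> 0 <= r' -> (phi r < phi r') = (r < r').
Proof.
move=> r0 r'0; rewrite -(ltr_pXn2r (ltn0Sn 1)) ?nnegrE ?lift_radius_ge0 //.
by rewrite !sqr_lift_radius ltrD2r ltr_pXn2r.
Qed.

Lemma lift_radius_le r r' : 0 <= r -> 0 <= r' -> (phi r <= phi r') = (r <= r').
Proof. by move=> r0 r'0; rewrite !leNgt lift_radius_lt. Qed.

Lemma continuous_lift_radius : continuous phi.
Proof.
move=> r; apply: (@continuous_comp _ _ _ (fun r => r ^+ 2 + s) Num.sqrt); last exact: sqrt_continuous.
by apply: cvgD; [exact: exprn_continuous | exact: cvg_cst].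
Qed.

Lemma continuous_lift_speed r : 0 < r -> {for r, continuous w}.
Proof.
move=> r0; apply: cvgM; first exact: cvg_id.
by apply: cvgV; [rewrite gt_eqF // lift_radius_gt0 | exact: continuous_lift_radius].
Qed.

Lemma is_derive_lift_radius r : 0 < r -> is_derive r 1 phi (w r).
Proof.
move=> r0.
have h : 0 < r ^+ 2 + s by rewrite ltr_pwDl // exprn_gt0.
have d2 := is_derive1_sqrt h.
have d1 : is_derive r 1 (fun r => r ^+ 2 + s : R) (2 * r).
  apply: is_derive_eq; rewrite /= addr0 /GRing.scale /=.
  by rewrite mulr1 mulr2n mulrDl mul1r.
have := @is_derive1_comp _ Num.sqrt (fun r => r ^+ 2 + s : R) r _ _ d2 d1.
suff -> : (2 * Num.sqrt (r ^+ 2 + s))^-1 * (2 * r) = w r by [].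
rewrite /w /phi; field.
by rewrite gt_eqF // sqrtr_gt0.
Qed.

Local Open Scope ereal_scope.

Lemma integral_lift_speed r : (1 < r)%R ->
  \int[leb]_(x in `[1%R, r]) (w x)%:E = (phi r - phi 1)%:E.
Proof.
move=> r1.
rewrite (@continuous_FTC2 _ w phi 1%R r) //.
- apply: continuous_in_subspaceT => x; rewrite inE /= in_itv /= => /andP[x1 _].
  by apply: continuous_lift_speed; apply: lt_le_trans x1.
- split.
  + move=> x; rewrite in_itv /= => /andP[x1 _].
    by have [] := is_derive_lift_radius (lt_trans ltr01 x1).
  + by apply: cvg_at_right_filter; exact: continuous_lift_radius.
  + by apply: cvg_at_left_filter; exact: continuous_lift_radius.
- move=> x; rewrite in_itv /= => /andP[x1 _]; rewrite derive1E.
  by apply: derive_val; apply: is_derive_lift_radius; exact: lt_trans x1.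
Qed.

Lemma measurable_lift_radius : measurable_fun setT (phi : R -> R).
Proof. exact: continuous_measurable_fun continuous_lift_radius. Qed.

Lemma measurable_lift_speed :
  measurable_fun (`[1%R, 2%R]%classic : set R) (fun r => (w r)%:E).
Proof.
apply/measurable_EFinP; apply: subspace_continuous_measurable_fun => //.
apply: continuous_in_subspaceT => x; rewrite inE /= in_itv /= => /andP[x1 _].
by apply: continuous_lift_speed; apply: lt_le_trans x1.
Qed.

Lemma lift_speed_ge0 r : (1 <= r)%R -> (0 <= w r)%R.
Proof. by move=> r1; rewrite divr_ge0 ?lift_radius_ge0 // (le_trans ler01). Qed.

(** The image under [lift_radius] of the measure on [[1, 2]] with density
    [lift_speed]. *)
Definition lift_measure (A : set (measurableTypeR R)) : \bar R :=
  \int[leb]_(r in `[1%R, 2%R] `&` phi @^-1` A) (w r)%:E.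

Let mphi (A : set R) : measurable A -> measurable (phi @^-1` A).
Proof. by move=> mA; rewrite -[X in measurable X]setTI; exact: measurable_lift_radius. Qed.

Let lift_measure0 : lift_measure set0 = 0.
Proof. by rewrite /lift_measure preimage_set0 setI0 integral_set0. Qed.

Let lift_measure_ge0 A : 0 <= lift_measure A.
Proof.
apply: integral_ge0 => r [] /=; rewrite in_itv /= => /andP[r1 _] _.
by rewrite lee_fin lift_speed_ge0.
Qed.

Let lift_measure_sigma_additive : semi_sigma_additive lift_measure.
Proof.
move=> F mF tF mUF; rewrite /lift_measure preimage_bigcup setI_bigcupr.
rewrite ge0_integral_bigcup.
- by apply: is_cvg_nneseries => k _ _; exact: (lift_measure_ge0 (F k)).
- by move=> k; apply: measurableI => //; exact: (mphi (mF k)).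
- apply: measurable_funS measurable_lift_speed => //.
  by apply: bigcup_sub => k _; exact: subIsetl.
- move=> r [k _ [/=]]; rewrite in_itv /= => /andP[r1 _] _.
  by rewrite lee_fin lift_speed_ge0.
- apply/trivIsetP => i j _ _ ij; move/trivIsetP : tF => /(_ i j I I ij) h.
  by rewrite setIACA setIid -preimage_setI h preimage_set0 setI0.
Qed.

HB.instance Definition _ := isMeasure.Build _ (measurableTypeR R) R
  lift_measure lift_measure0 lift_measure_ge0 lift_measure_sigma_additive.

(** On rays the fundamental theorem of calculus applies; as rays generate the
    Borel sets and are stable under intersection, they determine the measure. *)
Lemma lift_measure_ray y :
  lift_measure `]-oo, y[ = leb (`]-oo, y[ `&` `[phi 1, phi 2]).
Proof.
have p12 : (phi 1 < phi 2)%R by rewrite lift_radius_lt // ltr1n.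
rewrite /lift_measure.
have [y1|y1] := leP y (phi 1).
  rewrite (_ : _ `&` _ = set0) ?integral_set0; last first.
    apply/seteqP; split => // r [] /=; rewrite !in_itv /= => /andP[r1 _].
    by move=> /lt_le_trans/(_ y1); rewrite lift_radius_lt ?(le_trans ler01) // ltNge r1.
  rewrite (_ : _ `&` _ = set0) ?measure0 //.
  apply/seteqP; split => // t [] /=; rewrite !in_itv /= => ty /andP[+ _].
  by rewrite leNgt (lt_le_trans ty).
have [y2|y2] := ltP (phi 2) y.
  rewrite (_ : _ `&` _ = `[1%R, 2%R]%classic); last first.
    apply/seteqP; split => r /=; rewrite !in_itv /=; first by case.
    move=> /andP[r1 r2]; split; first by rewrite r1.
    by apply: le_lt_trans y2; rewrite lift_radius_le // (le_trans ler01).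
  rewrite integral_lift_speed ?ltr1n // (_ : _ `&` _ = `[phi 1, phi 2]%classic).
    by rewrite lebesgue_measure_itv /= lte_fin p12.
  apply/seteqP; split => t /=; rewrite !in_itv /=; first by case.
  move=> /andP[t1 t2]; rewrite t1 t2; split => //; exact: le_lt_trans y2.
pose r := Num.sqrt (y ^+ 2 - s).
have y0 : (0 < y)%R by apply: lt_trans y1; rewrite lift_radius_gt0.
have ys : (1 < y ^+ 2 - s)%R.
  rewrite ltrBrDr -[X in (X + _)%R](expr1n _ 2) -sqr_lift_radius.
  by rewrite ltr_pXn2r // nnegrE ?lift_radius_ge0 // ltW.
have pr : phi r = y.
  rewrite /phi /r sqr_sqrtr ?subrK ?sqrtr_sqr ?gtr0_norm //.
  by rewrite (le_trans ler01) // ltW.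
have r1 : (1 < r)%R.
  by rewrite -[X in (X < _)%R]sqrtr1 ltr_sqrt // (lt_trans ltr01).
have r0 : (0 <= r)%R by apply: sqrtr_ge0.
have r2 : (r <= 2)%R by rewrite -lift_radius_le // pr.
rewrite (_ : _ `&` _ = `[1%R, r[%classic); last first.
  apply/seteqP; split => x /=; rewrite !in_itv /=.
    move=> [/andP[x1 x2] xy]; rewrite x1 /= -(lift_radius_lt (le_trans ler01 x1) r0).
    by rewrite pr.
  move=> /andP[x1 xr]; rewrite x1 (le_trans (ltW xr)) //; split => //.
  by rewrite -pr lift_radius_lt // (le_trans ler01).
rewrite (_ : _ `&` _ = `[phi 1, y[%classic); last first.
  apply/seteqP; split => t /=; rewrite !in_itv /=.
    by move=> [ty /andP[-> _]].
  by move=> /andP[t1 ty]; split=> //; rewrite t1 (le_trans (ltW ty)).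
rewrite integral_itv_bndo_bndc; last first.
  by apply: measurable_funS measurable_lift_speed => // x /=; rewrite !in_itv /= => /andP[-> /ltW /le_trans ->].
by rewrite integral_lift_speed // lebesgue_measure_itv /= lte_fin y1 pr.
Qed.

Lemma lift_measureE A : measurable A ->
  lift_measure A = leb (A `&` `[phi 1, phi 2]).
Proof.
move=> mA.
pose nu := mrestr leb (measurable_itv `[phi 1, phi 2]).
transitivity (nu A); last by [].
pose G := @RGenInftyO.G R.
apply: (@measure_unique _ R (measurableTypeR R) G (fun k => `]-oo, k%:R[%classic)
  _ _ _ _ lift_measure nu) => //.
- exact: RGenInftyO.measurableE.
- move=> _ _ [x ->] [y ->]; exists (Num.min x y).
  by apply/seteqP; split => t /=; rewrite !in_itv /= lt_min; [move=> [-> ->]|move=> /andP].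
- by move=> i; exists i%:R.
- apply/seteqP; split => // t _; exists (Num.truncn t).+1 => //=.
  by rewrite in_itv /= truncnS_gt.
- by move=> _ [y ->]; exact: lift_measure_ray.
- move=> k; rewrite /= lift_measure_ray.
  apply: (@le_lt_trans _ _ (leb `[phi 1, phi 2])).
    by apply: le_measure; rewrite ?inE //; exact: measurableI.
  by rewrite lebesgue_measure_itv /=; case: ifP => _; rewrite ?ltry // -EFinB ltry.
Qed.

Lemma radial_substitution A : measurable A ->
  \int[leb]_t (\1_(A `&` `[phi 1, phi 2]) t)%:E =
  \int[leb]_(r in `[1%R, 2%R]) (\1_A (phi r) * w r)%:E.
Proof.
move=> mA; rewrite integral_indic //; last by apply: measurableI.
rewrite setIT; transitivity (lift_measure A); first by rewrite lift_measureE.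
rewrite /lift_measure.
rewrite integral_mkcondr; apply: eq_integral => r _.
have E : (phi r \in A) = (r \in phi @^-1` A) by apply/idP/idP; rewrite !inE.
rewrite patchE indicE E; case: (_ \in _); first by rewrite mul1r.
by rewrite mul0r.
Qed.

End RadialSubstitution.

(** * The Lorentz form and its isometries *)

Section LorentzForm.
Variables (R : realType) (n : nat).
Local Notation vec := 'cV[R]_n.+1.
Implicit Types (x y z p q : vec) (A : 'M[R]_n.+1).

Definition lsign : 'rV[R]_n.+1 := \row_i (if i == ord0 then -1 else 1).
Definition lform x y : R := (x^T *m diag_mx lsign *m y) ord0 ord0.

Lemma lformE x y :
  lform x y = - (x ord0 ord0 * y ord0 ord0)
    + \sum_(i < n) x (lift ord0 i) ord0 * y (lift ord0 i) ord0.
Proof.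
rewrite /lform mxE big_ord_recl mul_mx_diag !mxE eqxx mulrN1 mulNr; congr (_ + _).
by apply: eq_bigr => i _; rewrite !mxE mulr1.
Qed.

Lemma lorentzE x : lorentz x = lform x x.
Proof.
by rewrite lformE /lorentz expr2; congr (_ + _); apply: eq_bigr => i _; rewrite expr2.
Qed.

Lemma lformC x y : lform x y = lform y x.
Proof.
by rewrite !lformE mulrC; congr (_ + _); apply: eq_bigr => i _; rewrite mulrC.
Qed.

Lemma lformDl x y z : lform (x + y) z = lform x z + lform y z.
Proof. by rewrite /lform linearD /= !mulmxDl mxE. Qed.

Lemma lformDr x y z : lform z (x + y) = lform z x + lform z y.
Proof. by rewrite /lform mulmxDr mxE. Qed.

Lemma lformZl a x y : lform (a *: x) y = a * lform x y.
Proof. by rewrite /lform linearZ /= -!scalemxAl mxE. Qed.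

Lemma lformZr a x y : lform y (a *: x) = a * lform y x.
Proof. by rewrite /lform -!scalemxAr mxE. Qed.

Lemma lformNl x y : lform (- x) y = - lform x y.
Proof. by rewrite -scaleN1r lformZl mulN1r. Qed.

Lemma lformNr x y : lform y (- x) = - lform y x.
Proof. by rewrite lformC lformNl lformC. Qed.

Definition lformB := (lformDl, lformDr, lformZl, lformZr, lformNl, lformNr).

Lemma lorentzD x y : lorentz (x + y) = lorentz x + 2 * lform x y + lorentz y.
Proof. by rewrite !lorentzE !lformB (lformC y x); ring. Qed.

Lemma lorentzZ a x : lorentz (a *: x) = a ^+ 2 * lorentz x.
Proof. by rewrite !lorentzE !lformB; ring. Qed.

Lemma hspace_lorentz x : hspace x -> lform x x = -1.
Proof. by case; rewrite lorentzE. Qed.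

(** By polarisation. *)
Lemma lform_isom A x y : (forall x, lorentz (A *m x) = lorentz x) ->
  lform (A *m x) (A *m y) = lform x y.
Proof.
move=> hA; have := hA (x + y); rewrite mulmxDr !lorentzD !hA => h.
by apply: (mulfI (_ : 2 != 0 :> R)); [rewrite pnatr_eq0 | move: h => /addIr /addrI].
Qed.

Lemma det_lsign : \det (diag_mx lsign) = -1.
Proof.
rewrite det_diag big_ord_recl !mxE eqxx big1 ?mulr1 // => i _.
by rewrite mxE.
Qed.

Lemma isom_gram A : (forall x, lorentz (A *m x) = lorentz x) ->
  A^T *m diag_mx lsign *m A = diag_mx lsign.
Proof.
move=> hA; apply/matrixP => i j.
have h := lform_isom (delta_mx i ord0) (delta_mx j ord0) hA.
have E (M : 'M[R]_n.+1) : M i j = (((delta_mx i ord0 : vec)^T *m M) *m (delta_mx j ord0 : vec)) ord0 ord0.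
  by rewrite trmx_delta -rowE -colE !mxE.
rewrite E [RHS]E; move: h; rewrite /lform trmx_mul => <-.
by rewrite !mulmxA.
Qed.

Lemma isom_det A : (forall x, lorentz (A *m x) = lorentz x) -> \det A ^+ 2 = 1.
Proof.
move=> /isom_gram /(congr1 determinant); rewrite !det_mulmx det_tr det_lsign.
by rewrite mulrN1 mulNr => /oppr_inj; rewrite expr2.
Qed.

Lemma hisom_unit A : hisom A -> A \in unitmx.
Proof.
case=> /isom_det d _; rewrite unitmxE unitfE.
by apply: contraTneq (oner_neq0 R) => A0; rewrite -d A0 expr0n eqxx.
Qed.

Lemma hisom_absdet A : hisom A -> `|\det A| = 1.
Proof.
case=> /isom_det d _; apply/eqP; rewrite -[_ == _](@eqrXn2 _ 2%N) ?normr_ge0 //.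
by rewrite expr1n -normrX d normr1.
Qed.

Lemma sg_gt0 (a b : R) : Num.sg a = Num.sg b -> (0 < a) = (0 < b).
Proof. by move=> e; rewrite -sgr_gt0 e sgr_gt0. Qed.

Lemma hisom_pos A x : hisom A -> lorentz x < 0 ->
  (0 < (A *m x) ord0 ord0) = (0 < x ord0 ord0).
Proof. by move=> [_ h] x0; apply: sg_gt0; exact: h. Qed.

Lemma hisom_hspace A x : hisom A -> hspace x -> hspace (A *m x).
Proof.
move=> hA [x1 x2]; have [h _] := hA; split; first by rewrite h.
by rewrite hisom_pos // x1 ltrN10.
Qed.

Definition future x := lorentz x < 0 /\ 0 < x ord0 ord0.

Lemma hspace_future x : hspace x -> future x.
Proof. by case=> x1 x2; split; rewrite // x1 ltrN10. Qed.

(** The reverse Cauchy-Schwarz inequality: for two timelike vectors the product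
    of the time coordinates outweighs the product of the space parts. *)
Lemma lform_future x y : future x -> future y -> lform x y < 0.
Proof.
move=> [lx x0] [ly y0]; move: lx ly; rewrite !lorentzE !lformE.
set a := x ord0 ord0 in x0 *; set b := y ord0 ord0 in y0 *.
rewrite !(addrC (- _)) !subr_lt0 => lx ly.
have ab0 : 0 < a * b by rewrite mulr_gt0.
rewrite -(ltr_pM2l (_ : 0 < 2 * (a * b))) ?mulr_gt0 ?ltr0n //.
apply: (@le_lt_trans _ _ (b ^+ 2 * (\sum_(i < n) x (lift ord0 i) ord0 * x (lift ord0 i) ord0)
   + a ^+ 2 * (\sum_(i < n) y (lift ord0 i) ord0 * y (lift ord0 i) ord0))).
  rewrite !mulr_sumr -big_split /=; apply: ler_sum => i _.
  rewrite -subr_ge0; set c := x _ _; set d := y _ _.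
  have -> : b ^+ 2 * (c * c) + a ^+ 2 * (d * d) - 2 * (a * b) * (c * d) = (b * c - a * d) ^+ 2.
    by ring.
  exact: sqr_ge0.
have -> : 2 * (a * b) * (a * b) = b ^+ 2 * (a * a) + a ^+ 2 * (b * b) by ring.
by apply: ltrD; rewrite ltr_pM2l // exprn_gt0.
Qed.

Lemma futureD x y : future x -> future y -> future (x + y).
Proof.
move=> fx fy; have l := lform_future fx fy; case: fx fy => [lx x0] [ly y0].
split; last by rewrite mxE addr_gt0.
by rewrite lorentzD; lra.
Qed.

Lemma futureZ a x : 0 < a -> future x -> future (a *: x).
Proof.
move=> a0 [lx x0]; split; last by rewrite mxE mulr_gt0.
by rewrite lorentzZ pmulr_rlt0 // exprn_gt0.
Qed.

(** The point of the hyperboloid on the ray through a future timelike vector. *)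
Definition radial x : vec := (Num.sqrt (- lorentz x))^-1 *: x.

Lemma radial_scale_gt0 x : future x -> 0 < (Num.sqrt (- lorentz x))^-1.
Proof. by case=> lx _; rewrite invr_gt0 sqrtr_gt0 oppr_gt0. Qed.

Lemma hspace_radial x : future x -> hspace (radial x).
Proof.
move=> fx; have [lx x0] := fx; have c0 := radial_scale_gt0 fx.
split; last by rewrite mxE mulr_gt0.
rewrite lorentzZ exprVn sqr_sqrtr ?oppr_ge0 ?ltW //.
by rewrite invrN mulNr mulVf // lt_eqF.
Qed.

(** The test by which transvections are seen to preserve the direction of time. *)
Lemma future_of_lform y q : lorentz y < 0 -> future q -> lform y q < 0 -> future y.
Proof.
move=> ly fq lyq; split=> //; case: (ltgtP (y ord0 ord0) 0) => // y0.
  have fy : future (- y).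
    by split; [rewrite lorentzE !lformB opprK -lorentzE | rewrite mxE oppr_gt0].
  by have := lform_future fy fq; rewrite lformNl oppr_lt0 ltNge (ltW lyq).
move: ly; rewrite lorentzE lformE y0 mul0r oppr0 add0r ltNge.
by rewrite sumr_ge0 // => i _; rewrite -expr2 sqr_ge0.
Qed.

(** Sylvester's identity, for rank-one updates. *)
Lemma det_1_rank1 m (u : 'cV[R]_m) (v : 'rV[R]_m) :
  \det (1%:M + u *m v) = 1 + (v *m u) ord0 ord0.
Proof.
pose L : 'M[R]_(1 + m) := block_mx 1%:M 0 u 1%:M.
pose U : 'M[R]_(1 + m) := block_mx 1%:M (- v) 0 (1%:M + u *m v).
pose U' : 'M[R]_(1 + m) := block_mx (1%:M + v *m u) (- v) 0 1%:M.
have E : L *m U = U' *m L.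
  rewrite /L /U /U' !mulmx_block !(mul1mx, mulmx1, mul0mx, mulmx0, addr0, add0r).
  by rewrite mulNmx mulmxN addrK addrCA addNr addr0.
have := congr1 determinant E; rewrite !det_mulmx /L /U /U' det_lblock !det_ublock.
rewrite !det1 !mul1r !mulr1 => ->.
by rewrite [LHS]det_mx11 !mxE eqxx.
Qed.

(** The Lorentz reflection in the hyperplane orthogonal to [a]. *)
Definition lrefl a : 'M[R]_n.+1 :=
  1%:M + (- (2 / lform a a) *: a) *m (a^T *m diag_mx lsign).

Lemma lreflE a x : lrefl a *m x = x - (2 * lform a x / lform a a) *: a.
Proof.
rewrite /lrefl mulmxDl mul1mx -mulmxA; congr (_ + _).
rewrite [X in _ *m X]mx11_scalar mul_mx_scalar -[X in X *: _]/(lform a x).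
by rewrite scalerA -[RHS]scaleNr; congr (_ *: _); ring.
Qed.

Lemma lrefl_lorentz a x : lform a a != 0 -> lorentz (lrefl a *m x) = lorentz x.
Proof.
move=> a0; rewrite lreflE !lorentzE !lformB (lformC x a); field.
exact: a0.
Qed.

Lemma det_lrefl a : lform a a != 0 -> \det (lrefl a) = -1.
Proof.
move=> a0; rewrite det_1_rank1 -scalemxAr mxE -/(lform a a).
by field; exact: a0.
Qed.

(** The transvection along the geodesic from [p] to [q]: the product of the
    reflections in [p] and in the midpoint direction [p + q]. *)
Definition transvection p q := lrefl (p + q) *m lrefl p.

Section Transvection.
Variables (p q : vec) (Hp : hspace p) (Hq : hspace q).

Let b := lform p q.

Let b_lt0 : b < 0.
Proof. by apply: lform_future; exact: hspace_future. Qed.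

Let u_form : lform (p + q) (p + q) = - 2 * (1 - b).
Proof. by rewrite !lformB (lformC q p) !hspace_lorentz // -/b; ring. Qed.

Let u_form_neq0 : lform (p + q) (p + q) != 0.
Proof. by rewrite u_form; have h := b_lt0; rewrite ltr0_neq0 //; lra. Qed.

Lemma transvectionE x : transvection p q *m x =
  x - (2 * lform p x) *: q + (lform (p + q) x / (1 - b)) *: (p + q).
Proof.
rewrite -mulmxA !lreflE u_form hspace_lorentz //.
rewrite invrN1 mulrN1 scaleNr opprK !lformB hspace_lorentz // (lformC q p) -/b.
have h : 1 - b != 0 by have h := b_lt0; rewrite lt0r_neq0 //; lra.
by apply/colP => i; rewrite !mxE; field; exact: h.
Qed.

Lemma transvection_point : transvection p q *m p = q.
Proof.
rewrite transvectionE !lformB hspace_lorentz // (lformC q p) -/b.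
have h : 1 - b != 0 by have h := b_lt0; rewrite lt0r_neq0 //; lra.
have -> : (-1 + b) / (1 - b) = -1 by field; exact: h.
by rewrite mulrN1 scaleNr opprK scaleN1r scaler_nat mulr2n opprD addrACA addrA subrr add0r addrK.
Qed.

Lemma transvection_hisom_plus : hisom_plus (transvection p q).
Proof.
have p0 : lform p p != 0 by rewrite hspace_lorentz // oppr_eq0 oner_eq0.
have lorT x : lorentz (transvection p q *m x) = lorentz x.
  by rewrite -mulmxA !lrefl_lorentz.
split; last by rewrite det_mulmx !det_lrefl // mulrNN mulr1 ltr01.
split=> // x lx.
have futT y : future y -> future (transvection p q *m y).
  move=> fy; have [ly y0] := fy.
  apply: (@future_of_lform _ q); [by rewrite lorT | exact: hspace_future |].
  rewrite -{2}transvection_point lform_isom //.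
  by apply: lform_future => //; exact: hspace_future.
have x0 : x ord0 ord0 != 0.
  apply: contraTneq lx => x0; rewrite lorentzE lformE x0 mul0r oppr0 add0r -leNgt.
  by rewrite sumr_ge0 // => i _; rewrite -expr2 sqr_ge0.
case: (ltgtP (x ord0 ord0) 0) x0 => // x0 _; last first.
  by have [_ h] := futT x (conj lx x0); rewrite !gtr0_sg.
have fNx : future (- x).
  by split; [rewrite lorentzE !lformB opprK -lorentzE | rewrite mxE oppr_gt0].
have [_] := futT _ fNx; rewrite mulmxN mxE oppr_gt0 => h.
by rewrite !ltr0_sg.
Qed.

(** The only denominator in [transvectionE] is at least 1, so that the distortion
    is controlled by the coordinates of [p] and [q]. *)
Lemma transvection_bound (r m : R) z (i : 'I_n.+1) :
  0 <= m -> 0 <= r -> (forall i, `|p i ord0| <= r) -> (forall i, `|q i ord0| <= r) ->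
  z ord0 ord0 = 0 -> (forall i, `|z i ord0| <= m) ->
  `|(transvection p q *m z) i ord0| <= m * (1 + 6 * n%:R * r ^+ 2).
Proof.
move=> m0 r0 hp hq z0 hz.
have B y t : (forall i, `|y i ord0| <= t) -> `|lform y z| <= n%:R * (t * m).
  move=> hy; rewrite lformE z0 mulr0 oppr0 add0r.
  apply: le_trans (ler_norm_sum _ _ _) _.
  apply: le_trans (ler_sum _ (_ : forall i, true -> _ <= t * m)) _.
    by move=> j _; rewrite normrM ler_pM.
  by rewrite sumr_const card_ord mulr_natl lexx.
have hpq j : `|(p + q) j ord0| <= 2 * r.
  by rewrite mxE; apply: le_trans (ler_normD _ _) _; rewrite mulr2n mulrDl mul1r lerD.
have Bp := B _ _ hp; have Bpq := B _ _ hpq.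
have -> : (transvection p q *m z) i ord0 =
    z i ord0 - 2 * lform p z * q i ord0 + lform (p + q) z / (1 - b) * (p + q) i ord0.
  by rewrite transvectionE !mxE.
apply: le_trans (ler_normD _ _) _.
have h1 : `|z i ord0 + - (2 * lform p z * q i ord0)| <= m + 2 * (n%:R * (r * m)) * r.
  apply: le_trans (ler_normB _ _) _; apply: lerD => //.
  rewrite normrM; apply: ler_pM => //.
  by rewrite normrM ger0_norm ?ler0n // ler_pM2l // ltr0n.
have h2 : `|lform (p + q) z / (1 - b) * (p + q) i ord0| <= n%:R * (2 * r * m) * (2 * r).
  rewrite normrM; apply: ler_pM => //; rewrite normrM.
  apply: (@le_trans _ _ (`|lform (p + q) z| * 1)); last by rewrite mulr1.
  apply: ler_wpM2l => //; rewrite normfV invf_le1; last by rewrite normr_gt0; have h := b_lt0; rewrite lt0r_neq0 //; lra.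
  by rewrite ger0_norm; have := b_lt0; lra.
apply: le_trans (lerD h1 _) _; first exact: h2.
by rewrite le_eqVlt; apply/orP; left; apply/eqP; ring.
Qed.

End Transvection.

End LorentzForm.

(** * Hyperbolic volume as the volume of a cone *)

Section HyperbolicMeasure.
Variables (R : realType) (n : nat).
Local Notation leb := (@lebesgue_measure R).
Local Notation vec := 'cV[R]_n.+1.
Implicit Types (X Y : set vec) (v : 'cV[R]_n) (x : vec).

Definition sqnorm v : R := \sum_(i < n) v i ord0 ^+ 2.

Lemma sqnorm_ge0 v : 0 <= sqnorm v.
Proof. by apply: sumr_ge0 => i _; exact: sqr_ge0. Qed.

Lemma sqnormZ a v : sqnorm (a *: v) = a ^+ 2 * sqnorm v.
Proof. by rewrite /sqnorm mulr_sumr; apply: eq_bigr => i _; rewrite mxE exprMn. Qed.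

Lemma height_gt0 v : 0 < height v.
Proof. by rewrite sqrtr_gt0 ltr_pwDl // sqnorm_ge0. Qed.

Lemma height_ge1 v : 1 <= height v.
Proof.
rewrite -[X in X <= _]sqrtr1 ler_wsqrtr // lerDl; exact: sqnorm_ge0.
Qed.

Lemma lorentz_vcons t v : lorentz (vcons (t, v)) = sqnorm v - t ^+ 2.
Proof.
rewrite /lorentz vcons0 /= addrC; congr (_ - _).
by apply: eq_bigr => i _; rewrite vconsS.
Qed.

Lemma hpointE v : hpoint v = vcons (height v, v).
Proof. by []. Qed.

Lemma measurable_sqrt : measurable_fun setT (Num.sqrt : R -> R).
Proof. exact: continuous_measurable_fun (@sqrt_continuous R). Qed.

Lemma measurable_sqnorm : measurable_fun setT sqnorm.
Proof.
apply: measurable_sum => i; apply: measurable_funX; exact: measurable_coor.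
Qed.

Lemma measurable_height : measurable_fun setT (@height R n).
Proof.
apply: (measurableT_comp measurable_sqrt); apply: measurable_funD => //.
exact: measurable_sqnorm.
Qed.

Lemma measurable_hpoint : measurable_fun setT (@hpoint R n).
Proof.
apply: measurable_vecP => i; under eq_fun do rewrite hpointE.
case: (unliftP ord0 i) => [j ->|->].
  by under eq_fun do rewrite vconsS; exact: measurable_coor.
by under eq_fun do rewrite vcons0; exact: measurable_height.
Qed.

Lemma measurable_lorentz : measurable_fun setT (@lorentz R n).
Proof.
apply: measurable_funD.
  apply: measurable_funN; apply: measurable_funX; exact: measurable_coor.
apply: measurable_sum => i; apply: measurable_funX; exact: measurable_coor.
Qed.

Lemma measurable_inv : measurable_fun setT (fun r : R => r^-1).
Proof.
have m0 : measurable ([set 0] : set R) by [].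
rewrite -(setvU [set 0]) ; apply/measurable_funU => //; first exact: measurableC.
split.
  apply: open_continuous_measurable_fun.
    by rewrite openC; exact: closed_eq.
  by move=> r; rewrite inE => /eqP r0; exact: inv_continuous.
exact: measurable_fun_set1.
Qed.

Local Open Scope ereal_scope.

Definition hdensity X v : \bar R := (\1_X (hpoint v) / height v)%:E.

Definition hmeasure X : \bar R := \int[vleb R n]_v hdensity X v.

Lemma hdensity_ge0 X v : 0 <= hdensity X v.
Proof. by rewrite lee_fin divr_ge0 // ltW // height_gt0. Qed.

Lemma measurable_hdensity X : measurable X -> measurable_fun setT (hdensity X).
Proof.
move=> mX; apply/measurable_EFinP; apply: measurable_funM.
  exact: (measurableT_comp (measurable_indic mX) measurable_hpoint).
exact: (measurableT_comp measurable_inv measurable_height).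
Qed.

Lemma hmeasure_ge0 X : 0 <= hmeasure X.
Proof. by apply: integral_ge0 => v _; exact: hdensity_ge0. Qed.

Lemma hvolumeE X : measurable X -> hvolume X = fine (hmeasure X).
Proof.
move=> mX; rewrite /hvolume lebesgue_iintE //; last exact: hdensity_ge0.
exact: measurable_hdensity.
Qed.

(** The part between the hyperboloids of radii 1 and 2 of the cone over [X];
    the thickness keeps it away from the apex, where the radial coordinate
    degenerates. *)
Definition thick_cone X : set vec := [set x : vec | [/\ (0 < x ord0 ord0)%R,
  (1 <= - lorentz x <= 4)%R & X (radial x)]].

Lemma measurable_radial : measurable_fun setT (@radial R n).
Proof.
apply: measurable_vecP => i; under eq_fun do rewrite mxE.
apply: measurable_funM; last exact: measurable_coor.
apply: (measurableT_comp measurable_inv); apply: (measurableT_comp measurable_sqrt).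
by apply: measurable_funN; exact: measurable_lorentz.
Qed.

Lemma measurable_preimage d d' (T : measurableType d) (U : measurableType d')
  (f : T -> U) (A : set U) : measurable_fun setT f -> measurable A -> measurable (f @^-1` A).
Proof. by move=> mf mA; rewrite -[X in measurable X]setTI; exact: mf. Qed.

Lemma measurable_thick_cone X : measurable X -> measurable (thick_cone X).
Proof.
move=> mX.
rewrite (_ : thick_cone X = (fun x : vec => x ord0 ord0) @^-1` `]0%R, +oo[ `&`
   ((fun x : vec => - lorentz x)%R @^-1` `[1%R, 4%R] `&` (@radial R n) @^-1` X)); last first.
  apply/seteqP; split => x /=; rewrite !in_itv /= andbT; first by case.
  by move=> [? [? ?]].
apply: measurableI.
  by apply: measurable_preimage; [exact: measurable_coor | exact: measurable_itv].
apply: measurableI; last exact: measurable_preimage measurable_radial mX.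
apply: measurable_preimage; last exact: measurable_itv.
by apply: measurable_funN; exact: measurable_lorentz.
Qed.

(** The line over [v] crosses the cone in the points of radius between 1 and 2,
    and the speed of this parametrisation by the radius [r] is the factor
    [1 / height] of the volume element at [r^-1 *: v]. *)
Lemma thick_cone_slice X v : measurable X ->
  \int[leb]_t (\1_(thick_cone X) (vcons (t, v)))%:E =
  \int[leb]_(r in `[1%R, 2%R]) hdensity X (r^-1 *: v).
Proof.
move=> mX; set s := sqnorm v; have s0 : (0 <= s)%R := sqnorm_ge0 v.
pose A : set R := [set t | X (radial (vcons (t, v)))].
have mA : measurable A.
  apply: (measurable_preimage (f := fun t : R => radial (vcons (t, v)))) mX.
  apply: (measurableT_comp measurable_radial).
  apply: (measurableT_comp (@measurable_vcons R n)).
  exact: measurable_fun_pair.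
transitivity (\int[leb]_t
    (\1_(A `&` `[lift_radius s 1, lift_radius s 2]) t)%:E).
  apply: eq_integral => t _; congr EFin; rewrite !indicE; congr (nat_of_bool _)%:R.
  apply/idP/idP; rewrite !inE /thick_cone /=.
    move=> []; rewrite vcons0 lorentz_vcons opprB -/s => /= t0 /andP[t1 t2] At.
    split=> //; rewrite /= in_itv /=.
    have te : t = Num.sqrt (t ^+ 2) by rewrite sqrtr_sqr gtr0_norm.
    rewrite te.
    by apply/andP; split; rewrite ler_wsqrtr //; lra.
  move=> [At]; rewrite /= in_itv /= => /andP[t1 t2].
  have t0 : (0 < t)%R by apply: lt_le_trans t1; rewrite lift_radius_gt0.
  split; rewrite ?vcons0 // lorentz_vcons opprB -/s.
  have : (lift_radius s 1 ^+ 2 <= t ^+ 2)%R by rewrite ler_pXn2r ?nnegrE ?lift_radius_ge0 // ltW.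
  have : (t ^+ 2 <= lift_radius s 2 ^+ 2)%R by rewrite ler_pXn2r ?nnegrE ?lift_radius_ge0 // ltW.
  by rewrite !sqr_lift_radius // => h2 h1; apply/andP; split; lra.
rewrite radial_substitution //; apply: eq_integral => r.
rewrite inE /= in_itv /= => /andP[r1 _].
have r0 : (0 < r)%R by exact: lt_le_trans r1.
have hr : (height (r^-1 *: v) = lift_radius s r / r)%R.
  rewrite /height -/(sqnorm _) sqnormZ -/s -[X in (_ / X)%R](gtr0_norm r0) -sqrtr_sqr.
  rewrite -sqrtrV ?sqr_ge0 // -sqrtrM; last by rewrite addr_ge0 ?sqr_ge0.
  by congr Num.sqrt; field; rewrite gt_eqF.
rewrite /hdensity hr invf_div -/(lift_speed s r) !indicE; congr ((_%:R * _)%:E).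
have -> // : (lift_radius s r \in A) = (hpoint (r^-1 *: v) \in X).
rewrite /A; apply/idP/idP; rewrite !inE /=.
all: rewrite /radial lorentz_vcons sqr_lift_radius // opprB addrK sqrtr_sqr gtr0_norm //.
all: have -> // : r^-1 *: vcons (lift_radius s r, v) = hpoint (r^-1 *: v).
all: rewrite hpointE hr; apply/colP => i; rewrite mxE.
all: by case: (unliftP ord0 i) => [j ->|->]; rewrite !(vconsS, vcons0) /= ?mxE // mulrC.
Qed.

Definition radial_mass : \bar R := \int[leb]_(r in `[1%R, 2%R]) (r ^+ n)%:E.

Let measurable_EFin_exp : measurable_fun setT (fun r : R => (r ^+ n)%:E).
Proof. by apply/measurable_EFinP; apply: measurable_funX. Qed.

Lemma radial_mass_ge1 : 1 <= radial_mass.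
Proof.
have h : \int[leb]_(r in (`[1%R, 2%R]%classic : set R)) (cst 1 r) = 1 :> \bar R.
  rewrite integral_cst //= mul1e lebesgue_measure_itv /= lte_fin ltr1n -EFinB.
  by congr EFin; lra.
rewrite -[X in X <= _]h; apply: ge0_le_integral => //.
- exact: measurable_funTS measurable_EFin_exp.
- by move=> r /=; rewrite in_itv /= => /andP[r1 _]; rewrite lee_fin exprn_ege1.
Qed.

Lemma radial_mass_fin : radial_mass < +oo.
Proof.
have h : \int[leb]_(r in (`[1%R, 2%R]%classic : set R)) (cst ((2 ^+ n)%R%:E) r) = (2 ^+ n)%R%:E :> \bar R.
  rewrite integral_cst //= lebesgue_measure_itv /= lte_fin ltr1n -EFinB -EFinM.
  by congr EFin; ring.
apply: (@le_lt_trans _ _ ((2 ^+ n)%R%:E)); last exact: ltry.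
rewrite -[X in _ <= X]h; apply: ge0_le_integral => //.
- move=> r /=; rewrite in_itv /= => /andP[r1 _].
  by rewrite lee_fin exprn_ge0 // (le_trans ler01).
- exact: measurable_funTS measurable_EFin_exp.
- move=> r /=; rewrite in_itv /= => /andP[r1 r2].
  by rewrite lee_fin lerXn2r // ?nnegrE // (le_trans ler01).
Qed.

(** Slicing the thick cone by the radius shows every slice to be a copy of [X]
    scaled by the radius, so that its Euclidean volume is a fixed multiple of
    the hyperbolic volume of [X]. *)
Lemma thick_cone_volume X : measurable X ->
  \int[vleb R n.+1]_x (\1_(thick_cone X) x)%:E = radial_mass * hmeasure X.
Proof.
move=> mX; rewrite tonelli_vleb2 //; last first.
  by apply/measurable_EFinP; apply: measurable_indic; exact: measurable_thick_cone.
under eq_integral => v _ do rewrite thick_cone_slice // integral_mkcond.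
pose F (p : measurableTypeR R * 'cV[R]_n) : \bar R :=
  ((hdensity X \o (fun v => p.1^-1 *: v)) p.2) * (\1_(`[1%R, 2%R]%classic : set R) p.1)%:E.
have F0 p : 0 <= F p by rewrite mule_ge0 // ?hdensity_ge0 // lee_fin.
have FE v r : ((fun r : R => hdensity X (r^-1 *: v)) \_ `[1%R, 2%R]) r = F (r, v).
  by rewrite /F patchE indicE /=; case: (_ \in _); rewrite ?mule1 ?mule0.
have mF : measurable_fun setT F.
  apply: emeasurable_funM.
    apply: (measurableT_comp (f := hdensity X)); first exact: measurable_hdensity.
    apply: measurable_vecP => i; under eq_fun do rewrite mxE.
    apply: measurable_funM; first exact: (measurableT_comp measurable_inv measurable_fst).
    exact: (measurableT_comp (measurable_coor i) measurable_snd).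
  apply/measurable_EFinP.
  apply: (measurableT_comp (measurable_indic (measurable_itv _)) measurable_fst).
under eq_integral => v _.
  under eq_integral => r _ do rewrite FE.
  over.
rewrite -(fubini_tonelli (m1 := leb) (m2 := vleb R n) F mF F0).
rewrite /radial_mass -ge0_integralZr //; last 3 first.
- exact: measurable_funTS measurable_EFin_exp.
- move=> r /=; rewrite in_itv /= => /andP[r1 _].
  by rewrite lee_fin exprn_ge0 // (le_trans ler01).
- exact: hmeasure_ge0.
rewrite [RHS]integral_mkcond.
apply: eq_integral => r _; rewrite patchE /F /= indicE.
case: ifPn => [r12|_]; last first.
  by rewrite integral0_eq // => v _; rewrite mule0.
have r0 : (0 < r)%R.
  by move: r12; rewrite inE /= in_itv /= => /andP[r1 _]; exact: lt_le_trans r1.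
under eq_integral => v _ do rewrite mule1.
have uA : (r^-1)%:M \in (unitmx : pred 'M[R]_n).
  by rewrite unitmxE det_scalar unitfE expf_neq0 // invr_neq0 // gt_eqF.
rewrite /hmeasure -(linear_change_of_variables uA (measurable_hdensity mX) (@hdensity_ge0 X)).
rewrite muleA -EFinM det_scalar normrX normfV gtr0_norm // -exprMn divff ?gt_eqF //.
rewrite expr1n mul1e; apply: eq_integral => v _.
by rewrite mul_scalar_mx.
Qed.

End HyperbolicMeasure.

(** * The hyperbolic measure *)

Section HyperbolicMeasureTheory.
Variables (R : realType) (n : nat).
Local Notation leb := (@lebesgue_measure R).
Local Notation vec := 'cV[R]_n.+1.
Implicit Types (X Y : set vec) (A : 'M[R]_n.+1) (l : 'rV[R]_n.+1).
Local Open Scope ereal_scope.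

Lemma hmeasure_restrict X : hmeasure X =
  \int[vleb R n]_(v in @hpoint R n @^-1` X) (height v)^-1%:E.
Proof.
rewrite /hmeasure [RHS]integral_mkcond; apply: eq_integral => v _.
have E : (hpoint v \in X) = (v \in @hpoint R n @^-1` X) by apply/idP/idP; rewrite !inE.
rewrite /hdensity patchE indicE E.
by case: (_ \in _); rewrite ?mul1r // mul0r.
Qed.

Let hmeasure0 : hmeasure (set0 : set vec) = 0.
Proof. by rewrite hmeasure_restrict preimage_set0 integral_set0. Qed.

Let hmeasure_sigma_additive : semi_sigma_additive (@hmeasure R n).
Proof.
move=> F mF tF mUF; rewrite hmeasure_restrict preimage_bigcup.
rewrite ge0_integral_bigcup.
- under eq_fun do under eq_bigr do rewrite hmeasure_restrict.
  by apply: is_cvg_nneseries => k _ _; rewrite -hmeasure_restrict hmeasure_ge0.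
- by move=> k; apply: measurable_preimage (mF k); exact: measurable_hpoint.
- apply/measurable_EFinP; apply: measurable_funTS.
  exact: (measurableT_comp (@measurable_inv R) (@measurable_height R n)).
- by move=> v _; rewrite lee_fin invr_ge0 ltW // height_gt0.
- apply/trivIsetP => i j _ _ ij; move/trivIsetP : tF => /(_ i j I I ij) h.
  by rewrite -preimage_setI h preimage_set0.
Qed.

HB.instance Definition _ := isMeasure.Build _ ('cV[R]_n.+1 : measurableType _) R
  (@hmeasure R n) hmeasure0 (@hmeasure_ge0 R n) hmeasure_sigma_additive.

Lemma imageM_preimage A X : A \in unitmx ->
  [set A *m x | x in X] = (fun x => invmx A *m x) @^-1` X.
Proof.
move=> uA; apply/seteqP; split => [_ [x Xx <-]|x Xx] /=; first by rewrite mulKmx.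
by exists (invmx A *m x) => //; rewrite mulKVmx.
Qed.

Lemma measurable_imageM A X : A \in unitmx -> measurable X ->
  measurable [set A *m x | x in X].
Proof.
move=> uA mX; rewrite imageM_preimage //.
by apply: measurable_preimage => //; exact: measurable_mulmx.
Qed.

Lemma radial_massE : exists2 c : R, (0 < c)%R & radial_mass R n = c%:E.
Proof.
have := radial_mass_ge1 R n; have := radial_mass_fin R n.
case: (radial_mass R n) => // c _; rewrite lee_fin => c1.
by exists c => //; exact: lt_le_trans c1.
Qed.

Lemma muleI_pos (c : R) (a b : \bar R) : (0 < c)%R -> c%:E * a = c%:E * b -> a = b.
Proof.
move=> c0 /(congr1 (mule (c^-1)%:E)).
by rewrite !muleA -!EFinM mulVf ?gt_eqF // !mul1e.
Qed.

(** An isometry maps the thick cone over [X] to the thick cone over its image and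
    preserves Euclidean volume. *)
Theorem hmeasure_isom A X : hisom A -> measurable X ->
  hmeasure [set A *m x | x in X] = hmeasure X.
Proof.
move=> hA mX; have uA := hisom_unit hA.
have mAX := measurable_imageM uA mX.
have [c c0 cE] := radial_massE.
apply: (muleI_pos c0); rewrite -cE -!thick_cone_volume //.
have mf : measurable_fun setT (fun x : vec => (\1_(thick_cone [set A *m x | x in X]) x)%:E : \bar R).
  by apply/measurable_EFinP; apply: measurable_indic; exact: measurable_thick_cone.
rewrite -(linear_change_of_variables uA mf) => [|x]; last by rewrite lee_fin.
rewrite hisom_absdet // mul1e; apply: eq_integral => x _; congr EFin.
rewrite !indicE; congr (nat_of_bool _)%:R.
have lA : lorentz (A *m x) = lorentz x by case: hA.
have E : radial (A *m x) = A *m radial x by rewrite /radial lA scalemxAr.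
apply/idP/idP; rewrite !inE /thick_cone /= lA E.
  move=> [x0 /andP[l1 l4] [y Xy /(congr1 (mulmx (invmx A)))]].
  rewrite !mulKmx // => yx; split; rewrite ?l1 // -?yx //.
  by rewrite -(hisom_pos hA) //; lra.
move=> [x0 /andP[l1 l4] Xx]; split; rewrite ?l1 //; last by exists (radial x).
by rewrite hisom_pos //; lra.
Qed.

Lemma measurable_affine_hyperplane m (a : 'rV[R]_m) (c : R) :
  measurable [set v : 'cV[R]_m | (a *m v) ord0 ord0 = c].
Proof.
rewrite (_ : [set _ | _] = (fun v => (a *m v) ord0 ord0) @^-1` [set c]) //.
apply: measurable_preimage => //.
exact: (measurableT_comp (measurable_coor ord0) (@measurable_mulmx _ _ _ a)).
Qed.

Lemma slice_integral m (X : set 'cV[R]_m.+1) (t : R) : measurable X ->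
  vleb R m [set v | X (vcons (t, v))] = \int[vleb R m]_v (\1_X (vcons (t, v)))%:E.
Proof.
move=> mX; have mt : measurable_fun setT (fun v : 'cV[R]_m => vcons (t, v)).
  exact: (measurableT_comp (@measurable_vcons R m) (pair1_measurable t)).
have mXt := measurable_preimage mt mX.
transitivity (\int[vleb R m]_v (\1_[set v | X (vcons (t, v))] v)%:E).
  by rewrite integral_indic ?setIT.
by apply: eq_integral => v _; congr EFin; rewrite !indicE; congr (nat_of_bool _)%:R.
Qed.

Let measurable_EFin_indic d (T : measurableType d) (X : set T) : measurable X ->
  measurable_fun setT (fun x => (\1_X x)%:E : \bar R).
Proof. by move=> mX; apply/measurable_EFinP; exact: measurable_indic. Qed.

Lemma measurable_slice m (X : set 'cV[R]_m.+1) : measurable X ->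
  measurable_fun setT (fun t : R => vleb R m [set v | X (vcons (t, v))]).
Proof.
move=> mX; under eq_fun do rewrite slice_integral //.
apply: (@measurable_partial_vleb _ _ (fun x => (\1_X x)%:E)).
  exact: measurable_EFin_indic.
by move=> x; rewrite lee_fin.
Qed.

Lemma vleb_slice m (X : set 'cV[R]_m.+1) : measurable X ->
  vleb R m.+1 X = \int[leb]_t vleb R m [set v | X (vcons (t, v))].
Proof.
move=> mX; transitivity (\int[vleb R m.+1]_x (\1_X x)%:E).
  by rewrite integral_indic // setIT.
rewrite tonelli_vleb1 //; last exact: measurable_EFin_indic.
by apply: eq_integral => t _; rewrite slice_integral.
Qed.

Lemma affine_hyperplane_null m (a : 'rV[R]_m) (c : R) : a != 0%R ->
  vleb R m [set v | (a *m v) ord0 ord0 = c] = 0.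
Proof.
elim: m a c => [|m IH] a c a0; first by case/eqP: a0; apply/rowP => -[].
pose a' : 'rV[R]_m := \row_j a ord0 (lift ord0 j).
have aE t v : (a *m vcons (t, v)) ord0 ord0 = (a ord0 ord0 * t + (a' *m v) ord0 ord0)%R.
  rewrite mxE big_ord_recl vcons0 /=; congr (_ + _)%R.
  by rewrite mxE; apply: eq_bigr => j _; rewrite vconsS mxE.
rewrite vleb_slice; last exact: measurable_affine_hyperplane.
have [a'0|a'0] := eqVneq a' 0%R; last first.
  rewrite integral0_eq // => t _.
  rewrite (_ : [set v | _] = [set v | (a' *m v) ord0 ord0 = c - a ord0 ord0 * t]%R) ?IH //.
  by apply/seteqP; split => v /=; rewrite aE => h; lra.
have a00 : a ord0 ord0 != 0%R.
  apply: contraNneq a0 => h; apply/eqP/rowP => j; rewrite mxE.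
  by case: (unliftP ord0 j) => [k ->|->] //; move/rowP: a'0 => /(_ k); rewrite !mxE.
set f := fun t : R => _; pose t0 := (c / a ord0 ord0)%R.
transitivity (\int[leb]_t (f \_ [set t0]) t); last first.
  by rewrite -integral_mkcond integral_set1.
apply: eq_integral => t _; rewrite patchE; case: ifPn => // tt0.
rewrite /f (_ : [set v | _] = set0) ?measure0 //.
apply/seteqP; split => // v /=; rewrite aE a'0 mul0mx mxE addr0 => h.
by move: tt0; rewrite notin_setE; apply; rewrite /= /t0 -h mulrAC divff // mul1r.
Qed.

Lemma measurable_hspace : measurable (@hspace R n).
Proof.
rewrite (_ : @hspace R n = (@lorentz R n) @^-1` [set (-1)%R] `&`
  (fun x : vec => x ord0 ord0) @^-1` `]0%R, +oo[); last first.
  by apply/seteqP; split => x /=; rewrite in_itv /= andbT.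
apply: measurableI; first by apply: measurable_preimage => //; exact: measurable_lorentz.
apply: measurable_preimage; [exact: measurable_coor | exact: measurable_itv].
Qed.

Definition lval l (x : vec) : R := (l *m x) ord0 ord0.

Lemma lvalZ l (a : R) (x : vec) : lval l (a *: x) = (a * lval l x)%R.
Proof. by rewrite /lval -scalemxAr mxE. Qed.

Lemma measurable_lval l : measurable_fun setT (lval l).
Proof.
exact: (measurableT_comp (measurable_coor ord0) (@measurable_mulmx _ _ _ l)).
Qed.

(** The cone over a hyperplane section lies in a hyperplane of the ambient
    space. *)
Theorem hmeasure_hyperplane l : l != 0%R ->
  hmeasure [set x | lval l x = 0%R] = 0.
Proof.
move=> l0; have [c c0 cE] := radial_massE.
have mX : measurable [set x | lval l x = 0%R] by exact: measurable_affine_hyperplane.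
apply: (muleI_pos c0); rewrite mule0 -cE -thick_cone_volume //.
have mC := measurable_thick_cone mX.
rewrite integral_indic // setIT; apply/eqP; rewrite eq_le measure_ge0 andbT.
rewrite -(affine_hyperplane_null 0 l0); apply: le_measure; rewrite ?inE //.
move=> x [x0 /andP[l1 l4]] /eqP; rewrite /radial lvalZ mulf_eq0 invr_eq0.
by rewrite sqrtr_eq0 leNgt (lt_le_trans ltr01 l1) /= => /eqP.
Qed.

(** A ball about the base point of the hyperboloid; [r] is the hyperbolic cosine
    of its radius. *)
Definition hball (r : R) : set vec := [set x | hspace x /\ (x ord0 ord0 <= r)%R].

Lemma measurable_hball (r : R) : measurable (hball r).
Proof.
rewrite (_ : hball r = @hspace R n `&` (fun x : vec => x ord0 ord0) @^-1` `]-oo, r]).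
  apply: measurableI; first exact: measurable_hspace.
  by apply: measurable_preimage; [exact: measurable_coor | exact: measurable_itv].
by apply/seteqP; split => x /=; rewrite in_itv.
Qed.

Lemma hspace_coor_le (x : vec) i : hspace x -> (`|x i ord0| <= x ord0 ord0)%R.
Proof.
move=> [lx x0]; case: (unliftP ord0 i) => [j ->|->]; last by rewrite gtr0_norm.
rewrite -ler_sqr ?nnegrE ?(ltW x0) // real_normK ?num_real //.
move: lx; rewrite /lorentz (bigD1 j) //= => lx.
have : (0 <= \sum_(i < n | i != j) x (lift ord0 i) ord0 ^+ 2)%R.
  by apply: sumr_ge0 => k _; exact: sqr_ge0.
lra.
Qed.

Definition vbox m (r : R) : set 'cV[R]_m := [set v | forall i, `|v i ord0| <= r]%R.

Lemma measurable_vbox m (r : R) : measurable (vbox r : set 'cV[R]_m).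
Proof.
rewrite (_ : vbox r = \bigcap_(i in [set: 'I_m])
    ((fun v : 'cV[R]_m => v i ord0) @^-1` `[(- r)%R, r]%classic)).
  apply: fin_bigcap_measurable => // i _.
  by apply: measurable_preimage; [exact: measurable_coor | exact: measurable_itv].
apply/seteqP; split => v /= h i; first by move=> _; rewrite /= in_itv /= -ler_norml.
by have := h i I; rewrite /= in_itv /= -ler_norml.
Qed.

Lemma vbox_le m (r : R) : (0 <= r)%R ->
  vleb R m (vbox r) <= ((2 * r) ^+ m)%:E.
Proof.
have mbox k := @measurable_vbox k r.
move=> r0; elim: m => [|m IH]; first by rewrite /= diracE expr0 lee_fin lern1 leq_b1.
rewrite vleb_slice //.
apply: (@le_trans _ _ (\int[leb]_t (((2 * r) ^+ m)%:E * (\1_(`[(- r)%R, r]%classic : set R) t)%:E))); last first.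
  rewrite ge0_integralZl //; last 2 first.
  - exact: measurable_EFin_indic.
  - by rewrite lee_fin exprn_ge0 // mulr_ge0.
  have -> : \int[leb]_t (\1_(`[(- r)%R, r]%classic : set R) t)%:E = leb `[(- r)%R, r]%classic.
    by rewrite integral_indic // setIT.
  rewrite lebesgue_measure_itv /=.
  case: ifP => _; last by rewrite mule0 lee_fin exprn_ge0 // mulr_ge0.
  by rewrite -EFinB -EFinM lee_fin exprSr le_eqVlt; apply/orP; left; apply/eqP; ring.
have mg : measurable_fun setT (fun t : measurableTypeR R =>
    ((2 * r) ^+ m)%:E * (\1_(`[(- r)%R, r]%classic : set R) t)%:E).
  apply/measurable_EFinP; apply: (@measurable_funM _ (measurableTypeR R) R setT (cst _)) => //.
apply: ge0_le_integral => //.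
- exact: (measurable_slice (mbox m.+1)).
move=> t _; rewrite indicE; case: (boolP (t \in _)) => tr.
  rewrite mule1; apply: le_trans IH; apply: le_measure; rewrite ?inE //.
    have mt : measurable_fun setT (fun v : 'cV[R]_m => vcons (t, v)).
      exact: (measurableT_comp (@measurable_vcons R m) (pair1_measurable t)).
    exact: measurable_preimage mt (mbox m.+1).
    exact: mbox.
  by move=> v h i; have := h (lift ord0 i); rewrite vconsS.
rewrite mule0 (_ : [set v | _] = set0) ?measure0 //.
apply/seteqP; split => // v /(_ ord0); rewrite vcons0 /= ler_norml => h.
by move: tr; rewrite notin_setE /= in_itv /= h.
Qed.

Lemma hmeasure_le X (B : set 'cV[R]_n) : measurable X -> measurable B ->
  @hpoint R n @^-1` X `<=` B -> hmeasure X <= vleb R n B.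
Proof.
move=> mX mB XB; have <- : \int[vleb R n]_v (\1_B v)%:E = vleb R n B.
  by rewrite integral_indic // setIT.
apply: ge0_le_integral => //.
- by move=> v _; exact: hdensity_ge0.
- exact: measurable_hdensity.
- exact: measurable_EFin_indic.
move=> v _; rewrite lee_fin !indicE; case: (boolP (hpoint v \in X)) => [|_].
  rewrite inE => /XB vB; rewrite mem_set // mul1r invf_le1 ?height_ge1 //.
  exact: height_gt0.
by rewrite mul0r.
Qed.

(** In the chart [hpoint] the ball is bounded, and the density is at most 1. *)
Lemma hmeasure_hball_fin (r : R) : hmeasure (hball r) < +oo.
Proof.
have [r0|r0] := leP 0%R r; last first.
  rewrite (_ : hball r = set0) ?hmeasure0 ?ltry //.
  apply/seteqP; split => // x [[_ x0] xr].
  by have := lt_trans (lt_le_trans x0 xr) r0; rewrite ltxx.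
have mB := @measurable_vbox n r.
apply: (@le_lt_trans _ _ (((2 * r) ^+ n)%:E)); last exact: ltry.
apply: le_trans (vbox_le n r0); apply: hmeasure_le => //.
  exact: measurable_hball.
move=> v [hv vr] i; apply: le_trans vr.
by have := hspace_coor_le (lift ord0 i) hv; rewrite hpointE vconsS.
Qed.

Definition slab l (d : R) : set vec := [set x | `|lval l x| <= d]%R.

Lemma measurable_slab l (d : R) : measurable (slab l d).
Proof.
rewrite (_ : slab l d = lval l @^-1` `[(- d)%R, d]%classic).
  by apply: measurable_preimage; [exact: measurable_lval | exact: measurable_itv].
by apply/seteqP; split => x /=; rewrite /slab /= in_itv /= -ler_norml.
Qed.

(** The slabs shrink to a hyperplane, which is null. *)
Lemma hmeasure_slab l (r e : R) : l != 0%R -> (0 < e)%R ->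
  exists2 d : R, (0 < d)%R & hmeasure (hball r `&` slab l d) <= e%:E.
Proof.
move=> l0 e0.
pose F k := hball r `&` slab l (k.+1%:R^-1).
have mF k : measurable (F k).
  by apply: measurableI; [exact: measurable_hball | exact: measurable_slab].
have mcap : measurable (\bigcap_k F k) by exact: bigcap_measurable.
have Foo : hmeasure (F 0%N) < +oo.
  apply: le_lt_trans (hmeasure_hball_fin r); apply: le_measure; rewrite ?inE //.
    exact: measurable_hball.
  exact: subIsetl.
have ndF : nonincreasing_seq F.
  move=> i j ij; apply/subsetPset => x [xr h]; split => //; apply: le_trans h _.
  by rewrite lef_pV2 ?posrE // ler_nat ltnS.
have cv := nonincreasing_cvg_mu (mu := @hmeasure R n) Foo mF mcap ndF.
have E : hmeasure (\bigcap_k F k) = 0.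
  apply/eqP; rewrite eq_le hmeasure_ge0 andbT -(hmeasure_hyperplane l0).
  apply: le_measure; rewrite ?inE //; first exact: measurable_affine_hyperplane.
  move=> x h /=; apply/eqP; rewrite -normr_le0; apply/ler_addgt0Pr => d d0.
  have [_] := h (Num.truncn d^-1) I; rewrite /= add0r => /le_trans; apply.
  by rewrite -[X in (_ <= X)%R]invrK lef_pV2 ?posrE ?invr_gt0 // ltW // truncnS_gt.
have : @hmeasure R n \o F @ \oo --> (0 : \bar R) by rewrite -E; exact: cv.
move=> /fine_cvgP[Ffin /cvgrPdist_le /(_ _ e0)] [N _ hN].
case: Ffin => N' _ hN'; pose k := maxn N N'.
exists k.+1%:R^-1%R; first by rewrite invr_gt0.
have /= := hN k (leq_maxl _ _); rewrite sub0r normrN ger0_norm; last exact/fine_ge0/hmeasure_ge0.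
by have kfin := hN' k (leq_maxr _ _); rewrite -lee_fin fineK.
Qed.

End HyperbolicMeasureTheory.

(** * Simplices as traces of cones *)

Section SimplicialCones.
Variables (R : realType) (n : nat).
Local Notation vec := 'cV[R]_n.+1.
Local Notation mat := 'M[R]_n.+1.
Implicit Types (x y : vec) (V W : mat) (l : 'rV[R]_n.+1) (s t : seq mat).

Definition nonneg_coords (b : vec) := forall i, 0 <= b i ord0.

(** A geometric simplex as the trace of a simplicial cone. The spanning vectors,
    unlike the vertices, may be rescaled freely. *)
Definition scone V : set vec :=
  [set x | hspace x /\ exists2 b, nonneg_coords b & x = V *m b].

Definition future_basis V := V \in unitmx /\ forall j, future (col j V).

Lemma mulmx_cols V (b : vec) : V *m b = \sum_j b j ord0 *: col j V.
Proof.
apply/colP => i; rewrite mxE summxE; apply: eq_bigr => j _.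
by rewrite !mxE mulrC.
Qed.

Lemma future_sum (I : finType) (b : I -> R) (v : I -> vec) :
  (forall i, 0 <= b i) -> (forall i, future (v i)) -> (exists i, 0 < b i) ->
  future (\sum_i b i *: v i).
Proof.
move=> b0 fv [i0 bi0]; rewrite (bigD1 i0) //=.
suff [->|h] : \sum_(i | i != i0) b i *: v i = 0 \/ future (\sum_(i | i != i0) b i *: v i).
- by rewrite addr0; exact: futureZ.
- by apply: futureD => //; exact: futureZ.
apply: (big_ind (fun x : vec => x = 0 \/ future x)) => [|x y|i _]; first by left.
- move=> [->|fx] [->|fy]; rewrite ?addr0 ?add0r; [by left|by right|by right|right].
  exact: futureD.
- have := b0 i; rewrite le_eqVlt => /orP[/eqP <-|bi]; first by left; rewrite scale0r.
  by right; exact: futureZ.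
Qed.

Lemma future_mulmx V (b : vec) : (forall j, future (col j V)) -> nonneg_coords b ->
  (exists i, 0 < b i ord0) -> future (V *m b).
Proof. by move=> fV b0 bp; rewrite mulmx_cols; exact: future_sum. Qed.

Lemma sconeP V x : V \in unitmx ->
  scone V x <-> hspace x /\ nonneg_coords (invmx V *m x).
Proof.
move=> uV; split=> [[hx [b b0 xE]]|[hx h]].
  by split=> //; rewrite xE mulKmx.
by split => //; exists (invmx V *m x) => //; rewrite mulKVmx.
Qed.

Lemma radial_scone V (b : vec) : future_basis V -> nonneg_coords b ->
  (exists i, 0 < b i ord0) -> scone V (radial (V *m b)).
Proof.
move=> [uV fV] b0 bp; have fb := future_mulmx fV b0 bp.
split; first exact: hspace_radial.
exists ((Num.sqrt (- lorentz (V *m b)))^-1 *: b).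
  by move=> i; rewrite mxE mulr_ge0 // ltW // radial_scale_gt0.
by rewrite -scalemxAr.
Qed.

Lemma scone_hspace V : scone V `<=` @hspace R n.
Proof. by move=> x []. Qed.

Lemma hspace_col_basis V : (forall j, hspace (col j V)) -> row_free V^T -> future_basis V.
Proof.
move=> hV; rewrite row_free_unit unitmx_tr => uV; split=> // j.
exact: hspace_future.
Qed.

Lemma radial_proj_hull V : V \in unitmx -> radial_proj (convex_hull V) = scone V.
Proof.
move=> uV; apply/seteqP; split => x.
  move=> [hx [t t0 [a [a0 a1] aE]]]; split => //; exists (t^-1 *: a).
    by move=> i; rewrite mxE mulr_ge0 // invr_ge0 ltW.
  by rewrite -scalemxAr aE scalerA mulVf ?scale1r // gt_eqF.
move=> [hx [b b0 bE]]; split => //.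
have s0 : 0 < \sum_i b i ord0.
  rewrite lt_neqAle (sumr_ge0 _ (fun j _ => b0 j)) andbT eq_sym; apply/negP => /eqP b00.
  have bz i : b i ord0 = 0.
    have : b i ord0 <= \sum_i b i ord0.
      by rewrite (bigD1 i) //= lerDl; apply: sumr_ge0 => j _; exact: b0.
    by rewrite b00 => h; apply: le_anti; rewrite h b0.
  have : x ord0 ord0 = 0 by rewrite bE mxE big1 // => i _; rewrite bz mulr0.
  by case: hx => _ x0 xe; rewrite xe ltxx in x0.
exists (\sum_i b i ord0)^-1; first by rewrite invr_gt0.
exists ((\sum_i b i ord0)^-1 *: b).
  split; first by move=> i; rewrite mxE mulr_ge0 // invr_ge0 ltW.
  under eq_bigr do rewrite mxE.
  by rewrite -mulr_sumr mulVf // gt_eqF.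
by rewrite bE -scalemxAr.
Qed.

(** Rescaling the spanning vectors to the hyperboloid leaves the cone unchanged. *)
Lemma geometric_simplexP S : geometric_simplex S <-> exists2 V, future_basis V & S = scone V.
Proof.
split=> [[V [hV fV ->]]|[V [uV fV] ->]].
  exists V; first exact: hspace_col_basis.
  by apply: radial_proj_hull; move: fV; rewrite row_free_unit unitmx_tr.
pose c j := (Num.sqrt (- lorentz (col j V)))^-1.
have c0 j : 0 < c j by exact: radial_scale_gt0.
pose D : mat := diag_mx (\row_j c j).
have uD : D \in unitmx.
  rewrite unitmxE det_diag unitfE; apply/prodf_neq0 => j _.
  by rewrite mxE gt_eqF.
have colVD j : col j (V *m D) = radial (col j V).
  apply/colP => i; rewrite mxE mul_mx_diag !mxE mulrC; congr (_ * _).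
have uVD : V *m D \in unitmx by rewrite unitmx_mul uV.
exists (V *m D); split.
- by move=> j; rewrite colVD; exact: hspace_radial.
- by rewrite row_free_unit unitmx_tr.
rewrite radial_proj_hull //; apply/seteqP; split => x [hx [b b0 bE]]; split => //.
  exists (invmx D *m b); last by rewrite -mulmxA mulKVmx.
  have -> : invmx D = diag_mx (\row_j (c j)^-1).
    apply: (mulIr uD); rewrite -[X in _ = X]/(_ *m _) -[X in X = _]/(_ *m _) mulVmx //.
    rewrite mul_diag_mx; apply/matrixP => i j; rewrite !mxE.
    by case: (i == j); rewrite ?mulr0 // mulVf // gt_eqF.
  by move=> i; rewrite mul_diag_mx !mxE mulr_ge0 // invr_ge0 ltW.
exists (D *m b); last by rewrite mulmxA.
by move=> i; rewrite mul_diag_mx !mxE mulr_ge0 // ltW.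
Qed.

(** ** Subdividing a cone along an edge *)

(** The column [i] of [V] is replaced by the point [a *: col i V + b *: col j V] of
    the edge that joins it to column [j]. This cone and the one in which the same
    point replaces column [j] subdivide the cone of [V]. *)
Definition edge_split V (i j : 'I_n.+1) (a b : R) : mat :=
  V *m (1%:M + ((a - 1) *: delta_mx i ord0 + b *: delta_mx j ord0 : vec) *m delta_mx ord0 i).

Section EdgeSplit.
Variables (V : mat) (i j : 'I_n.+1) (a b : R).
Hypotheses (ij : i != j) (a0 : 0 < a) (b0 : 0 < b).
Let u : vec := (a - 1) *: delta_mx i ord0 + b *: delta_mx j ord0.

Let u_i : u i ord0 = a - 1.
Proof. by rewrite !mxE !eqxx (negbTE ij) mulr1 mulr0 addr0. Qed.
Let u_j : u j ord0 = b.
Proof. by rewrite !mxE !eqxx eq_sym (negbTE ij) mulr1 mulr0 add0r. Qed.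
Let u_k k : k != i -> k != j -> u k ord0 = 0.
Proof. by move=> /negbTE ki /negbTE kj; rewrite !mxE ki kj !mulr0 addr0. Qed.

Lemma edge_split_mul (c : vec) :
  edge_split V i j a b *m c = V *m (c + c i ord0 *: u).
Proof.
rewrite /edge_split -mulmxA mulmxDl mul1mx -mulmxA -rowE; congr (_ *m (_ + _)).
by rewrite [X in _ *m X]mx11_scalar mul_mx_scalar !mxE.
Qed.

Lemma edge_split_col k : k != i -> col k (edge_split V i j a b) = col k V.
Proof.
move=> ki; rewrite colE edge_split_mul mxE [X in (X && _)](_ : _ = false); last first.
  by rewrite eq_sym (negbTE ki).
by rewrite mulr0n scale0r addr0 -colE.
Qed.

Lemma edge_split_coli : col i (edge_split V i j a b) = a *: col i V + b *: col j V.
Proof.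
rewrite colE edge_split_mul mxE !eqxx.
have -> : delta_mx i ord0 + 1 *: u = a *: delta_mx i ord0 + b *: delta_mx j ord0.
  by apply/colP => k; rewrite !mxE; ring.
by rewrite mulmxDr -!scalemxAr -!colE.
Qed.

Lemma edge_split_basis : future_basis V -> future_basis (edge_split V i j a b).
Proof.
move=> [uV fV]; split.
  rewrite unitmx_mul uV unitmxE det_1_rank1 -rowE [row i _ _ _]mxE u_i.
  by rewrite addrC subrK unitfE gt_eqF.
move=> k; have [->|ki] := eqVneq k i; last by rewrite edge_split_col.
by rewrite edge_split_coli; apply: futureD; exact: futureZ.
Qed.

Lemma edge_split_sub : scone (edge_split V i j a b) `<=` scone V.
Proof.
move=> x [hx [c c0 xE]]; split=> //.
exists (c + c i ord0 *: u) => [k|]; last by rewrite xE edge_split_mul.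
rewrite mxE [X in _ + X]mxE.
have [->|ki] := eqVneq k i.
  by rewrite u_i mulrBr mulr1 addrC subrK mulr_ge0 // ltW.
have [->|kj] := eqVneq k j; last by rewrite u_k // mulr0 addr0.
by rewrite u_j addr_ge0 // mulr_ge0 // ltW.
Qed.

Lemma edge_split_mem x (d : vec) : hspace x -> nonneg_coords d -> x = V *m d ->
  b * d i ord0 <= a * d j ord0 -> scone (edge_split V i j a b) x.
Proof.
move=> hx d0 xE dij; split => //; exists (d - (d i ord0 / a) *: u); last first.
  rewrite edge_split_mul xE; congr (_ *m _).
  have -> : (d - (d i ord0 / a) *: u) i ord0 = d i ord0 / a.
    by rewrite mxE [X in _ + X]mxE [X in - X]mxE u_i; field; rewrite gt_eqF.
  by rewrite subrK.
move=> k; rewrite mxE [X in _ + X]mxE [X in - X]mxE.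
have [->|ki] := eqVneq k i.
  rewrite u_i (_ : _ - _ = d i ord0 / a); last by field; rewrite gt_eqF.
  by rewrite divr_ge0 // ltW.
have [->|kj] := eqVneq k j; last by rewrite u_k // mulr0 subr0.
by rewrite u_j subr_ge0 mulrAC ler_pdivrMr // mulrC [leRHS]mulrC.
Qed.

End EdgeSplit.

End SimplicialCones.

(** * Polytopes modulo hyperplanes *)

Lemma bigcup_finE (T : Type) (I : finType) (F : I -> set T) :
  \bigcup_(i in [set: I]) F i = \big[setU/set0]_(i <- enum I) F i.
Proof.
rewrite -bigcup_seq; apply/seteqP; split => x [i _ xi]; exists i => //=.
by rewrite mem_enum.
Qed.

Section PolytopeAlgebra.
Variables (R : realType) (n : nat).
Local Notation vec := 'cV[R]_n.+1.
Local Notation mat := 'M[R]_n.+1.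
Local Notation lval := (@lval R n).
Local Notation scone := (@scone R n).
Local Notation future_basis := (@future_basis R n).
Implicit Types (x y : vec) (V W : mat) (l : 'rV[R]_n.+1) (s t : seq mat).
Implicit Types (X Y Z P Q : set vec).

Lemma lvalD l x y : lval l (x + y) = lval l x + lval l y.
Proof. by rewrite /lval mulmxDr mxE. Qed.

Lemma lvalN l x : lval (- l) x = - lval l x.
Proof. by rewrite /lval mulNmx mxE. Qed.

Lemma lval_mulmx l V (b : vec) : lval l (V *m b) = \sum_j b j ord0 * lval l (col j V).
Proof.
rewrite /lval mulmxA mxE; apply: eq_bigr => j _.
by rewrite mulrC; congr (_ * _); rewrite !mxE; apply: eq_bigr => k _; rewrite mxE.
Qed.

(** Unlike a polytope, a list of cones can be recursed on. *)
Definition polyset s : set vec := [set x | exists2 V, V \in s & scone V x].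

Definition all_bases s := forall V, V \in s -> future_basis V.

Lemma all_bases_cons V s : future_basis V -> all_bases s -> all_bases (V :: s).
Proof. by move=> gV gs W; rewrite inE => /predU1P[->|] //; exact: gs. Qed.

Lemma all_bases_cat s t : all_bases s -> all_bases t -> all_bases (s ++ t).
Proof. by move=> gs gt W; rewrite mem_cat => /orP[]; [exact: gs|exact: gt]. Qed.

Lemma polyset_nil : polyset [::] = set0.
Proof. by apply/seteqP; split => // x [V]. Qed.

Lemma polyset_cons V s : polyset (V :: s) = scone V `|` polyset s.
Proof.
apply/seteqP; split => x.
  by move=> [W]; rewrite inE => /predU1P[->|Ws]; [left|right; exists W].
by move=> [xV|[W Ws xW]]; [exists V; rewrite ?mem_head|exists W; rewrite // inE Ws orbT].
Qed.

Lemma polyset_cat s t : polyset (s ++ t) = polyset s `|` polyset t.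
Proof.
by elim: s => [|V s IH]; rewrite /= ?polyset_nil ?set0U // !polyset_cons IH setUA.
Qed.

Lemma polyset1 V : polyset [:: V] = scone V.
Proof. by rewrite polyset_cons polyset_nil setU0. Qed.

Lemma is_polytopeP P : is_polytope P <-> exists2 s, all_bases s & P = polyset s.
Proof.
split=> [[k [S [gS ->]]]|[s gs ->]].
  have {}gS i : exists V, future_basis V /\ S i = scone V by have /geometric_simplexP[V] := gS i; exists V.
  have [V hV] := choice gS; exists [seq V i | i <- enum 'I_k].
    by move=> W /mapP[i _ ->]; have [] := hV i.
  apply/seteqP; split => x.
    move=> [i _]; have [_ ->] := hV i; exists (V i) => //.
    by apply: map_f; rewrite mem_enum.
  by move=> [W /mapP[i _ ->]]; have [_ <-] := hV i; exists i.
exists (size s), (fun i => scone (nth 0 s i)); split=> [i|].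
  by apply/geometric_simplexP; exists (nth 0 s i) => //; apply: gs; rewrite mem_nth.
apply/seteqP; split => x.
  move=> [V Vs xV]; have h : (index V s < size s)%N by rewrite index_mem.
  by exists (Ordinal h) => //=; rewrite nth_index.
by move=> [i _ xi]; exists (nth 0 s i); rewrite ?mem_nth.
Qed.

(** ** Cutting by a half-space *)

Definition lsupport l V : {set 'I_n.+1} := [set j | lval l (col j V) != 0].

(** By induction on the number of spanning vectors off the hyperplane. If two of
    them lie strictly on opposite sides, subdividing where their edge crosses the
    hyperplane puts one more spanning vector of each part on it. *)
Lemma scone_cut l V : future_basis V -> exists sp sm, [/\ all_bases sp, all_bases sm,
  polyset sp `<=` scone V `&` [set x | 0 <= lval l x],
  polyset sm `<=` scone V `&` [set x | lval l x <= 0] &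
  scone V `<=` polyset sp `|` polyset sm].
Proof.
move: {-1}#|lsupport l V| (leqnn #|lsupport l V|) => k.
elim: k V => [|k IH] V kV gV.
all: have [/forallP hp|/forallPn[j]] := boolP [forall j, 0 <= lval l (col j V)].
all: try (exists [:: V], [::]; rewrite polyset1 polyset_nil setU0; split=> //;
  [by apply: all_bases_cons|move=> x xV; split=> //; case: xV => _ [b b0 ->] /=;
   rewrite lval_mulmx; apply: sumr_ge0 => i _; exact: mulr_ge0]).
  move: kV; rewrite leqn0 cards_eq0 => /eqP/setP/(_ j); rewrite !inE => /negbFE/eqP ->.
  by rewrite lexx.
rewrite -ltNge => lj.
have [/forallP hm|/forallPn[i]] := boolP [forall j, lval l (col j V) <= 0].
  exists [::], [:: V]; rewrite polyset1 polyset_nil set0U; split=> //.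
    exact: all_bases_cons.
  move=> x xV; split=> //; case: xV => _ [b b0 ->] /=.
  by rewrite lval_mulmx; apply: sumr_le0 => i _; exact: mulr_ge0_le0.
rewrite -ltNge => li.
have ij : i != j by apply: contraTneq li => ->; rewrite -leNgt ltW.
(* The weights for which [a *: col i V + b *: col j V] lies on the hyperplane. *)
set a := - lval l (col j V); set b := lval l (col i V) in li.
have a0 : 0 < a by rewrite oppr_gt0.
have step p q c d : p != q -> 0 < c -> 0 < d -> lval l (col p V) != 0 ->
    c * lval l (col p V) + d * lval l (col q V) = 0 ->
  exists sp sm, [/\ all_bases sp, all_bases sm,
    polyset sp `<=` scone V `&` [set x | 0 <= lval l x],
    polyset sm `<=` scone V `&` [set x | lval l x <= 0] &
    scone (edge_split V p q c d) `<=` polyset sp `|` polyset sm].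
  move=> pq c0 d0 lp lpq.
  have [||sp [sm [gsp gsm hsp hsm hV]]] := IH (edge_split V p q c d).
  - rewrite -ltnS; apply: leq_trans kV; apply: proper_card; apply/fintype.properP; split.
      apply/fintype.subsetP => m; rewrite !inE.
      have [->|mp] := eqVneq m p; first by rewrite lp.
      by rewrite edge_split_col.
    exists p; rewrite !inE ?lp // edge_split_coli // lvalD !lvalZ.
    by rewrite lpq eqxx.
  - exact: edge_split_basis.
  exists sp, sm; split=> //.
    by move=> x /hsp[xV lx]; split=> //; exact: edge_split_sub xV.
  by move=> x /hsm[xV lx]; split=> //; exact: edge_split_sub xV.
have [|||||sp1 [sm1 [g1 g1' h1 h1' c1]]] := step i j a b => //.
- by rewrite gt_eqF.
- by rewrite /a /b; ring.
have [|||||sp2 [sm2 [g2 g2' h2 h2' c2]]] := step j i b a => //.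
- by rewrite eq_sym.
- by rewrite lt_eqF.
- by rewrite /a /b; ring.
exists (sp1 ++ sp2), (sm1 ++ sm2); split; rewrite ?polyset_cat.
- exact: all_bases_cat.
- exact: all_bases_cat.
- by rewrite subUset.
- by rewrite subUset.
move=> x [hx [d d0 xE]].
have [h|/ltW h] := leP (b * d i ord0) (a * d j ord0).
  by have /c1[] := edge_split_mem ij a0 hx d0 xE h; [left; left|right; left].
have ji : j != i by rewrite eq_sym.
by have /c2[] := edge_split_mem ji li hx d0 xE h; [left; right|right; right].
Qed.

Lemma polyset_cut l s : all_bases s -> exists s', [/\ all_bases s',
  polyset s' `<=` polyset s `&` [set x | 0 <= lval l x] &
  polyset s `&` [set x | 0 < lval l x] `<=` polyset s'].
Proof.
elim: s => [|V s IH] gs; first by exists [::]; rewrite polyset_nil set0I; split=> // x [].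
have [|s' [gs' h1 h2]] := IH; first by move=> W Ws; apply: gs; rewrite inE Ws orbT.
have [|sp [sm [gp gm hp hm c]]] := @scone_cut l V; first by apply: gs; rewrite mem_head.
exists (sp ++ s'); rewrite polyset_cat polyset_cons; split.
- exact: all_bases_cat.
- by rewrite setIUl; apply: setUSS.
- rewrite setIUl; apply: setUSS => // x [/c[//|/hm[_ /=]]].
  by rewrite leNgt => /negbTE h /=; rewrite h.
Qed.

(** ** Sets modulo hyperplanes *)

(** The boundaries of polytopes are thin, and so are the overlaps of polytopes with
    disjoint interiors; thin sets are null. *)
Definition thin X := exists2 s : seq 'rV[R]_n.+1, (forall l, l \in s -> l != 0) &
  X `<=` [set x | exists2 l, l \in s & lval l x = 0].

Lemma thin0 : thin set0.
Proof. by exists [::]. Qed.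

Lemma thin_sub X Y : X `<=` Y -> thin Y -> thin X.
Proof. by move=> XY [s s0 h]; exists s => //; exact: subset_trans h. Qed.

Lemma thinU X Y : thin X -> thin Y -> thin (X `|` Y).
Proof.
move=> [s s0 hs] [t t0 ht]; exists (s ++ t).
  by move=> l; rewrite mem_cat => /orP[/s0|/t0].
move=> x [/hs|/ht] [l ls lx]; exists l => //; by rewrite mem_cat ls ?orbT.
Qed.

Lemma thin_hyperplane l : l != 0 -> thin [set x | lval l x = 0].
Proof.
by move=> l0; exists [:: l] => [k|x lx]; [rewrite inE => /eqP->|exists l; rewrite ?mem_head].
Qed.

Lemma thin_bigcup (I : finType) (A : I -> set vec) :
  (forall i, thin (A i)) -> thin (\bigcup_(i in [set: I]) A i).
Proof.
move=> hA; rewrite bigcup_finE.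
by apply: (big_ind thin) => [|X Y|i _]; [exact: thin0|exact: thinU|exact: hA].
Qed.

Lemma thin_trans X Y Z : thin (X `\` Y) -> thin (Y `\` Z) -> thin (X `\` Z).
Proof.
move=> h1 h2; apply: thin_sub (thinU h1 h2) => x [Xx Zx].
by have [Yx|Yx] := pselect (Y x); [right|left].
Qed.

(** The sets that agree with a polytope up to finitely many hyperplanes; these
    are closed under the Boolean operations, which polytopes are not. *)
Definition polyhedral X := exists2 s, all_bases s &
  thin (X `\` polyset s) /\ thin (polyset s `\` X).

Lemma polyhedral_polyset s : all_bases s -> polyhedral (polyset s).
Proof. by move=> gs; exists s => //; rewrite setDv; split; exact: thin0. Qed.

Lemma polyhedral_ae X Y : thin (X `\` Y) -> thin (Y `\` X) -> polyhedral Y -> polyhedral X.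
Proof.
move=> h1 h2 [s gs [h3 h4]]; exists s => //.
by split; [exact: thin_trans h1 h3|exact: thin_trans h4 h2].
Qed.

Lemma polyhedralU X Y : polyhedral X -> polyhedral Y -> polyhedral (X `|` Y).
Proof.
move=> [s gs [h1 h2]] [t gt [h3 h4]]; exists (s ++ t); first exact: all_bases_cat.
rewrite polyset_cat; split.
  apply: thin_sub (thinU h1 h3) => x [[Xx|Yx] /not_orP[sx tx]]; by [left|right].
apply: thin_sub (thinU h2 h4) => x [[Xx|Yx] /not_orP[sx tx]]; by [left|right].
Qed.

Lemma polyhedral_pos X l : l != 0 -> polyhedral X -> polyhedral (X `&` [set x | 0 < lval l x]).
Proof.
move=> l0 [s gs [h1 h2]]; have [s' [gs' h3 h4]] := polyset_cut l gs.
exists s' => //; split.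
  apply: thin_sub h1 => x [[Xx lx] sx]; split=> // ssx; apply: sx; exact: h4.
apply: thin_sub (thinU h2 (thin_hyperplane l0)) => x [s'x XXx].
have [sx /= lx] := h3 _ s'x; have [Xx|Xx] := pselect (X x); last by left.
right => /=; apply/eqP; rewrite eq_le lx andbT leNgt; apply/negP => lx0.
by apply: XXx.
Qed.

Lemma polyhedral_nonneg X l : l != 0 -> polyhedral X ->
  polyhedral (X `&` [set x | 0 <= lval l x]).
Proof.
move=> l0 hX; apply: (polyhedral_ae (Y := X `&` [set x | 0 < lval l x])).
- apply: thin_sub (thin_hyperplane l0) => x [[Xx /= lx] h] /=; apply/eqP.
  by rewrite eq_le lx andbT leNgt; apply/negP => lx0; apply: h.
- apply: thin_sub thin0 => x [[Xx /= lx]]; apply; split=> //=; exact: ltW.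
- exact: polyhedral_pos.
Qed.

Lemma polyhedral_neg X l : l != 0 -> polyhedral X -> polyhedral (X `&` [set x | lval l x < 0]).
Proof.
move=> l0 hX; rewrite (_ : [set x | _] = [set x | 0 < lval (- l) x]).
  by apply: polyhedral_pos; rewrite ?oppr_eq0.
by apply/seteqP; split => x /=; rewrite lvalN oppr_gt0.
Qed.

End PolytopeAlgebra.

(** * Polytopes are determined by their thick part *)

Section MomentCurve.
Variables (R : realType) (n : nat).
Local Notation vec := 'cV[R]_n.+1.
Local Notation mat := 'M[R]_n.+1.
Local Notation lval := (@lval R n).
Implicit Types (x y : vec) (V W : mat) (l : 'rV[R]_n.+1).

(** A curve leaving [x] into the interior of the cone spanned by [V]; being a
    moment curve, it meets each hyperplane finitely often. *)
Definition moment_vec (e : R) : vec := \col_k e ^+ k.+1.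
Definition moment_curve V x (e : R) : vec := x + V *m moment_vec e.

Definition moment_poly V x l : {poly R} :=
  (lval l x)%:P + \sum_k lval l (col k V) *: 'X^(k.+1).

Lemma moment_polyE V x l e : (moment_poly V x l).[e] = lval l (moment_curve V x e).
Proof.
rewrite /moment_poly /moment_curve lvalD lval_mulmx hornerD hornerC horner_sum.
by congr (_ + _); apply: eq_bigr => k _; rewrite hornerZ hornerXn mxE mulrC.
Qed.

(** A functional that vanishes along the whole curve vanishes on the columns of
    [V], which span. *)
Lemma moment_poly_neq0 V x l : V \in unitmx -> l != 0 -> moment_poly V x l != 0.
Proof.
move=> uV; apply: contraNneq => p0; suff : l *m V = 0.
  by move=> /(congr1 (mulmx^~ (invmx V))); rewrite mulmxK // mul0mx => ->.
apply/rowP => k; rewrite [RHS]mxE.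
have := congr1 (fun p : {poly R} => p`_k.+1) p0; rewrite coef0 coefD coefC /= add0r.
rewrite coef_sum (bigD1 k) //= coefZ coefXn eqxx mulr1 big1 ?addr0 => [<-|j jk].
  by rewrite /lval !mxE; apply: eq_bigr => i _; rewrite mxE.
rewrite coefZ coefXn eqSS (_ : (k == j :> nat) = false) ?mulr0 //.
by rewrite eq_sym; apply: negbTE.
Qed.

Lemma avoid_roots (p : {poly R}) (d : R) : p != 0 -> 0 < d ->
  exists e, [/\ 0 < e, e < d & p.[e] != 0].
Proof.
move=> p0 d0; apply: contrapT => /forallNP h.
pose rs := [seq d / k.+2%:R | k <- iota 0 (size p)].
suff : (size rs < size p)%N by rewrite size_map size_iota ltnn.
apply: max_poly_roots => //; last first.
  rewrite map_inj_uniq ?iota_uniq // => i j /(mulfI (lt0r_neq0 d0)) /invr_inj /eqP.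
  by rewrite eqr_nat => /eqP[].
apply/allP => _ /mapP[k _ ->]; apply/negPn/negP => hk; apply: (h (d / k.+2%:R)).
rewrite divr_gt0 //; split=> //; rewrite ltr_pdivrMr // ltr_pMr //.
by rewrite ltr1n.
Qed.

Lemma moment_curve_avoid V x (s : seq 'rV[R]_n.+1) (d : R) : V \in unitmx ->
  (forall l, l \in s -> l != 0) -> 0 < d ->
  exists e, [/\ 0 < e, e < d & forall l, l \in s -> lval l (moment_curve V x e) != 0].
Proof.
move=> uV s0 d0.
have p0 : \prod_(l <- s) moment_poly V x l != 0.
  by rewrite prodf_seq_neq0; apply/allP => l /s0 l0 /=; exact: moment_poly_neq0.
have [e [e0 ed]] := avoid_roots p0 d0; rewrite horner_prod prodf_seq_neq0 => /allP h.
by exists e; split=> // l /h /=; rewrite moment_polyE.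
Qed.

Lemma moment_curve_neg V x l : lval l x < 0 ->
  \forall e \near 0^'+, lval l (moment_curve V x e) < 0.
Proof.
move=> lx; have E : (moment_poly V x l).[0] = lval l x.
  rewrite moment_polyE /moment_curve (_ : moment_vec 0 = 0) ?mulmx0 ?addr0 //.
  by apply/colP => k; rewrite !mxE expr0n.
have c : (moment_poly V x l).[e] @[e --> 0^'+] --> lval l x.
  by rewrite -E; apply: cvg_at_right_filter; exact: continuous_horner.
by near do rewrite -moment_polyE; exact: (cvgr_lt _ c).
Unshelve. all: by end_near. Qed.

End MomentCurve.

Section PolytopeBoolean.
Variables (R : realType) (n : nat).
Local Notation vec := 'cV[R]_n.+1.
Local Notation mat := 'M[R]_n.+1.
Local Notation lval := (@lval R n).
Local Notation scone := (@scone R n).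
Local Notation future_basis := (@future_basis R n).
Local Notation hspace := (@hspace R n).
Implicit Types (x y : vec) (V W A : mat) (l : 'rV[R]_n.+1) (s t : seq mat).
Implicit Types (X Y Z P Q : set vec).

(** The rows of the inverse matrix are the coordinates with respect to the columns
    of [W], whose signs cut out the cone. *)
Definition facet W (i : 'I_n.+1) : 'rV[R]_n.+1 := row i (invmx W).

Lemma lval_facet W i x : lval (facet W i) x = (invmx W *m x) i ord0.
Proof. by rewrite /lval /facet -row_mul mxE. Qed.

Lemma facet_neq0 W i : W \in unitmx -> facet W i != 0.
Proof.
move=> uW; apply/eqP => f0.
have := congr1 (fun l : 'rV[R]_n.+1 => (l *m W) ord0 i) f0.
by rewrite /facet -row_mul mulVmx // mul0mx !mxE eqxx => /eqP; rewrite oner_eq0.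
Qed.

Lemma scone_facets W : W \in unitmx ->
  scone W = [set x | hspace x /\ forall i, 0 <= lval (facet W i) x].
Proof.
move=> uW; apply/seteqP; split => x.
  by move=> /(sconeP _ uW)[hx h]; split=> // i; rewrite lval_facet.
by move=> [hx h]; apply/(sconeP _ uW); split=> // i; rewrite -lval_facet.
Qed.

Lemma polyhedral_facets X (ls : seq 'rV[R]_n.+1) : (forall l, l \in ls -> l != 0) ->
  polyhedral X -> polyhedral (X `&` [set x | forall l, l \in ls -> 0 <= lval l x]).
Proof.
move=> + hX; elim: ls => [|l ls IH] ls0.
  rewrite (_ : [set x | _] = setT) ?setIT //.
  by apply/seteqP; split.
rewrite (_ : _ `&` _ = (X `&` [set x | forall l, l \in ls -> 0 <= lval l x]) `&`
    [set x | 0 <= lval l x]); last first.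
  apply/seteqP; split => x.
    move=> [Xx h]; split; [split=> // k kls|]; apply: h; rewrite inE ?eqxx //.
    by rewrite kls orbT.
  by move=> [[Xx h] hl]; split=> // k; rewrite inE => /predU1P[->|/h].
apply: polyhedral_nonneg; first by apply: ls0; rewrite mem_head.
by apply: IH => k kls; apply: ls0; rewrite inE kls orbT.
Qed.

Lemma polyhedral_hspace X : polyhedral X -> thin (X `\` hspace).
Proof.
move=> [s gs [h _]]; apply: thin_sub h => x [Xx hx]; split=> // -[V _ /scone_hspace].
exact: hx.
Qed.

Lemma polyhedralI_scone X W : future_basis W -> polyhedral X -> polyhedral (X `&` scone W).
Proof.
move=> [uW _] hX; pose ls := [seq facet W i | i <- enum 'I_n.+1].
apply: (polyhedral_ae (Y := X `&` [set x | forall l, l \in ls -> 0 <= lval l x])).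
- apply: thin_sub (@thin0 R n) => x [[Xx]]; rewrite scone_facets // => -[hx h].
  by apply; split=> // l /mapP[i _ ->].
- apply: thin_sub (polyhedral_hspace hX) => x [[Xx h] h']; split=> // hx; apply: h'.
  split=> //; rewrite scone_facets //; split=> // i; apply: h.
  by apply: map_f; rewrite mem_enum.
apply: polyhedral_facets => // _ /mapP[i _ ->]; exact: facet_neq0.
Qed.

Lemma polyhedral0 : polyhedral (set0 : set vec).
Proof. by rewrite -(@polyset_nil R n); apply: polyhedral_polyset. Qed.

Lemma polyhedralI X Y : polyhedral X -> polyhedral Y -> polyhedral (X `&` Y).
Proof.
move=> hX [t gt [h1 h2]]; apply: (polyhedral_ae (Y := X `&` polyset t)).
- by apply: thin_sub h1 => x [[Xx Yx] h]; split=> // tx; exact: h.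
- by apply: thin_sub h2 => x [[Xx Yx] h]; split=> // tx; exact: h.
elim: t gt {h1 h2} => [|W t IH] gt; first by rewrite polyset_nil setI0; exact: polyhedral0.
rewrite polyset_cons setIUr; apply: polyhedralU.
  by apply: polyhedralI_scone => //; apply: gt; rewrite mem_head.
by apply: IH => V Vt; apply: gt; rewrite inE Vt orbT.
Qed.

Lemma polyhedral_bigcup (I : finType) (A : I -> set vec) :
  (forall i, polyhedral (A i)) -> polyhedral (\bigcup_(i in [set: I]) A i).
Proof.
move=> hA; rewrite bigcup_finE; apply: (big_ind (@polyhedral R n)) => [|X Y|i _].
- exact: polyhedral0.
- exact: polyhedralU.
- exact: hA.
Qed.

Lemma polyhedralD_scone X W : future_basis W -> polyhedral X -> polyhedral (X `\` scone W).
Proof.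
move=> [uW _] hX.
apply: (polyhedral_ae (Y := \bigcup_(i in [set: 'I_n.+1]) (X `&` [set x | lval (facet W i) x < 0]))).
- apply: thin_sub (polyhedral_hspace hX) => x [[Xx h] h']; split=> // hx; apply: h.
  rewrite scone_facets //; split=> // i; rewrite leNgt; apply/negP => li; apply: h'.
  by exists i.
- apply: thin_sub (@thin0 R n) => x [[i _ [Xx li]]]; apply; split=> //.
  by rewrite scone_facets // => -[_ /(_ i)]; rewrite leNgt li.
by apply: polyhedral_bigcup => i; apply: polyhedral_neg => //; exact: facet_neq0.
Qed.

Lemma polyhedralD X Y : polyhedral X -> polyhedral Y -> polyhedral (X `\` Y).
Proof.
move=> hX [t gt [h1 h2]]; apply: (polyhedral_ae (Y := X `\` polyset t)).
- by apply: thin_sub h2 => x [[Xx nY] h]; split=> //; apply: contrapT => ntx; exact: h.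
- by apply: thin_sub h1 => x [[Xx nt] h]; split=> //; apply: contrapT => nY; exact: h.
elim: t X hX gt {h1 h2} => [|W t IH] X hX gt; first by rewrite polyset_nil setD0.
rewrite polyset_cons setDUr (_ : _ `&` _ = (X `\` scone W) `\` polyset t); last first.
  by apply/seteqP; split => x; [move=> [[? ?] [? ?]]|move=> [[? ?] ?]].
apply: IH; last by move=> V Vt; apply: gt; rewrite inE Vt orbT.
by apply: polyhedralD_scone => //; apply: gt; rewrite mem_head.
Qed.

Lemma lval_radial l x : future x -> (lval l (radial x) < 0) = (lval l x < 0).
Proof. by move=> fx; rewrite /radial lvalZ pmulr_rlt0 // radial_scale_gt0. Qed.

Lemma lval_radial_eq0 l x : future x -> (lval l (radial x) == 0) = (lval l x == 0).
Proof.
by move=> fx; rewrite /radial lvalZ mulf_eq0 gt_eqF //= radial_scale_gt0.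
Qed.

(** The complement of a polytope is open: a point outside a cone violates one of
    its facet inequalities strictly. *)
Lemma polyset_nmem_near t x V : all_bases t -> hspace x -> ~ polyset t x ->
  \forall e \near (0 : R)^'+, future (moment_curve V x e) ->
    ~ polyset t (radial (moment_curve V x e)).
Proof.
move=> gt hx; elim: t gt => [|W t IH] gt ntx.
  by near=> e => _; rewrite polyset_nil.
have nW : ~ scone W x by move=> xW; apply: ntx; rewrite polyset_cons; left.
have uW : W \in unitmx by have [] := gt W (mem_head _ _).
have [i li] : exists i, lval (facet W i) x < 0.
  apply: contrapT => /forallNP h; apply: nW; rewrite scone_facets //; split=> // i.
  by rewrite leNgt; apply/negP; exact: h.
have IH' : \forall e \near (0 : R)^'+, future (moment_curve V x e) ->
    ~ polyset t (radial (moment_curve V x e)).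
  apply: IH; first by move=> U Ut; apply: gt; rewrite inE Ut orbT.
  by move=> tx; apply: ntx; rewrite polyset_cons; right.
near=> e => fe; rewrite polyset_cons => -[|].
  rewrite scone_facets // => -[_ /(_ i)]; rewrite leNgt lval_radial // => /negP; apply.
  near: e; exact: moment_curve_neg.
by move: fe; near: e.
Unshelve. all: by end_near. Qed.

(** Every point of a polytope is a limit of points of the polytope off any
    given finite set of hyperplanes, and polytopes are closed. *)
Lemma polyset_sub s t : all_bases s -> all_bases t ->
  thin (polyset s `\` polyset t) -> polyset s `<=` polyset t.
Proof.
move=> gs gt [ls ls0 h] x sx; apply: contrapT => ntx.
have [V Vs [hx [b b0 xE]]] := sx; have [uV fV] := gs _ Vs.
have near_t := polyset_nmem_near V gt hx ntx.
have [d /= d0 hd] := near_t.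
have [e [e0 ed he]] := moment_curve_avoid x uV ls0 d0.
have mE : moment_curve V x e = V *m (b + moment_vec n e).
  by rewrite /moment_curve mulmxDr -xE.
have c0 : nonneg_coords (b + moment_vec n e).
  by move=> i; rewrite mxE addr_ge0 // mxE exprn_ge0 // ltW.
have cp : exists i, 0 < (b + moment_vec n e) i ord0.
  by exists ord0; rewrite mxE ltr_wpDl // mxE exprn_gt0.
have fe : future (moment_curve V x e) by rewrite mE; exact: future_mulmx.
have [|l ls_l /eqP] := h (radial (moment_curve V x e)).
  split.
    by exists V => //; rewrite mE; apply: radial_scone.
  apply: hd => //=; by rewrite sub0r normrN gtr0_norm.
by rewrite lval_radial_eq0 // (negbTE (he _ ls_l)).
Qed.

Lemma polytope_sub P Q : is_polytope P -> is_polytope Q -> thin (P `\` Q) -> P `<=` Q.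
Proof.
by move=> /is_polytopeP[s gs ->] /is_polytopeP[t gt ->]; exact: polyset_sub.
Qed.

Lemma polyhedral_polytope P : is_polytope P -> polyhedral P.
Proof. by move=> /is_polytopeP[s gs ->]; exact: polyhedral_polyset. Qed.

Lemma polyhedralE X : polyhedral X ->
  exists P, [/\ is_polytope P, thin (X `\` P) & thin (P `\` X)].
Proof. by move=> [s gs [h1 h2]]; exists (polyset s); split=> //; apply/is_polytopeP; exists s. Qed.

Lemma hspace_hisom A x : hisom A -> hspace (A *m x) <-> hspace x.
Proof.
move=> hA; split=> [[lx x0]|]; last exact: hisom_hspace.
have lE : lorentz x = -1 by have [h _] := hA; rewrite -h.
by split=> //; rewrite -(hisom_pos hA) // lE ltrN10.
Qed.

Lemma hisom_future A x : hisom A -> future x -> future (A *m x).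
Proof.
move=> hA [lx x0]; split; first by have [-> _] := hA.
by rewrite hisom_pos.
Qed.

Lemma hisom_image_scone A V : hisom A ->
  [set A *m x | x in scone V] = scone (A *m V).
Proof.
move=> hA; apply/seteqP; split.
  move=> _ [x [hx [b b0 xE]] <-]; split; first by apply/hspace_hisom.
  by exists b => //; rewrite xE mulmxA.
move=> x [hx [b b0 xE]]; exists (V *m b); last by rewrite xE mulmxA.
by split; [apply/(hspace_hisom _ hA); rewrite mulmxA -xE | exists b].
Qed.

Lemma hisom_basis A V : hisom A -> future_basis V -> future_basis (A *m V).
Proof.
move=> hA [uV fV]; split; first by rewrite unitmx_mul hisom_unit.
by move=> j; rewrite colE -mulmxA -colE; exact: hisom_future.
Qed.

Lemma hisom_image_polytope A P : hisom A -> is_polytope P ->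
  is_polytope [set A *m x | x in P].
Proof.
move=> hA /is_polytopeP[s gs ->]; apply/is_polytopeP; exists [seq A *m V | V <- s].
  by move=> _ /mapP[V Vs ->]; apply: hisom_basis => //; exact: gs.
apply/seteqP; split.
  move=> _ [x [V Vs xV] <-]; exists (A *m V); first exact: map_f.
  by rewrite -hisom_image_scone //; exists x.
move=> x [_ /mapP[V Vs ->]]; rewrite -hisom_image_scone // => -[y yV <-].
by exists y => //; exists V.
Qed.

Lemma thin_image A X : A \in unitmx -> thin X -> thin [set A *m x | x in X].
Proof.
move=> uA [ls ls0 h]; exists [seq l *m invmx A | l <- ls].
  move=> _ /mapP[l /ls0 l0 ->]; apply: contra_neq l0 => /(congr1 (mulmx^~ A)).
  by rewrite mulmxKV // mul0mx.
move=> _ [x /h[l ls_l lx] <-]; exists (l *m invmx A); first exact: map_f.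
by rewrite /lval -mulmxA mulKmx.
Qed.

Lemma measurable_nonneg l : measurable [set x | 0 <= lval l x].
Proof.
rewrite (_ : [set _ | _] = lval l @^-1` `[0, +oo[).
  by apply: measurable_preimage; [exact: measurable_lval | exact: measurable_itv].
by apply/seteqP; split => x /=; rewrite in_itv /= andbT.
Qed.

Lemma measurable_scone V : V \in unitmx -> measurable (scone V).
Proof.
move=> uV; rewrite scone_facets // (_ : [set x | _] =
  hspace `&` \bigcap_(i in [set: 'I_n.+1]) [set x | 0 <= lval (facet V i) x]).
  apply: measurableI; first exact: measurable_hspace.
  by apply: fin_bigcap_measurable => // i _; exact: measurable_nonneg.
by apply/seteqP; split => x [hx h]; split=> // i; [move=> _|]; exact: h.
Qed.

Lemma measurable_polytope P : is_polytope P -> measurable P.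
Proof.
move=> /is_polytopeP[s gs ->]; elim: s gs => [|V s IH] gs.
  by rewrite polyset_nil; exact: measurable0.
rewrite polyset_cons; apply: measurableU.
  by apply: measurable_scone; have [] := gs V (mem_head _ _).
by apply: IH => W Ws; apply: gs; rewrite inE Ws orbT.
Qed.

Lemma hmeasure_thin X : measurable X -> thin X -> hmeasure X = 0%E.
Proof.
move=> mX [ls ls0 h].
have mH l : measurable [set x | lval l x = 0] by exact: measurable_affine_hyperplane.
have : hmeasure (\big[setU/set0]_(l <- ls) [set x | lval l x = 0]) = 0%E.
  elim: ls ls0 {h} => [|l ls IH] ls0; first by rewrite big_nil measure0.
  rewrite big_cons; apply/eqP; rewrite eq_le measure_ge0 andbT.
  have m1 : measurable (\big[setU/set0]_(l <- ls) [set x | lval l x = 0]).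
    by apply: bigsetU_measurable => k _; exact: mH.
  apply: le_trans (measureU2 (@hmeasure R n) (mH l) m1) _.
  have h1 : hmeasure (\big[setU/set0]_(l <- ls) [set x | lval l x = 0]) = 0%E.
    by apply: IH => k kls; apply: ls0; rewrite inE kls orbT.
  have h2 := hmeasure_hyperplane (ls0 l (mem_head _ _)).
  by rewrite [X in (X + _)%E]h2 [X in (_ + X)%E]h1 adde0.
move=> h0; apply/eqP; rewrite eq_le measure_ge0 andbT -h0; apply: le_measure; rewrite ?inE //.
  by apply: bigsetU_measurable => k _; exact: mH.
by move=> x /h[l ls_l lx]; rewrite -bigcup_seq; exists l.
Qed.

Lemma lform_sum (I : finType) (b : I -> R) (v : I -> vec) y :
  lform (\sum_i b i *: v i) y = \sum_i b i * lform (v i) y.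
Proof.
rewrite (big_morph (fun u => lform u y) (id1 := 0) (op1 := +%R)).
- by apply: eq_bigr => i _; rewrite lformZl.
- by move=> u w; rewrite lformDl.
- by rewrite -(scale0r 0) lformZl mul0r.
Qed.

(** The cross terms of the Lorentz form on a simplicial cone are negative, so
    each coordinate of a point of the hyperboloid is bounded by its own square
    term. *)
Lemma scone_hball V : future_basis V -> exists r : R, scone V `<=` hball r.
Proof.
move=> [uV fV]; pose c j := 1 + (- lorentz (col j V))^-1.
exists (\sum_j c j * col j V ord0 ord0) => x [hx [b b0 xE]]; split=> //.
have lj j : lform (col j V) x <= b j ord0 * lorentz (col j V).
  rewrite lformC {1}xE mulmx_cols lform_sum (bigD1 j) //= lorentzE gerDl.
  apply: sumr_le0 => k _; apply: mulr_ge0_le0 => //.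
  by apply: ltW; exact: lform_future.
have neg j : b j ord0 * lform (col j V) x <= 0.
  apply: mulr_ge0_le0 => //; apply: le_trans (lj j) _.
  by apply: mulr_ge0_le0 => //; have [/ltW] := fV j.
have bc j : b j ord0 <= c j.
  have [lv _] := fV j; set L := - lorentz (col j V).
  have L0 : 0 < L by rewrite oppr_gt0.
  have h : b j ord0 ^+ 2 * L <= 1.
    have : lform x x <= b j ord0 * lform (col j V) x.
      rewrite {1}xE mulmx_cols lform_sum (bigD1 j) //= gerDl.
      by apply: sumr_le0 => k _; exact: neg.
    rewrite hspace_lorentz // => h1.
    have : b j ord0 * lform (col j V) x <= b j ord0 * (b j ord0 * lorentz (col j V)).
      by apply: ler_wpM2l.
    by move=> /(le_trans h1); rewrite mulrA -expr2 /L mulrN lerNl.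
  rewrite leNgt; apply/negP; rewrite /c -/L => cb; move: h; apply/negP; rewrite -ltNge.
  have Li : 0 < L^-1 by rewrite invr_gt0.
  have LL : L^-1 * L = 1 by rewrite mulVf // gt_eqF.
  have b1 : 1 < b j ord0 by apply: lt_trans cb; rewrite ltrDl.
  apply: (@lt_le_trans _ _ (b j ord0 * L)).
    by rewrite -LL ltr_pM2r //; apply: lt_trans cb; rewrite ltrDr.
  by rewrite ler_pM2r // expr2 ler_peMl ?b0 // ltW.
rewrite {1}xE mulmx_cols summxE; apply: ler_sum => j _; rewrite mxE.
by apply: ler_wpM2r => //; have [_ /ltW] := fV j.
Qed.

Lemma polytope_hball P : is_polytope P -> exists r : R, P `<=` hball r.
Proof.
move=> /is_polytopeP[s gs ->]; elim: s gs => [|V s IH] gs.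
  by exists 0; rewrite polyset_nil.
have [|r hr] := IH; first by move=> W Ws; apply: gs; rewrite inE Ws orbT.
have [r' hr'] := scone_hball (gs V (mem_head _ _)).
exists (Num.max r r'); rewrite polyset_cons => x [/hr'|/hr] [hx xr].
all: by split=> //; rewrite le_max xr ?orbT.
Qed.

Lemma hball_le (r r' : R) : r <= r' -> (hball r : set vec) `<=` hball r'.
Proof. by move=> rr x [hx xr]; split=> //; exact: le_trans rr. Qed.

End PolytopeBoolean.

(** * Interiors and overlaps *)

Section HyperbolicInterior.
Variables (R : realType) (n : nat).
Local Notation vec := 'cV[R]_n.+1.
Local Notation mat := 'M[R]_n.+1.
Local Notation lval := (@lval R n).
Local Notation scone := (@scone R n).
Local Notation future_basis := (@future_basis R n).
Local Notation hspace := (@hspace R n).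
Implicit Types (x y : vec) (V W A : mat) (l : 'rV[R]_n.+1).
Implicit Types (X Y P Q : set vec).

Lemma continuous_lval l : continuous (lval l).
Proof.
have -> : lval l = (fun x => \sum_j l ord0 j * x j ord0).
  by apply/funext => x; rewrite /lval mxE.
apply: (continuous_big (@add_continuous _)) => j _ x.
apply: (@continuousM _ _ (cst (l ord0 j)) (fun x => x j ord0)).
  exact: cst_continuous.
exact: coord_continuous.
Qed.

Lemma continuous_sqr_coord i : continuous (fun x : vec => x i ord0 ^+ 2).
Proof.
move=> x; apply: (@continuousM _ _ (fun x => x i ord0) (fun x => x i ord0)).
all: exact: coord_continuous.
Qed.

Lemma continuous_lorentz : continuous (@lorentz R n).
Proof.
move=> x; apply: (@continuousD _ _ _ (fun x : vec => - x ord0 ord0 ^+ 2)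
    (fun x : vec => \sum_(i < n) x (lift ord0 i) ord0 ^+ 2)).
  by apply: continuousN; exact: continuous_sqr_coord.
move: x; apply: (continuous_big (@add_continuous _)) => j _.
exact: continuous_sqr_coord.
Qed.

Lemma radial_hspace x : hspace x -> radial x = x.
Proof. by case=> lx _; rewrite /radial lx opprK sqrtr1 invr1 scale1r. Qed.

Lemma radial_cvg x : hspace x -> radial y @[y --> x] --> x.
Proof.
move=> hx; rewrite -{2}(radial_hspace hx).
have c0 : {for x, continuous (fun y => Num.sqrt (- lorentz y))}.
  apply: (@continuous_comp _ _ _ (fun y => - lorentz y) Num.sqrt).
    by apply: continuousN; exact: continuous_lorentz.
  exact: sqrt_continuous.
have nz : Num.sqrt (- lorentz x) != 0.
  by case: hx => -> _; rewrite opprK sqrtr1 oner_eq0.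
exact: (cvgZ (cvgV nz c0) cvg_id).
Qed.

Lemma moment_curve_cvg V x : moment_curve V x e @[e --> (0 : R)^'+] --> x.
Proof.
have cp (j : 'I_n.+1) : (e : R) ^+ j.+1 @[e --> (0 : R)^'+] --> (0 : R).
  rewrite -[X in _ --> X](expr0n R j.+1).
  by apply: cvg_at_right_filter; exact: exprn_continuous.
have c : (V *m moment_vec n e) @[e --> (0 : R)^'+] --> (0 : vec).
  rewrite (_ : (fun e : R => V *m moment_vec n e) =
      (fun e : R => \sum_(j < n.+1) e ^+ j.+1 *: col j V)); last first.
    apply/funext => e; rewrite mulmx_cols; apply: eq_bigr => j _.
    by rewrite mxE.
  have s0 : \sum_(j < n.+1) (0 : R) *: col j V = 0 by rewrite big1 // => j _; rewrite scale0r.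
  rewrite -[X in _ --> X]s0.
  apply: (@cvg_big vec 'I_n.+1 +%R 0 xpredT (@add_continuous _) R ((0 : R)^'+)
    (index_enum 'I_n.+1) (fun (j : 'I_n.+1) (e : R) => e ^+ j.+1 *: col j V)
    (fun j => 0 *: col j V) _).
  by move=> j _; exact: cvgZr_tmp (cp j).
by have h := cvgD (cvg_cst x) c; rewrite addr0 in h; exact: h.
Qed.

Lemma future_near x : future x -> \forall y \near x, future y.
Proof.
move=> [lx x0]; near=> y; split.
  by near: y; apply: (cvgr_lt (lorentz x)) => //; exact: continuous_lorentz.
near: y; apply: (cvgr_gt (x ord0 ord0)) => //; exact: coord_continuous.
Unshelve. all: by end_near. Qed.

Lemma hinteriorI X Y : hinterior (X `&` Y) = hinterior X `&` hinterior Y.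
Proof.
apply/seteqP; split => x.
  by move=> [hx h]; split; split=> //; apply: filterS h => y [].
by move=> [[hx h] [_ h']]; split=> //; apply: filterI.
Qed.

Lemma hinterior_sub X Y : X `<=` Y -> hinterior X `<=` hinterior Y.
Proof. by move=> XY x [hx h]; split=> //; apply: filterS h. Qed.

(** A moment curve from an interior point stays in the set for a while, and leaves
    any given hyperplanes at once. *)
Lemma hinterior_not_thin X x : hinterior X x -> ~ thin X.
Proof.
move=> [hx hX] [ls ls0 h].
have cv := @moment_curve_cvg 1%:M x.
have nearX : \forall e \near (0 : R)^'+, hspace (radial (moment_curve 1%:M x e)) ->
    X (radial (moment_curve 1%:M x e)).
  have cv' : radial (moment_curve 1%:M x e) @[e --> (0 : R)^'+] --> x.
    exact: (cvg_comp _ _ cv (radial_cvg hx)).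
  exact: (cv' _ hX).
have nearF : \forall e \near (0 : R)^'+, future (moment_curve 1%:M x e).
  exact: (cv _ (future_near (hspace_future hx))).
have [d /= d0 hd] := filterI nearX nearF.
have [e [e0 ed he]] := moment_curve_avoid x (unitmx1 _ _) ls0 d0.
have [|//|hXe fe] := hd e; first by rewrite /= sub0r normrN gtr0_norm.
have [l ls_l /eqP] := h _ (hXe (hspace_radial fe)).
by rewrite lval_radial_eq0 // (negbTE (he _ ls_l)).
Qed.

Lemma scone_interior V : future_basis V -> exists x, hinterior (scone V) x.
Proof.
move=> [uV fV]; pose b : vec := const_mx 1; exists (radial (V *m b)).
have fb : future (V *m b).
  apply: future_mulmx => // [i|]; first by rewrite mxE ler01.
  by exists ord0; rewrite mxE ltr01.
split; first exact: hspace_radial.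
have h : \forall y \near radial (V *m b), forall i, 0 < lval (facet V i) y.
  apply: (@filter_forall _ _ (fun i y => 0 < lval (facet V i) y)
    (nbhs (radial (V *m b))) (nbhs_filter _)) => i.
  apply: (cvgr_gt (lval (facet V i) (radial (V *m b)))); last first.
    rewrite /radial lvalZ mulr_gt0 ?radial_scale_gt0 // lval_facet mulKmx // mxE.
    exact: ltr01.
  exact: continuous_lval.
by apply: filterS h => y hy hsy; rewrite scone_facets //; split=> // i; exact: ltW.
Qed.

Lemma polytope_interior P : is_polytope P -> P !=set0 -> exists x, hinterior P x.
Proof.
move=> /is_polytopeP[s gs ->] [x [V Vs _]].
have [y yV] := scone_interior (gs V Vs); exists y.
by apply: hinterior_sub yV => z zV; exists V.
Qed.

(** If the intersection is not thin, it agrees up to a thin set with a nonempty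
    polytope, which has interior points. *)
Lemma interiors_disjointP P Q : is_polytope P -> is_polytope Q ->
  hinterior P `&` hinterior Q = set0 <-> thin (P `&` Q).
Proof.
move=> hP hQ; split=> [h|h]; last first.
  apply/seteqP; split => // x; rewrite -hinteriorI => /hinterior_not_thin; exact.
have [S [pS h1 h2]] := polyhedralE (polyhedralI (polyhedral_polytope hP) (polyhedral_polytope hQ)).
have SP : S `<=` P by apply: polytope_sub => //; apply: thin_sub h2 => x [Sx Px]; split=> // -[].
have SQ : S `<=` Q by apply: polytope_sub => //; apply: thin_sub h2 => x [Sx Px]; split=> // -[].
have [S0|/set0P Sn] := eqVneq S set0; first by apply: thin_sub h1 => x PQx; rewrite S0; split.
have [x xS] := polytope_interior pS Sn.
have : (hinterior P `&` hinterior Q) x by split; apply: hinterior_sub xS.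
by rewrite h.
Qed.

End HyperbolicInterior.

(** * The assembler axioms *)

Section HyperbolicAssemblerAxioms.
Variables (R : realType) (n : nat) (G : set 'M[R]_n.+1) (hG : is_isom_group G).
Local Notation vec := 'cV[R]_n.+1.
Local Notation mat := 'M[R]_n.+1.
Local Notation AA := (hyp_assembler hG).
Local Notation hom := Defs.hom.
Implicit Types (x y : vec) (A B : mat) (X Y : set vec) (P Q S T : polytope R n).

Notation "A @* X" := [set A *m x | x in X] (at level 40, left associativity).

Lemma G_hisom A : G A -> hisom A.
Proof. exact: isog_sub hG _. Qed.

Lemma G_unit A : G A -> A \in unitmx.
Proof. by move=> /G_hisom /hisom_unit. Qed.

Lemma image1 X : 1%:M @* X = X.
Proof.
apply/seteqP; split => [_ [x Xx <-]|x Xx]; first by rewrite mul1mx.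
by exists x; rewrite ?mul1mx.
Qed.

Lemma imageM A B X : (A *m B) @* X = A @* (B @* X).
Proof.
apply/seteqP; split => [_ [x Xx <-]|_ [_ [x Xx <-] <-]].
  by exists (B *m x); [exists x|rewrite mulmxA].
by exists x => //; rewrite mulmxA.
Qed.

Lemma imageS A X Y : X `<=` Y -> A @* X `<=` A @* Y.
Proof. by move=> XY _ [x Xx <-]; exists x => //; exact: XY. Qed.

Lemma imageMV A X : A \in unitmx -> A @* (invmx A @* X) = X.
Proof. by move=> uA; rewrite -imageM mulmxV // image1. Qed.

Lemma imageVM A X : A \in unitmx -> invmx A @* (A @* X) = X.
Proof. by move=> uA; rewrite -imageM mulVmx // image1. Qed.

(** *** Morphisms as matrices *)

(** The identity matrix stands for the missing matrix of a morphism from the empty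
    polytope, whose image is empty in any case. *)
Definition hom_mx P Q (f : polyhom G P Q) : mat :=
  match f with from_empty _ => 1%:M | by_isom A _ _ _ => A end.

Lemma hom_mx_G P Q (f : polyhom G P Q) : G (hom_mx f).
Proof. by case: f => //= _; exact: isog_1 hG. Qed.

Lemma image_homE P Q (f : polyhom G P Q) : image_hom f = hom_mx f @* sval P.
Proof. by case: f => //= e; rewrite e image_set0. Qed.

Lemma image_hom_sub P Q (f : polyhom G P Q) : image_hom f `<=` sval Q.
Proof. by case: f => [e|A GA nP sA] /=; [exact: sub0set | exact: sA]. Qed.

Lemma image_hom_polytope P Q (f : polyhom G P Q) : is_polytope (image_hom f).
Proof.
rewrite image_homE; apply: hisom_image_polytope; last exact: (svalP P).
exact/G_hisom/hom_mx_G.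
Qed.

(** From the empty polytope there is only one morphism, so the matrix can be
    recovered only when the source is nonempty. *)
Lemma hom_of_mx P Q A : G A -> A @* sval P `<=` sval Q ->
  {f : polyhom G P Q | image_hom f = A @* sval P & sval P !=set0 -> hom_mx f = A}.
Proof.
move=> GA sA; case: (pselect (sval P = set0)) => [e|ne].
  exists (from_empty G Q e); first by rewrite /= e image_set0.
  by case=> x; rewrite e.
by exists (by_isom GA (nonempty_of_neq ne) sA).
Qed.

Lemma polyhom_eq P Q (f g : polyhom G P Q) :
  (sval P !=set0 -> hom_mx f = hom_mx g) -> f = g.
Proof.
case: f => [e|A GA nP sA]; case: g => [e'|B GB nP' sB] /= h.
- by congr from_empty; exact: Prop_irrelevance.
- by exfalso; case: nP' => x; rewrite e.
- by exfalso; case: nP => x; rewrite e'.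
- by apply: by_isom_eq; exact: h.
Qed.

Lemma hom_mx_comp P Q S (g : polyhom G Q S) (f : polyhom G P Q) : sval P !=set0 ->
  hom_mx (polyhom_comp hG g f) = hom_mx g *m hom_mx f.
Proof.
case: f => [e|A GA nP sA] /=; first by case=> x; rewrite e.
by case: g => [e|B GB nQ sB] //=; case: (Defs.image_nonempty nP sA e).
Qed.

Lemma image_hom_comp P Q S (g : polyhom G Q S) (f : polyhom G P Q) :
  image_hom (polyhom_comp hG g f) = hom_mx g @* image_hom f.
Proof.
have [P0|/eqP/set0P nP] := pselect (sval P = set0).
  by rewrite !image_homE P0 !image_set0.
by rewrite !image_homE hom_mx_comp // imageM.
Qed.

Lemma hom_mx_id P : hom_mx (polyhom_id hG P) = 1%:M.
Proof. by rewrite /polyhom_id; case: pselect. Qed.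

Lemma is_polytope0 : is_polytope (set0 : set vec).
Proof.
exists 0%N, (fun i : 'I_0 => set0); split; first by case.
by apply/seteqP; split => // x [] [].
Qed.

Lemma is_polytope_bigcup (I : finType) (F : I -> set vec) :
  (forall i, is_polytope (F i)) -> is_polytope (\bigcup_(i in [set: I]) F i).
Proof.
move=> hF; rewrite bigcup_finE; apply: (big_ind (@is_polytope R n)) => [|X Y|i _]; [exact: is_polytope0| |exact: hF].
move=> /is_polytopeP[s gs ->] /is_polytopeP[t gt ->]; apply/is_polytopeP.
by exists (s ++ t); [exact: all_bases_cat | rewrite polyset_cat].
Qed.

Definition empty_polytope : polytope R n := exist _ set0 is_polytope0.

Definition polytope_ae X P := thin (X `\` sval P) /\ thin (sval P `\` X).

Lemma polyhedral_choice (I : Type) (X : I -> set vec) : (forall i, polyhedral (X i)) ->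
  exists P : I -> polytope R n, forall i, polytope_ae (X i) (P i).
Proof.
move=> hX; have h i : exists P, polytope_ae (X i) P.
  by have [P [pP h1 h2]] := polyhedralE (hX i); exists (exist _ P pP).
by have [P hP] := choice h; exists P.
Qed.

Lemma polyhedral_sval P : polyhedral (sval P).
Proof. exact/polyhedral_polytope/svalP. Qed.

(** By [polytope_sub], an inclusion of polytopes needs to be checked only up to thin
    sets; the same holds for covers, in the next lemma. *)
Lemma polytope_ae_sub X P Q : polytope_ae X P -> thin (X `\` sval Q) -> sval P `<=` sval Q.
Proof.
move=> [_ h] h'; apply: (polytope_sub (svalP P) (svalP Q)); exact: thin_trans h h'.
Qed.

Lemma polytope_ae_cover (I : finType) (X : I -> set vec) (P : I -> polytope R n) Q :
  (forall i, polytope_ae (X i) (P i)) -> thin (sval Q `\` \bigcup_(i in setT) X i) ->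
  sval Q `<=` \bigcup_(i in [set: I]) sval (P i).
Proof.
move=> hP h; apply: (polytope_sub (svalP Q)); first by apply: is_polytope_bigcup => i; exact: svalP.
apply: thin_trans h _; apply: thin_sub (thin_bigcup (fun i => (hP i).1)).
by move=> x [[i _ Xx] h']; exists i => //; split=> // Px; apply: h'; exists i.
Qed.

Lemma is_initialP P : @is_initial AA P <-> sval P = set0.
Proof.
split=> [h|P0 Q]; last first.
  exists (from_empty G Q P0) => g; apply: polyhom_eq; by rewrite P0 => -[].
have [f _] := h empty_polytope.
by apply/seteqP; split => // x Px; have := image_hom_sub (f := f); rewrite image_homE => /(_ (hom_mx f *m x)); apply; exists x.
Qed.

Lemma hyp_asm_id Q : @covering AA _ _ Q (fun _ : unit => polyhom_id hG Q).
Proof.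
rewrite /covering /=; apply/seteqP; split => x.
  by move=> [_ _]; rewrite image_homE hom_mx_id image1.
by move=> Qx; exists tt => //; rewrite image_homE hom_mx_id image1.
Qed.

Lemma hyp_asm_comp (I : finType) (P : I -> ob AA) (Q : ob AA)
    (f : forall i, hom (P i) Q) (J : I -> finType)
    (S : forall i, J i -> ob AA) (g : forall i j, hom (S i j) (P i)) :
  covering f -> (forall i, covering (g i)) ->
  covering (fun k : {i : I & J i} =>
      mcomp (f (projT1 k)) (g (projT1 k) (projT2 k))).
Proof.
rewrite /covering /= => cf cg; rewrite -cf; apply/seteqP; split => x.
  move=> [[i j] _ /=]; rewrite image_hom_comp => -[y gy <-]; exists i => //.
  by rewrite image_homE; exists y => //; exact: image_hom_sub gy.
move=> [i _]; rewrite image_homE => -[y]; rewrite -cg => -[j _ gy] <-.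
by exists (existT _ i j) => //=; rewrite image_hom_comp; exists y.
Qed.

(** The pieces are the intersections of [Q'] with the preimages of the images of
    the [f i]. *)
Lemma hyp_asm_pullback (I : finType) (P : I -> ob AA) (Q Q' : ob AA)
    (f : forall i, hom (P i) Q) (u : hom Q' Q) : covering f ->
  exists (J : finType) (S : J -> ob AA) (g : forall j, hom (S j) Q'),
      covering g /\ refines (fun j => mcomp u (g j)) f.
Proof.
rewrite {1}/covering /= => cf.
pose A := hom_mx u; have GA : G A := hom_mx_G u; have uA := G_unit GA.
have GAV : G (invmx A) by exact: isog_V.
pose X i := sval Q' `&` invmx A @* image_hom (f i).
have hX i : polyhedral (X i).
  apply: polyhedralI; first exact: polyhedral_sval.
  apply: polyhedral_polytope; apply: hisom_image_polytope; first exact: G_hisom.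
  exact: image_hom_polytope.
have [S hS] := polyhedral_choice hX.
have SQ i : 1%:M @* sval (S i) `<=` sval Q'.
  rewrite image1; apply: polytope_ae_sub (hS i) _.
  by apply: thin_sub (@thin0 R n) => x [[]].
pose g i := s2val (hom_of_mx (isog_1 hG) (SQ i)).
have gE i : image_hom (g i) = sval (S i).
  by rewrite /g; case: hom_of_mx => /= h -> _; rewrite image1.
exists I, S, g; split.
  rewrite /covering /=; apply/seteqP; split => x.
    by move=> [i _]; exact: image_hom_sub.
  move=> Qx; have [i _ Sx] : (\bigcup_(i in [set: I]) sval (S i)) x.
    apply: polytope_ae_cover hS _ _ Qx; apply: thin_sub (@thin0 R n) => y [Q'y]; apply.
    have : (A @* sval Q') (A *m y) by exists y.
    rewrite -image_homE => /image_hom_sub; rewrite -cf => -[i _ fi].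
    exists i => //; split=> //; exists (A *m y) => //; by rewrite mulKmx.
  by exists i => //; rewrite gE.
move=> i; exists i; pose B := hom_mx (f i).
have GB : G B := hom_mx_G (f i); have uB := G_unit GB.
have sa : (invmx B *m A) @* sval (S i) `<=` sval (P i).
  rewrite imageM; have fiE : image_hom (f i) = B @* sval (P i) by rewrite image_homE.
  suff h : A @* sval (S i) `<=` image_hom (f i).
    by rewrite -[X in _ `<=` X](imageVM _ uB) -fiE; exact: imageS.
  rewrite -[X in _ `<=` X](imageMV _ uA); apply: imageS.
  apply: (polytope_sub (svalP _)).
    by apply: hisom_image_polytope; [exact: G_hisom | exact: image_hom_polytope].
  have [_ h2] := hS i; apply: thin_sub h2 => x [Sx nx]; split=> // -[]; exact.
have [a aE amx] := hom_of_mx (isog_M hG (isog_V hG GB) GA) sa.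
exists a; apply: polyhom_eq => nS; rewrite !hom_mx_comp // amx //.
rewrite mulKVmx // /g; case: hom_of_mx => /= h _ ->; by rewrite ?mulmx1.
Qed.

Lemma hyp_asm_saturated (I J : finType) (P : I -> ob AA) (P' : J -> ob AA)
    (Q : ob AA) (f : forall i, hom (P i) Q) (g : forall j, hom (P' j) Q) :
  covering f -> refines f g -> covering g.
Proof.
rewrite /covering /= => cf rf; apply/seteqP; split => x.
  by move=> [j _]; exact: image_hom_sub.
rewrite -cf => -[i _ fx]; have [j [a fE]] := rf i; exists j => //.
move: fx; rewrite fE /= image_hom_comp => -[y ay <-]; rewrite image_homE.
by exists y => //; exact: image_hom_sub ay.
Qed.

Lemma disjoint_morP (P1 P2 Q : ob AA) (f : hom P1 Q) (g : hom P2 Q) :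
  disjoint_mor f g <-> thin (image_hom f `&` image_hom g).
Proof. by apply: interiors_disjointP; exact: image_hom_polytope. Qed.

(** The polytope that agrees with the intersection of the two images up to a thin
    set maps compatibly to both sources, and it is empty only when the
    intersection is thin. *)
Lemma hyp_asm_disjoint (P1 P2 Q : ob AA) (f : hom P1 Q) (g : hom P2 Q) :
  disjoint_mor f g <->
  (forall (S : ob AA) (a : hom S P1) (b : hom S P2), mcomp f a = mcomp g b -> is_initial S).
Proof.
split=> [/disjoint_morP h S a b /= fgE|h].
  apply/is_initialP; apply/eqP/negPn/negP => /set0P nS.
  have [x xS] : exists x, hinterior (image_hom (polyhom_comp hG f a)) x.
    apply: polytope_interior; first exact: image_hom_polytope.
    by rewrite image_homE; case: nS => y Sy; exists (hom_mx (polyhom_comp hG f a) *m y); exists y.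
  apply: (hinterior_not_thin xS); apply: thin_sub h => y fy; split.
    move: fy; rewrite image_hom_comp => -[z az <-]; rewrite image_homE.
    by exists z => //; exact: image_hom_sub az.
  move: fy; rewrite fgE image_hom_comp => -[z az <-]; rewrite image_homE.
  by exists z => //; exact: image_hom_sub az.
apply/disjoint_morP.
have hX : polyhedral (image_hom f `&` image_hom g).
  by apply: polyhedralI; apply: polyhedral_polytope; exact: image_hom_polytope.
have [S [h1 h2]] : exists S, polytope_ae (image_hom f `&` image_hom g) S.
  by have [S hS] := polyhedral_choice (fun _ : unit => hX); exists (S tt).
have lift (P0 : ob AA) (k : hom P0 Q) : thin (sval S `\` image_hom k) ->
    invmx (hom_mx k) @* sval S `<=` sval P0.
  move=> tk; have uk := G_unit (hom_mx_G k).
  rewrite -[X in _ `<=` X](imageVM _ uk) -image_homE; apply: imageS.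
  exact: (polytope_sub (svalP S) (image_hom_polytope k)).
have [|a _ amx] := hom_of_mx (isog_V hG (hom_mx_G f)) (lift _ f _).
  by apply: thin_sub h2 => x [Sx nx]; split=> // -[].
have [|b _ bmx] := hom_of_mx (isog_V hG (hom_mx_G g)) (lift _ g _).
  by apply: thin_sub h2 => x [Sx nx]; split=> // -[].
have /h/is_initialP S0 : mcomp f a = mcomp g b.
  apply: polyhom_eq => nS; rewrite !hom_mx_comp // amx // bmx //.
  by rewrite !mulmxV // G_unit // ; exact: hom_mx_G.
by apply: thin_sub h1 => x fgx; split=> //; rewrite S0.
Qed.

(** The common refinement consists of the pairwise intersections of the images. *)
Lemma hyp_asm_refine (I J : finType) (P : I -> ob AA) (P' : J -> ob AA)
    (Q : ob AA) (f : forall i, hom (P i) Q) (g : forall j, hom (P' j) Q) :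
  is_cover f -> is_cover g ->
  exists (K : finType) (S : K -> ob AA) (h : forall k, hom (S k) Q),
    [/\ is_cover h, refines h f & refines h g].
Proof.
move=> [cf df] [cg dg]; rewrite /covering /= in cf cg.
pose X (k : I * J) := image_hom (f k.1) `&` image_hom (g k.2).
have hX k : polyhedral (X k).
  by apply: polyhedralI; apply: polyhedral_polytope; exact: image_hom_polytope.
have [S hS] := polyhedral_choice hX.
have Sf k : sval (S k) `<=` image_hom (f k.1).
  apply: (polytope_sub (svalP _) (image_hom_polytope _)).
  by have [_ h2] := hS k; apply: thin_sub h2 => x [Sx nx]; split=> // -[].
have Sg k : sval (S k) `<=` image_hom (g k.2).
  apply: (polytope_sub (svalP _) (image_hom_polytope _)).
  by have [_ h2] := hS k; apply: thin_sub h2 => x [Sx nx]; split=> // -[].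
have SQ k : 1%:M @* sval (S k) `<=` sval Q.
  by rewrite image1; apply: subset_trans (Sf k) _; exact: image_hom_sub.
pose h k := s2val (hom_of_mx (isog_1 hG) (SQ k)).
have hE k : image_hom (h k) = sval (S k).
  by rewrite /h; case: hom_of_mx => /= h' -> _; rewrite image1.
have hfac (P0 : ob AA) (k : hom P0 Q) kk : sval (S kk) `<=` image_hom k -> @factors_through AA (S kk) P0 Q (h kk) k.
  move=> Sk; have GB := hom_mx_G k; have uB := G_unit GB.
  have sa : invmx (hom_mx k) @* sval (S kk) `<=` sval P0.
    by rewrite -[X in _ `<=` X](imageVM _ uB) -image_homE; exact: imageS.
  have [a aE amx] := hom_of_mx (isog_V hG GB) sa; exists a.
  apply: polyhom_eq => nS; rewrite hom_mx_comp // amx // mulmxV //.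
  by rewrite /h; case: hom_of_mx => /= h' _ ->.
exists (I * J)%type, S, h; split; last 2 first.
- by move=> k; exists k.1; apply: hfac; exact: Sf.
- by move=> k; exists k.2; apply: hfac; exact: Sg.
split.
  rewrite /covering /=; apply/seteqP; split => x.
    by move=> [k _]; exact: image_hom_sub.
  move=> Qx; have [k _ Sx] : (\bigcup_(k in [set: I * J]) sval (S k)) x.
    apply: polytope_ae_cover hS _ _ Qx; apply: thin_sub (@thin0 R n) => y [Qy]; apply.
    move: (Qy); rewrite -{1}cf => -[i _ fi]; move: Qy; rewrite -cg => -[j _ gj].
    by exists (i, j).
  by exists k => //; rewrite hE.
move=> k k' kk; apply/disjoint_morP; rewrite !hE.
have [e1|ne1] := eqVneq k.1 k'.1.
  have ne2 : k.2 != k'.2 by apply: contra_neq kk => e2; rewrite [k]surjective_pairing [k']surjective_pairing e1 e2.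
  by have /disjoint_morP := dg _ _ ne2; apply: thin_sub => x [/Sg gx /Sg gx'].
by have /disjoint_morP := df _ _ ne1; apply: thin_sub => x [/Sf fx /Sf fx'].
Qed.

Lemma hyp_asm_monic (P Q : ob AA) (f : hom P Q) : is_mono f.
Proof.
move=> S a b /= fab; apply: polyhom_eq => nS.
have uf := G_unit (hom_mx_G f).
have := congr1 (@hom_mx _ _) fab; rewrite !hom_mx_comp // => e.
by rewrite -(mulKmx uf (hom_mx a)) e mulKmx.
Qed.

Theorem hyp_is_assembler : is_assembler AA.
Proof.
split.
- exact: hyp_asm_id.
- exact: hyp_asm_comp.
- exact: hyp_asm_pullback.
- exact: hyp_asm_saturated.
- exists empty_polytope; split; first exact/is_initialP.
  by move=> P f; rewrite /covering /=; apply/seteqP; split => // x [] [].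
- exact: hyp_asm_disjoint.
- exact: hyp_asm_refine.
- exact: hyp_asm_monic.
Qed.

End HyperbolicAssemblerAxioms.

(** * The volume function *)

Section RealVolume.
Variables (R : realType) (n : nat).
Local Notation vec := 'cV[R]_n.+1.
Local Notation mat := 'M[R]_n.+1.
Implicit Types (X Y P Q : set vec) (A : mat).

Definition bounded_set X := exists r : R, X `<=` hball r.

Definition vol X : R := fine (hmeasure X).

Lemma bounded_subset X Y : X `<=` Y -> bounded_set Y -> bounded_set X.
Proof. by move=> XY [r hr]; exists r; exact: subset_trans hr. Qed.

Lemma bounded_fin X : measurable X -> bounded_set X -> hmeasure X \is a fin_num.
Proof.
move=> mX [r hr]; rewrite ge0_fin_numE ?hmeasure_ge0 //.
apply: le_lt_trans (hmeasure_hball_fin n r); apply: le_measure; rewrite ?inE //.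
exact: measurable_hball.
Qed.

Lemma volE X : measurable X -> bounded_set X -> hmeasure X = (vol X)%:E.
Proof. by move=> mX bX; rewrite fineK // bounded_fin. Qed.

Lemma vol_ge0 X : 0 <= vol X.
Proof. exact/fine_ge0/hmeasure_ge0. Qed.

Lemma vol_sub X Y : measurable X -> measurable Y -> bounded_set Y -> X `<=` Y -> vol X <= vol Y.
Proof.
move=> mX mY bY XY; rewrite -lee_fin -!volE //; last exact: bounded_subset bY.
by apply: le_measure; rewrite ?inE.
Qed.

Lemma hmeasureU_null X Y : measurable X -> measurable Y -> hmeasure (X `&` Y) = 0%E ->
  hmeasure (X `|` Y) = (hmeasure X + hmeasure Y)%E.
Proof.
move=> mX mY h.
have E1 : hmeasure Y = (hmeasure (Y `\` X) + hmeasure (Y `&` X))%E := measureDI (@hmeasure R n) mY mX.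
have mD : measurable (Y `\` X) by exact: measurableD.
have E2 : hmeasure (X `|` (Y `\` X)) = (hmeasure X + hmeasure (Y `\` X))%E.
  by apply: (measureU (@hmeasure R n) mX mD); rewrite setDIK.
have <- : X `|` (Y `\` X) = X `|` Y.
  apply/seteqP; split => x; first by move=> [?|[? _]]; [left|right].
  by move=> [Xx|Yx]; [left|have [Xx|Xx] := pselect (X x); [left|right]].
by rewrite E2 E1 [Y `&` X]setIC h adde0.
Qed.

Lemma hmeasure_congr X Y : measurable X -> measurable Y ->
  thin (X `\` Y) -> thin (Y `\` X) -> hmeasure X = hmeasure Y.
Proof.
move=> mX mY h1 h2.
have E1 : hmeasure X = (hmeasure (X `\` Y) + hmeasure (X `&` Y))%E := measureDI (@hmeasure R n) mX mY.
have E2 : hmeasure Y = (hmeasure (Y `\` X) + hmeasure (Y `&` X))%E := measureDI (@hmeasure R n) mY mX.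
rewrite E1 E2 (hmeasure_thin (measurableD mX mY) h1).
by rewrite (hmeasure_thin (measurableD mY mX) h2) !add0e setIC.
Qed.

Lemma hmeasure_bigsetU (I : eqType) (s : seq I) (T : I -> set vec) :
  uniq s -> (forall i, i \in s -> measurable (T i)) ->
  (forall i j, i \in s -> j \in s -> i != j -> thin (T i `&` T j)) ->
  hmeasure (\big[setU/set0]_(i <- s) T i) = (\sum_(i <- s) hmeasure (T i))%E.
Proof.
elim: s => [|i s IH] /=; first by rewrite !big_nil measure0.
move=> /andP[nis us] mT tT; rewrite !big_cons -IH //; last 2 first.
- by move=> j js; apply: mT; rewrite inE js orbT.
- by move=> j k js ks; apply: tT; rewrite inE ?js ?ks orbT.
have mU : measurable (\big[setU/set0]_(i <- s) T i).
  rewrite big_seq; apply: bigsetU_measurable => j js; apply: mT.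
  by rewrite inE js orbT.
have mi : measurable (T i) by apply: mT; rewrite mem_head.
apply: hmeasureU_null => //; apply: hmeasure_thin; first exact: measurableI.
have : forall j, j \in s -> thin (T i `&` T j).
  move=> j js; apply: tT; rewrite ?mem_head // ?inE ?js ?orbT //.
  by apply: contraNneq nis => ->.
elim: (s) => [|j t IHt] h; first by rewrite big_nil setI0; exact: thin0.
rewrite big_cons setIUr; apply: thinU; first by apply: h; rewrite mem_head.
by apply: IHt => k kt; apply: h; rewrite inE kt orbT.
Qed.

Lemma bounded_bigcup (I : finType) (T : I -> set vec) :
  (forall i, bounded_set (T i)) -> bounded_set (\bigcup_(i in [set: I]) T i).
Proof.
move=> bT; rewrite bigcup_finE; apply: (big_ind bounded_set) => [|X Y [r hr] [r' hr']|i _] //.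
  by exists 0.
exists (Num.max r r') => x [/hr|/hr']; apply: hball_le; by rewrite le_max lexx ?orbT.
Qed.

(** Pairwise overlaps are null, so that they do not count. *)
Lemma vol_bigcup (I : finType) (T : I -> set vec) :
  (forall i, measurable (T i)) -> (forall i, bounded_set (T i)) ->
  (forall i j, i != j -> thin (T i `&` T j)) ->
  vol (\bigcup_(i in [set: I]) T i) = \sum_i vol (T i).
Proof.
move=> mT bT tT; apply: EFin_inj.
have mU : measurable (\bigcup_(i in [set: I]) T i) by exact: fin_bigcup_measurable.
rewrite -volE //; last exact: bounded_bigcup.
rewrite bigcup_finE hmeasure_bigsetU ?enum_uniq //; last by move=> *; exact: tT.
rewrite big_enum /= -sumEFin; apply: eq_bigr => i _; exact: volE.
Qed.

Lemma vol_bigcup_le (I : finType) (T : I -> set vec) Y :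
  (forall i, measurable (T i)) -> (forall i, T i `<=` Y) ->
  measurable Y -> bounded_set Y ->
  (forall i j, i != j -> thin (T i `&` T j)) ->
  \sum_i vol (T i) <= vol Y.
Proof.
move=> mT TY mY bY tT; rewrite -vol_bigcup // => [|i]; last exact: bounded_subset bY.
apply: vol_sub => //; first exact: fin_bigcup_measurable.
by move=> x [i _ /TY].
Qed.

Lemma vol_le_sum (I : finType) (T : I -> set vec) Y :
  (forall i, measurable (T i)) -> (forall i, bounded_set (T i)) -> measurable Y ->
  Y `<=` \bigcup_(i in [set: I]) T i -> vol Y <= \sum_i vol (T i).
Proof.
move=> mT bT mY YT; have mU : measurable (\bigcup_(i in [set: I]) T i) by exact: fin_bigcup_measurable.
have bU := bounded_bigcup bT.
apply: le_trans (vol_sub mY mU bU YT) _.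
rewrite -lee_fin -volE // bigcup_finE -sumEFin -big_enum /=.
have : (hmeasure (\big[setU/set0]_(i <- enum I) T i) <= \sum_(i <- enum I) hmeasure (T i))%E.
  elim: (enum I) => [|i s IH]; first by rewrite !big_nil measure0.
  rewrite !big_cons; apply: le_trans (measureU2 (@hmeasure R n) _ _) _ => //.
    by apply: bigsetU_measurable => j _.
  exact: leeD2l.
by move=> /le_trans; apply; apply: lee_sum => i _; rewrite volE.
Qed.

Lemma vol_congr X Y : measurable X -> measurable Y ->
  thin (X `\` Y) -> thin (Y `\` X) -> vol X = vol Y.
Proof. by move=> mX mY h1 h2; rewrite /vol (hmeasure_congr mX mY h1 h2). Qed.

Lemma vol_isom A X : hisom A -> measurable X -> vol [set A *m x | x in X] = vol X.
Proof. by move=> hA mX; rewrite /vol hmeasure_isom. Qed.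

Lemma vol0 : vol set0 = 0. Proof. by rewrite /vol measure0. Qed.

Lemma bounded_polytope P : is_polytope P -> bounded_set P.
Proof. by move=> /polytope_hball[r hr]; exists r. Qed.

End RealVolume.

Section HyperbolicVolumeFunction.
Variables (R : realType) (n : nat) (G : set 'M[R]_n.+1) (hG : is_isom_group G).

Lemma hyp_volE (P : ob (hyp_assembler hG)) : hyp_vol P = vol (sval P).
Proof. by rewrite /hyp_vol hvolumeE //; apply: measurable_polytope; exact: svalP. Qed.

Theorem hyp_is_volume : is_volume (@hyp_vol R n G hG).
Proof.
split=> [P|I P Q f [cf df]]; first by rewrite hyp_volE vol_ge0.
have pim i : is_polytope (image_hom (f i)) by exact: (image_hom_polytope hG).
rewrite hyp_volE -cf vol_bigcup.
- apply: eq_bigr => i _; rewrite hyp_volE image_homE //.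
  rewrite vol_isom //; first by apply: (G_hisom hG); exact: (hom_mx_G hG).
  by apply: measurable_polytope; exact: svalP.
- by move=> i; exact: measurable_polytope.
- by move=> i; exact: bounded_polytope.
- by move=> i j ij; apply/(disjoint_morP (hG := hG)); exact: df.
Qed.

End HyperbolicVolumeFunction.

(** * Cubes in the Klein model *)

Section KleinCubes.
Variables (R : realType) (n : nat).
Local Notation vec := 'cV[R]_n.+1.
Local Notation hspace := (@hspace R n).
Implicit Types (x y p q : vec) (c : 'I_n -> R) (h r : R).

(** The Klein coordinates, in which geodesic hyperplanes are affine. *)
Definition klein x (i : 'I_n) : R := x (lift ord0 i) ord0 / x ord0 ord0.

Lemma kleinK x i : hspace x -> x (lift ord0 i) ord0 = klein x i * x ord0 ord0.
Proof. by case=> _ x0; rewrite divfK // gt_eqF. Qed.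

Lemma hspace_ge1 x : hspace x -> 1 <= x ord0 ord0.
Proof.
move=> [lx x0]; rewrite -ler_sqr ?nnegrE ?ler01 ?(ltW x0) // expr1n.
move: lx; rewrite /lorentz => lx.
have : 0 <= \sum_(i < n) x (lift ord0 i) ord0 ^+ 2 by apply: sumr_ge0 => i _; exact: sqr_ge0.
lra.
Qed.

(** A bound on the time coordinate is the same as a bound, away from 1, on the norm
    of the Klein coordinates. *)
Lemma klein_sqr x : hspace x -> \sum_i klein x i ^+ 2 = 1 - (x ord0 ord0) ^- 2.
Proof.
move=> hx; have [lx x0] := hx; have x00 : x ord0 ord0 != 0 by rewrite gt_eqF.
have -> : \sum_i klein x i ^+ 2 = (\sum_(i < n) x (lift ord0 i) ord0 ^+ 2) * (x ord0 ord0) ^- 2.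
  by rewrite mulr_suml; apply: eq_bigr => i _; rewrite expr_div_n.
move: lx; rewrite /lorentz => lx.
have -> : \sum_(i < n) x (lift ord0 i) ord0 ^+ 2 = x ord0 ord0 ^+ 2 - 1 by lra.
by field.
Qed.

Lemma klein_lt1 x i : hspace x -> `|klein x i| < 1.
Proof.
move=> hx; have [_ x0] := hx.
have h := klein_sqr hx; have s0 : 0 <= \sum_(j | j != i) klein x j ^+ 2.
  by apply: sumr_ge0 => j _; exact: sqr_ge0.
rewrite -ltr_sqr ?nnegrE ?ler01 // expr1n real_normK ?num_real //.
rewrite (bigD1 i) //= in h.
have u0 : 0 < (x ord0 ord0) ^- 2 by rewrite invr_gt0 exprn_gt0.
apply: (@le_lt_trans _ _ (1 - x ord0 ord0 ^- 2)); last by rewrite ltrBlDr ltrDl.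
by rewrite -h lerDl.
Qed.

(** Half-open, so that the cubes of a grid are disjoint; the condition is linear
    in [x], so that the cubes are polyhedral. *)
Definition klein_cube c h : set vec :=
  [set x | hspace x /\ forall i, c i <= klein x i < c i + h].

Definition subcorner c h (L : nat) (a : {ffun 'I_n -> 'I_L}) : 'I_n -> R :=
  fun i => c i + (a i)%:R * (h / L%:R).

Lemma subcube_cover c h L : (0 < L)%N -> 0 < h ->
  klein_cube c h `<=` \bigcup_(a in [set: {ffun 'I_n -> 'I_L}])
    klein_cube (subcorner c h a) (h / L%:R).
Proof.
move=> L0 h0 x [hx hc]; have LR : 0 < L%:R :> R by rewrite ltr0n.
have H0 : 0 < h / L%:R by rewrite divr_gt0.
pose t i := (klein x i - c i) / (h / L%:R).
have t0 i : 0 <= t i by have /andP[? _] := hc i; rewrite divr_ge0 ?subr_ge0 // ltW.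
have tL i : (Num.truncn (t i) < L)%N.
  rewrite -(ltr_nat R); apply: le_lt_trans (_ : t i < L%:R); first by rewrite truncn_le.
  have /andP[_ h2] := hc i; rewrite ltr_pdivrMr // mulrC divfK ?gt_eqF //; lra.
exists [ffun i => Ordinal (tL i)] => //; split=> // i.
rewrite /subcorner ffunE /=.
have := truncn_itv (t0 i) => /andP[h1 h2].
have E : klein x i = c i + t i * (h / L%:R) by rewrite divfK ?gt_eqF //; ring.
rewrite E lerD2l ler_pM2r // h1 /= -addrA ltrD2l -[X in _ < _ + X]mul1r -mulrDl.
by rewrite ltr_pM2r // -(natrD R _ 1) addn1.
Qed.

Lemma subcube_disjoint c h L (a b : {ffun 'I_n -> 'I_L}) : 0 < h -> a != b ->
  klein_cube (subcorner c h a) (h / L%:R) `&` klein_cube (subcorner c h b) (h / L%:R) = set0.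
Proof.
move=> h0 ab; apply/seteqP; split => // x [[hx ha] [_ hb]]; move/eqP: ab; apply.
apply/ffunP => i; apply/val_inj => /=.
have L0 : 0 < L%:R :> R by rewrite ltr0n; case: (L) (a i) => [[]|].
have H0 : 0 < h / L%:R by rewrite divr_gt0.
have /andP[a1 a2] := ha i; have /andP[b1 b2] := hb i.
have lt1 (u v : nat) : c i + u%:R * (h / L%:R) <= klein x i ->
    klein x i < c i + v%:R * (h / L%:R) + h / L%:R -> (u <= v)%N.
  move=> h1 h2; rewrite -ltnS -(ltr_nat R) -(ltr_pM2r H0) -addn1 natrD mulrDl mul1r.
  by rewrite -(ltrD2l (c i)) addrA; exact: le_lt_trans h2.
by apply/eqP; rewrite eqn_leq !lt1.
Qed.

Lemma klein_cube_full : hspace `<=` klein_cube (fun=> -1) 2.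
Proof.
move=> x hx; split=> // i; have := klein_lt1 i hx; rewrite ltr_norml => /andP[h1 h2].
by rewrite ltW //=; lra.
Qed.

Lemma klein_cubeE c h : klein_cube c h = hspace `&` \bigcap_(i in [set: 'I_n])
  ([set x | 0 <= lval (\row_j (if j == ord0 then - c i else (j == lift ord0 i)%:R)) x] `&`
   [set x | 0 < lval (\row_j (if j == ord0 then c i + h else - (j == lift ord0 i)%:R)) x]).
Proof.
have E x (a b : R) i : lval (\row_j (if j == ord0 then a else b * (j == lift ord0 i)%:R)) x =
    a * x ord0 ord0 + b * x (lift ord0 i) ord0.
  rewrite /lval mxE big_ord_recl mxE eqxx (bigD1 i) //= !mxE eqxx mulr1 big1 ?addr0 //.
  move=> j ji; rewrite mxE /= (_ : (lift ord0 j == lift ord0 i) = false) ?mulr0 ?mul0r //.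
  by apply: negbTE; apply: contra_neq ji => /lift_inj.
have E1 x i : lval (\row_j (if j == ord0 then - c i else (j == lift ord0 i)%:R)) x =
    x (lift ord0 i) ord0 - c i * x ord0 ord0.
  rewrite -[RHS]addrC -mulNr -[X in _ + X]mul1r -E; congr (lval _ _).
  by apply/rowP => j; rewrite !mxE mul1r.
have E2 x i : lval (\row_j (if j == ord0 then c i + h else - (j == lift ord0 i)%:R)) x =
    (c i + h) * x ord0 ord0 - x (lift ord0 i) ord0.
  rewrite -[X in _ - X]mul1r -mulNr -E; congr (lval _ _).
  by apply/rowP => j; rewrite !mxE mulN1r.
apply/seteqP; split => x [hx hc]; split=> // i.
  move=> _; have [_ x0] := hx; have /andP[h1 h2] := hc i; split=> /=.
    by rewrite E1 subr_ge0 (kleinK _ hx) ler_pM2r.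
  by rewrite E2 subr_gt0 (kleinK _ hx) ltr_pM2r.
have [_ x0] := hx; have [/= ] := hc i I; rewrite E1 E2 subr_ge0 subr_gt0 (kleinK _ hx).
by rewrite ler_pM2r // ltr_pM2r // => -> ->.
Qed.

End KleinCubes.

(** * Moving small cubes *)

Section CubeGeometry.
Variables (R : realType) (n : nat).
Local Notation vec := 'cV[R]_n.+1.
Local Notation mat := 'M[R]_n.+1.
Local Notation hspace := (@hspace R n).
Implicit Types (x y p q : vec) (c : 'I_n -> R) (h r : R) (X Y : set vec).

Lemma polyhedral_bigcapI (I : finType) X (Y : I -> set vec) :
  (forall i Z, polyhedral Z -> polyhedral (Z `&` Y i)) -> polyhedral X ->
  polyhedral (X `&` \bigcap_(i in [set: I]) Y i).
Proof.
move=> hY hX.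
have -> : \bigcap_(i in [set: I]) Y i = \big[setI/setT]_(i <- enum I) Y i.
  rewrite -bigcap_seq; apply/seteqP; split => x xi i; first by move=> _; exact: xi.
  by move=> _; apply: xi; rewrite /= mem_enum.
elim: (enum I) => [|i s IH]; first by rewrite big_nil setIT.
by rewrite big_cons setIA setIAC; apply: hY.
Qed.

Lemma polyhedral_cube X c h : polyhedral X -> polyhedral (X `&` klein_cube c h).
Proof.
move=> hX; rewrite klein_cubeE setIA; apply: polyhedral_bigcapI.
  move=> i Z hZ; rewrite setIA; apply: polyhedral_pos; last apply: polyhedral_nonneg => //.
  1-2: apply/eqP => /rowP/(_ (lift ord0 i)); rewrite !mxE /= eqxx => /eqP.
  1-2: by rewrite ?oppr_eq0 oner_eq0.
apply: (polyhedral_ae (Y := X)) => //.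
- by apply: thin_sub (@thin0 R n) => x [[Xx _]].
- by apply: thin_sub (polyhedral_hspace hX) => x [Xx nx]; split=> // hx; apply: nx.
Qed.

Lemma measurable_cube c h : measurable (klein_cube c h : set vec).
Proof.
rewrite klein_cubeE; apply: measurableI; first exact: measurable_hspace.
apply: fin_bigcap_measurable => // i _; apply: measurableI; first exact: measurable_nonneg.
rewrite (_ : [set x | _] = lval (\row_j (if j == ord0 then c i + h else - (j == lift ord0 i)%:R)) @^-1` `]0, +oo[).
  by apply: measurable_preimage; [exact: measurable_lval | exact: measurable_itv].
by apply/seteqP; split => x /=; rewrite in_itv /= andbT.
Qed.

(** [klein_point] turns the conclusion into a point of [hball (2 * r)] with Klein
    coordinates [a]. *)
Lemma klein_near x (a : 'I_n -> R) (r H : R) : hspace x -> 1 <= r -> x ord0 ord0 <= r ->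
  0 <= H -> H <= 1 -> n%:R * H <= (4 * r ^+ 2)^-1 ->
  (forall i, `|a i - klein x i| <= H) -> \sum_i a i ^+ 2 <= 1 - (4 * r ^+ 2)^-1.
Proof.
move=> hx r1 xr H0 H1 nH ha.
have r0 : 0 < r by apply: lt_le_trans r1.
have r2 : 0 < r ^+ 2 by rewrite exprn_gt0.
have x0 : 0 < x ord0 ord0 by case: hx.
have step i : a i ^+ 2 <= klein x i ^+ 2 + 3 * H.
  have k1 := ltW (klein_lt1 i hx); have := ha i; set k := klein x i in k1 *.
  set d := a i - k => dH; have -> : a i = k + d by rewrite addrC subrK.
  rewrite sqrrD -addrA lerD2l.
  have d2 : d ^+ 2 <= H.
    rewrite -real_normK ?num_real // expr2; apply: le_trans (_ : H * 1 <= _); last by rewrite mulr1.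
    by apply: ler_pM => //; exact: le_trans dH H1.
  have kd : k * d <= H.
    apply: le_trans (ler_norm _) _; rewrite normrM -[leRHS]mul1r.
    by apply: ler_pM.
  by rewrite mulr2n; lra.
apply: le_trans (ler_sum _ (fun i _ => step i)) _.
rewrite big_split /= klein_sqr // sumr_const card_ord -mulr_natl.
have xr2 : r ^- 2 <= x ord0 ord0 ^- 2.
  by rewrite lef_pV2 ?posrE ?exprn_gt0 // lerXn2r // nnegrE ltW.
have e4 : (4 * r ^+ 2)^-1 = r ^- 2 / 4 by field; rewrite gt_eqF.
move: nH; rewrite e4 => nH.
have : n%:R * (3 * H) <= 3 * (r ^- 2 / 4) by rewrite mulrCA ler_pM2l // ltr0n.
move: xr2; set u := r ^- 2; set w := x ord0 ord0 ^- 2 => xr2 h3.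
lra.
Qed.

Lemma klein_point (a : 'I_n -> R) r : 1 <= r -> \sum_i a i ^+ 2 <= 1 - (4 * r ^+ 2)^-1 ->
  exists q, [/\ hspace q, q ord0 ord0 <= 2 * r & forall i, klein q i = a i].
Proof.
move=> r1 ha; have r0 : 0 < r by apply: lt_le_trans r1.
have u0 : 0 < (4 * r ^+ 2)^-1 by rewrite invr_gt0 mulr_gt0 // ?ltr0n // exprn_gt0.
pose D := 1 - \sum_i a i ^+ 2.
have D1 : (4 * r ^+ 2)^-1 <= D by rewrite /D; lra.
have D0 : 0 < D by apply: lt_le_trans D1.
pose t := (Num.sqrt D)^-1; have t0 : 0 < t by rewrite invr_gt0 sqrtr_gt0.
have t2 : t ^+ 2 = D^-1 by rewrite exprVn sqr_sqrtr // ltW.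
exists (vcons (t, \col_i (t * a i))); rewrite vcons0 /=; split.
- split; last by rewrite vcons0.
  rewrite lorentz_vcons (_ : sqnorm _ = t ^+ 2 * \sum_i a i ^+ 2); last first.
    by rewrite /sqnorm mulr_sumr; apply: eq_bigr => i _; rewrite mxE exprMn.
  rewrite t2 (_ : \sum_i _ = 1 - D); last by rewrite /D; ring.
  by field; rewrite gt_eqF.
- rewrite -ler_sqr ?nnegrE ?(ltW t0) ?mulr_ge0 ?(ltW r0) // t2.
  rewrite -[leRHS]invrK lef_pV2 ?posrE ?invr_gt0 ?exprn_gt0 ?mulr_gt0 //.
  by rewrite exprMn (_ : 2 ^+ 2 = 4 :> R) //; ring.
- by move=> i; rewrite /klein vcons0 vconsS /= mxE mulrAC divff ?gt_eqF // mul1r.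
Qed.

Lemma klein_cube_diam c h x y i : 0 <= h -> klein_cube c h x -> klein_cube c h y ->
  `|klein y i - klein x i| <= h.
Proof.
move=> h0 [_ hx] [_ hy]; have /andP[x1 x2] := hx i; have /andP[y1 y2] := hy i.
by rewrite ler_norml; apply/andP; split; lra.
Qed.

(** A side length at which every cube meeting [hball r] stays in [hball (2 * r)],
    together with its centre. *)
Definition small_side r h := [/\ 0 < h, h <= 1 & n%:R * h <= (4 * r ^+ 2)^-1].

Definition near_cube r c h := exists2 x, klein_cube c h x & x ord0 ord0 <= r.

Lemma near_cube_hball r c h : 1 <= r -> small_side r h -> near_cube r c h ->
  klein_cube c h `<=` hball (2 * r).
Proof.
move=> r1 [h0 h1 nh] [x xc xr] y yc; have hx := xc.1; have hy := yc.1; split=> //.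
have := klein_near hx r1 xr (ltW h0) h1 nh (fun i => klein_cube_diam i (ltW h0) xc yc).
move=> /(klein_point r1)[q [hq qr qk]].
have r0 : 0 < r by apply: lt_le_trans r1.
suff -> : y ord0 ord0 = q ord0 ord0 by [].
have : \sum_i klein y i ^+ 2 = \sum_i klein q i ^+ 2 by apply: eq_bigr => i _; rewrite qk.
rewrite !klein_sqr // => /addrI /oppr_inj /invr_inj /eqP.
by rewrite eqrXn2 // ?ltW //; [move/eqP | case: hy | case: hq].
Qed.

Lemma near_cube_center r c h : 1 <= r -> small_side r h -> near_cube r c h ->
  exists q, [/\ hspace q, q ord0 ord0 <= 2 * r & forall i, klein q i = c i + h / 2].
Proof.
move=> r1 [h0 h1 nh] [x xc xr]; have hx := xc.1; apply: klein_point => //.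
apply: (klein_near hx r1 xr (ltW h0) h1 nh) => i; have /andP[x1 x2] := xc.2 i.
by rewrite ler_norml; apply/andP; split; lra.
Qed.

(** The factor in [transvection_bound], and a factor [r] for the passage from Klein
    coordinates to ambient ones. *)
Definition distortion r : R := r * (1 + 6 * n%:R * r ^+ 2).

(** The transvection moving a point of a small cube to the centre of another
    cube distorts distances by at most a constant depending on [r], so a cube
    of side [h] goes well inside a cube of side [M * h]; the margin leaves room
    for replacing the transvection by an element of the dense subgroup. *)
Lemma move_into_cube (D : set mat) r (M : nat) c h c' q X : D `<=` @hisom_plus R n ->
  @hisom_plus R n `<=` closure D -> 1 <= r -> 8 * distortion r < M%:R -> 0 < h ->
  X `<=` klein_cube c h -> (forall x, X x -> x ord0 ord0 <= r) -> X !=set0 ->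
  hspace q -> q ord0 ord0 <= r -> (forall i, klein q i = c' i + (M%:R * h) / 2) ->
  exists2 g, D g & [set g *m x | x in X] `<=` klein_cube c' (M%:R * h).
Proof.
move=> Dp Dd r1 HM h0 Xc Xr [p Xp] hq qr qk.
have r0 : 0 < r by apply: lt_le_trans r1.
have hp : hspace p by have [] := Xc _ Xp.
have p0 : 0 < p ord0 ord0 by case: hp.
set T := transvection p q.
pose k := distortion r.
have k0 : 0 < k.
  have h6 : 0 <= 6 * n%:R * r ^+ 2 by rewrite !mulr_ge0 ?ler0n ?exprn_ge0 // ltW.
  by rewrite /k /distortion mulr_gt0 //; lra.
pose eta := h * k / (n.+1%:R * r).
have nr0 : 0 < n.+1%:R * r by rewrite mulr_gt0 // ltr0n.
have eta0 : 0 < eta by rewrite divr_gt0 // mulr_gt0.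
have [g [Dg Tg]] : D `&` ball T eta !=set0.
  have [Tp _] : hisom_plus T /\ True by split=> //; exact: transvection_hisom_plus.
  by apply: (Dd _ Tp); exact: nbhsx_ballx.
exists g => // _ [x Xx <-]; have [hg _] := Dp _ Dg.
have hx : hspace x by have [] := Xc _ Xx.
have hgx : hspace (g *m x) by exact: hisom_hspace.
split=> // i.
(* Up to rescaling, [x] is [p] plus a vector [z] without time component, which is
   small because [x] and [p] lie in one small cube. *)
pose lam := x ord0 ord0 / p ord0 ord0; pose z := x - lam *: p.
have pr j : `|p j ord0| <= r by apply: le_trans (hspace_coor_le j hp) (Xr _ Xp).
have qr' j : `|q j ord0| <= r by apply: le_trans (hspace_coor_le j hq) qr.
have xr j : `|x j ord0| <= r by apply: le_trans (hspace_coor_le j hx) (Xr _ Xx).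
have x0 : 0 < x ord0 ord0 by case: hx.
have z0 : z ord0 ord0 = 0 by rewrite !mxE /lam divfK ?subrr // gt_eqF.
have zb j : `|z j ord0| <= h * r.
  case: (unliftP ord0 j) => [m ->|->]; last by rewrite z0 normr0 mulr_ge0 // ltW.
  have -> : z (lift ord0 m) ord0 = (klein x m - klein p m) * x ord0 ord0.
    by rewrite !mxE /klein /lam; field; rewrite !gt_eqF.
  rewrite normrM; apply: ler_pM => //.
  exact: klein_cube_diam (ltW h0) (Xc _ Xp) (Xc _ Xx).
(* As [T] maps [p] to [q] and [g] is close to [T], the image of [x] is close to a
   multiple of [q]. *)
pose e := g *m x - lam *: q.
have eE : e = T *m z + (g - T) *m x.
  rewrite /e /z mulmxBr -scalemxAr /T transvection_point // mulmxBl.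
  by rewrite addrACA -[in RHS]addrA [X in _ = X]addrC; apply/colP => j; rewrite !mxE; ring.
have eb j : `|e j ord0| <= 2 * (h * k).
  rewrite eE mxE; apply: le_trans (ler_normD _ _) _; rewrite mulr2n mulrDl mul1r; apply: lerD.
    apply: le_trans (transvection_bound hp hq j _ (ltW r0) pr qr' z0 zb) _.
      by rewrite mulr_ge0 // ltW.
    by rewrite /k /distortion mulrA.
  rewrite mxE; apply: le_trans (ler_norm_sum _ _ _) _.
  apply: le_trans (ler_sum _ (_ : forall m, true -> _ <= eta * r)) _.
    move=> m _; rewrite normrM; apply: ler_pM => //.
    have [_ /(_ j m) hTg] := Tg.
    by rewrite mxE [X in _ + X]mxE distrC; apply: ltW; exact: hTg.
  by rewrite sumr_const card_ord -mulr_natl /eta mulrCA mulfVK // gt_eqF.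
have y1 : 1 <= (g *m x) ord0 ord0 by exact: hspace_ge1.
set y := g *m x in y1 hgx *.
have yE : y = lam *: q + e by rewrite /e addrC subrK.
pose gam := klein q i.
have gam1 : `|gam| <= 1 by apply: ltW; exact: klein_lt1.
have dev : `|y (lift ord0 i) ord0 - gam * y ord0 ord0| <= 4 * (h * k).
  have -> : y (lift ord0 i) ord0 - gam * y ord0 ord0 = e (lift ord0 i) ord0 - gam * e ord0 ord0.
    by rewrite yE !mxE (kleinK i hq) -/gam; ring.
  apply: le_trans (ler_normB _ _) _; rewrite normrM.
  have : `|gam| * `|e ord0 ord0| <= 1 * (2 * (h * k)) by apply: ler_pM.
  by have := eb (lift ord0 i); lra.
have hlt : 4 * (h * k) < M%:R * h / 2.
  have : 8 * k * h < M%:R * h by rewrite ltr_pM2r.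
  lra.
have y0 : 0 < y ord0 ord0 by apply: lt_le_trans y1.
have Mh0 : 0 <= M%:R * h / 2 by apply: ltW; apply: lt_trans hlt; rewrite mulr_gt0 ?ltr0n // mulr_gt0.
(* The time coordinate of [y] is at least 1, so dividing by it does not increase
   the deviation from the direction of [q]. *)
have kd : `|klein y i - gam| < M%:R * h / 2.
  rewrite -(ltr_pM2r y0) -{1}[y ord0 ord0]gtr0_norm // -normrM mulrBl -kleinK //.
  apply: (le_lt_trans dev); apply: (lt_le_trans hlt).
  by rewrite ler_peMr.
move: kd; rewrite /gam qk ltr_norml => /andP[k1 k2]; apply/andP; split; lra.
Qed.

End CubeGeometry.

(** * Grids *)

Section Grids.
Variables (R : realType) (n : nat).
Local Notation vec := 'cV[R]_n.+1.
Local Notation hspace := (@hspace R n).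
Local Notation row_vec := 'rV[R]_n.+1.
Implicit Types (x y p q : vec) (c : 'I_n -> R) (h r e : R) (X Y P : set vec) (L : nat).
Implicit Types (l : row_vec).

Definition grid_corner L : {ffun 'I_n -> 'I_L} -> 'I_n -> R := subcorner (fun=> -1) 2 (L := L).
Definition grid_cube L (a : {ffun 'I_n -> 'I_L}) : set vec :=
  klein_cube (grid_corner a) (2 / L%:R).

Lemma measurable_grid_cube L (a : {ffun 'I_n -> 'I_L}) : measurable (grid_cube a).
Proof. exact: measurable_cube. Qed.

Lemma grid_cover L : (0 < L)%N ->
  hspace `<=` \bigcup_(a in [set: {ffun 'I_n -> 'I_L}]) grid_cube a.
Proof.
by move=> L0 x /klein_cube_full xc; apply: (subcube_cover L0 _ xc); rewrite ltr0n.
Qed.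

Lemma grid_disjoint L (a b : {ffun 'I_n -> 'I_L}) : a != b ->
  grid_cube a `&` grid_cube b = set0.
Proof. by move=> ab; apply: subcube_disjoint; rewrite ?ltr0n. Qed.

Lemma grid_side_le e : 0 < e -> exists L0, forall L, (L0 <= L)%N -> (0 : R) < 2 / L%:R <= e.
Proof.
move=> e0; exists (Num.truncn (2 / e)).+1 => L hL.
have LR : 0 < L%:R :> R by rewrite ltr0n; exact: leq_trans hL.
have h : 2 / e <= L%:R.
  by apply: ltW; apply: lt_le_trans (truncnS_gt (2 / e)) _; rewrite ler_nat.
by rewrite divr_gt0 //= ler_pdivrMr // mulrC -ler_pdivrMr.
Qed.

Lemma grid_small_side r : 1 <= r ->
  exists L0, forall L, (L0 <= L)%N -> small_side n r (2 / L%:R).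
Proof.
move=> r1; have r0 : 0 < r by apply: lt_le_trans r1.
pose e := Num.min 1 ((4 * r ^+ 2)^-1 / n.+1%:R).
have u0 : 0 < (4 * r ^+ 2)^-1 by rewrite invr_gt0 mulr_gt0 // exprn_gt0.
have e0 : 0 < e by rewrite lt_min ltr01 divr_gt0.
have [L0 hL0] := grid_side_le e0; exists L0 => L /hL0 /andP[h0].
rewrite le_min => /andP[h1 h2]; split=> //.
rewrite ler_pdivlMr // in h2; rewrite mulrC; apply: le_trans h2.
by apply: ler_wpM2l; [exact: ltW | rewrite ler_nat].
Qed.

(** *** Cubes across the boundary *)

Definition row_norm l : R := \sum_j `|l ord0 j|.

(** Divided by the time coordinate, a functional is affine in the Klein
    coordinates. *)
Lemma lval_klein_var l x y h : hspace x -> hspace y -> 0 <= h ->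
  (forall i, `|klein y i - klein x i| <= h) ->
  `|lval l y / y ord0 ord0 - lval l x / x ord0 ord0| <= row_norm l * h.
Proof.
move=> hx hy h0 hk.
have E z : hspace z -> lval l z / z ord0 ord0 =
    l ord0 ord0 + \sum_(i < n) l ord0 (lift ord0 i) * klein z i.
  move=> [_ z0]; rewrite /lval mxE big_ord_recl mulrDl mulfK ?gt_eqF //; congr (_ + _).
  by rewrite mulr_suml; apply: eq_bigr => i _; rewrite mulrA.
rewrite !E // opprD addrACA subrr add0r -sumrB.
apply: le_trans (ler_norm_sum _ _ _) _; rewrite /row_norm big_ord_recl mulrDl.
apply: le_trans (_ : \sum_(i < n) `|l ord0 (lift ord0 i)| * h <= _); last first.
  by rewrite -mulr_suml lerDr mulr_ge0.
apply: ler_sum => i _; rewrite -mulrBr normrM; apply: ler_wpM2l => //.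
Qed.

Lemma slabs_small (ls : seq row_vec) r e : (forall l, l \in ls -> l != 0) -> 0 < e ->
  exists2 d, 0 < d & vol (hball r `&` [set x | exists2 l, l \in ls & slab l d x]) <= e.
Proof.
have E s d : hball r `&` [set x | exists2 l, l \in s & slab l d x] =
    \big[setU/set0]_(l <- s) (hball r `&` slab l d).
  rewrite -bigcup_seq; apply/seteqP; split => x.
    by move=> [xr [l ls_l xl]]; exists l.
  by move=> [l ls_l [xr xl]]; split=> //; exists l.
have mS s d : measurable (\big[setU/set0]_(l <- s) (hball r `&` slab l d)).
  by apply: bigsetU_measurable => l _; apply: measurableI; [exact: measurable_hball|exact: measurable_slab].
have bS X : bounded_set (hball r `&` X) by exists r => x [].
elim: ls e => [|l ls IH] e ls0 e0.
  by exists 1 => //; rewrite E big_nil vol0 ltW.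
have e2 : 0 < e / 2 by rewrite divr_gt0.
have [d1 d10 h1] := hmeasure_slab r (ls0 l (mem_head _ _)) e2.
have [|d2 d20 h2] := IH (e / 2) _ e2; first by move=> k kls; apply: ls0; rewrite inE kls orbT.
have d0 : 0 < Num.min d1 d2 by rewrite lt_min d10.
exists (Num.min d1 d2) => //; set d := Num.min d1 d2.
have m1 : measurable (hball r `&` slab l d1) by apply: measurableI; [exact: measurable_hball|exact: measurable_slab].
have m2 : measurable (hball r `&` [set x | exists2 l, l \in ls & slab l d2 x]) by rewrite E.
pose T (b : bool) := if b then hball r `&` slab l d1 else hball r `&` [set x | exists2 l, l \in ls & slab l d2 x].
have -> : e = e / 2 + e / 2 by lra.
apply: le_trans (vol_le_sum (T := T) _ _ _ _) _.
- by case.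
- by case; exact: bS.
- by rewrite E.
- move=> x [xr [k]]; rewrite inE => /predU1P[->|kls] /=.
    by rewrite /slab /= le_min => /andP[xl _]; exists true.
  by rewrite /slab /= le_min => /andP[_ xl]; exists false => //; split=> //; exists k.
rewrite big_bool /= lerD //.
by rewrite -lee_fin -volE.
Qed.

Lemma sum_grid_cubes L (p : pred {ffun 'I_n -> 'I_L}) :
  \sum_(a | p a) vol (grid_cube a : set vec) = \sum_a vol (if p a then grid_cube a else set0 : set vec).
Proof. by rewrite big_mkcond; apply: eq_bigr => a _; case: ifP; rewrite ?vol0. Qed.

Lemma grid_cubes_vol_le L (p : pred {ffun 'I_n -> 'I_L}) Y :
  (forall a, p a -> grid_cube a `<=` Y) -> measurable Y -> bounded_set Y ->
  \sum_(a | p a) vol (grid_cube a : set vec) <= vol Y.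
Proof.
move=> pY mY bY; rewrite sum_grid_cubes; apply: vol_bigcup_le => //.
- by move=> a; case: ifP => _; [exact: measurable_grid_cube | exact: measurable0].
- by move=> a z; case: ifP => // /pY; apply.
- move=> a b ab; case: ifP => _; last by rewrite set0I; exact: thin0.
  by case: ifP => _; rewrite ?setI0 ?grid_disjoint //; exact: thin0.
Qed.
Definition meets L P (a : {ffun 'I_n -> 'I_L}) : bool := `[< grid_cube a `&` P !=set0 >].
Definition inside L P (a : {ffun 'I_n -> 'I_L}) : bool := `[< grid_cube a `<=` P >].

Lemma meets_hball r P L (a : {ffun 'I_n -> 'I_L}) : P `<=` hball r -> meets P a ->
  near_cube r (grid_corner a) (2 / L%:R).
Proof. by move=> Pr /asboolP[x [ax /Pr[_ xr]]]; exists x. Qed.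

(** A cube that meets a polytope without being contained in it crosses a facet
    of one of its simplices, and so lies in a thin slab around that facet. *)
Lemma boundary_cubes_small P r e : is_polytope P -> P `<=` hball r -> 1 <= r -> 0 < e ->
  exists L0, forall L, (L0 <= L)%N ->
    \sum_(a : {ffun 'I_n -> 'I_L} | meets P a && ~~ inside P a) vol (grid_cube a) <= e.
Proof.
move=> /is_polytopeP[s gs ->] Pr r1 e0; have r0 : 0 < r by apply: lt_le_trans r1.
pose ls : seq row_vec := flatten [seq [seq facet V i | i <- enum 'I_n.+1] | V <- s].
have ls0 l : l \in ls -> l != 0.
  by move=> /flattenP[_ /mapP[V Vs ->] /mapP[i _ ->]]; apply: facet_neq0; have [] := gs V Vs.
have [d d0 hd] := slabs_small (2 * r) ls0 e0.
pose C := \sum_(l <- ls) row_norm l.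
have C0 : 0 <= C by apply: sumr_ge0 => l _; apply: sumr_ge0 => j _.
have Cl l : l \in ls -> row_norm l <= C.
  move=> ls_l; rewrite /C (big_rem l) //= lerDl sumr_ge0 // => k _.
  by apply: sumr_ge0 => j _.
have [L1 hL1] := grid_small_side r1.
have e1 : 0 < d / ((C + 1) * (2 * r)).
  by rewrite divr_gt0 // mulr_gt0 ?mulr_gt0 // ltr_wpDl.
have [L2 hL2] := grid_side_le e1.
exists (maxn L1 L2) => L hL; have {hL1} sm := hL1 L (leq_trans (leq_maxl _ _) hL).
have {hL2} /andP[h0 hh] := hL2 L (leq_trans (leq_maxr _ _) hL).
set h := 2 / L%:R in sm h0 hh.
apply: le_trans hd; apply: grid_cubes_vol_le.
- move=> a /andP[ma /asboolPn na] z az.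
  have nc := meets_hball Pr ma.
  have zr := near_cube_hball r1 sm nc az.
  split=> //; move: ma => /asboolP[x [ax [V Vs xV]]].
  have [y [ay ny]] : exists y, grid_cube a y /\ ~ polyset s y.
    apply: contrapT => /forallNP H; apply: na => y ay; apply: contrapT => ny.
    by apply: (H y).
  have [uV fV] := gs V Vs.
  have nyV : ~ scone V y by move=> yV; apply: ny; exists V.
  have [i li] : exists i, lval (facet V i) y < 0.
    apply: contrapT => /forallNP H; apply: nyV; rewrite scone_facets //; split; first by have [] := ay.
    by move=> i; rewrite leNgt; apply/negP; exact: H.
  have lx : 0 <= lval (facet V i) x by move: xV; rewrite scone_facets // => -[_]; apply.
  have l_ls : facet V i \in ls.
    apply/flattenP; exists [seq facet V i | i <- enum 'I_n.+1]; first by apply: map_f.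
    by apply: map_f; rewrite mem_enum.
  exists (facet V i) => //; set l := facet V i in li lx l_ls *.
  have hx := ax.1; have hy := ay.1; have hz := az.1.
  have x0 : 0 < x ord0 ord0 by case: hx.
  have y0 : 0 < y ord0 ord0 by case: hy.
  have z0 : 0 < z ord0 ord0 by case: hz.
  have zx := lval_klein_var l hx hz (ltW h0) (fun i => klein_cube_diam i (ltW h0) ax az).
  have zy := lval_klein_var l hy hz (ltW h0) (fun i => klein_cube_diam i (ltW h0) ay az).
  have lx' : 0 <= lval l x / x ord0 ord0 by rewrite divr_ge0 // ltW.
  have ly' : lval l y / y ord0 ord0 <= 0 by rewrite pmulr_lle0 ?invr_gt0 // ltW.
  have lz : `|lval l z / z ord0 ord0| <= row_norm l * h.
    move: zx zy; rewrite !ler_norml => /andP[z1 z2] /andP[z3 z4]; apply/andP; split; lra.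
  rewrite /slab /=.
  have -> : lval l z = lval l z / z ord0 ord0 * z ord0 ord0 by rewrite divfK // gt_eqF.
  rewrite normrM (gtr0_norm z0); apply: le_trans (_ : ((C + 1) * h) * (2 * r) <= d).
    apply: ler_pM => //; first exact: ltW.
      apply: le_trans lz _; rewrite ler_pM2r //; apply: le_trans (Cl _ l_ls) _.
      by rewrite lerDl.
    by case: zr.
  rewrite mulrAC mulrC -ler_pdivlMr // mulr_gt0 ?mulr_gt0 // ltr_wpDl //.
- apply: measurableI; first exact: measurable_hball.
  rewrite (_ : [set x | _] = \big[setU/set0]_(l <- ls) slab l d).
    by apply: bigsetU_measurable => l _; exact: measurable_slab.
  rewrite -bigcup_seq; apply/seteqP; split => x [l ls_l xl]; by exists l.
- by exists (2 * r) => x [].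
Qed.

Lemma outer_cubes P r e : is_polytope P -> P `<=` hball r -> 1 <= r -> 0 < e ->
  exists L0, forall L, (L0 <= L)%N ->
    \sum_(a : {ffun 'I_n -> 'I_L} | meets P a) vol (grid_cube a) <= vol P + e.
Proof.
move=> pP Pr r1 e0; have [L0 hL0] := boundary_cubes_small pP Pr r1 e0.
have mP := measurable_polytope pP; have bP := bounded_polytope pP.
exists L0 => L /hL0 hL; rewrite (bigID (inside P)) /=; apply: lerD => //.
by apply: grid_cubes_vol_le => // a /andP[_ /asboolP].
Qed.

Lemma inner_cubes P r e : is_polytope P -> P `<=` hball r -> 1 <= r -> 0 < e ->
  exists L0, forall L, (L0 <= L)%N -> vol P - e <=
    \sum_(a : {ffun 'I_n -> 'I_L} | meets P a && inside P a) vol (grid_cube a).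
Proof.
move=> pP Pr r1 e0; have [L0 hL0] := boundary_cubes_small pP Pr r1 e0.
have [L1 hL1] := grid_small_side r1.
have mP := measurable_polytope pP; have bP := bounded_polytope pP.
exists (maxn (maxn L0 L1) 1) => L; rewrite !geq_max => /andP[/andP[/hL0 hL /hL1 sm] L1'].
rewrite lerBlDr; apply: le_trans (_ : \sum_(a : {ffun 'I_n -> 'I_L} | meets P a) vol (grid_cube a) <= _); last first.
  by rewrite (bigID (inside P)) /= lerD2l.
rewrite sum_grid_cubes; apply: vol_le_sum => //.
- by move=> a; case: ifP => _; [exact: measurable_grid_cube | exact: measurable0].
- move=> a; case: ifP => [ma|_]; last by exists 0.
  by exists (2 * r); apply: (near_cube_hball r1 sm); exact: meets_hball Pr ma.
- move=> x Px; have [hx _] := Pr _ Px; have [a _ ax] := grid_cover L1' hx.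
  by exists a => //; rewrite (_ : meets P a) //; apply/asboolP; exists x.
Qed.

End Grids.

(** * Comparing the volumes of cubes *)

Section CubeComparison.
Variables (R : realType) (n : nat) (D : set 'M[R]_n.+1).
Hypotheses (Dp : D `<=` @hisom_plus R n) (Dd : @hisom_plus R n `<=` closure D).
Local Notation vec := 'cV[R]_n.+1.
Local Notation hspace := (@hspace R n).
Implicit Types (x y p q : vec) (c : 'I_n -> R) (h r e : R) (X Y P : set vec) (L : nat).

(** The ratio between the sides of a slot and of a cube that can be moved into
    it when both lie in [hball (2 * r)]. *)
Definition slack r : nat := (Num.truncn (8 * distortion n (2 * r))).+1.

Lemma slackP r : 8 * distortion n (2 * r) < (slack r)%:R.
Proof. exact: truncnS_gt. Qed.

Lemma slack_ge r : 1 <= r -> (16 <= slack r)%N.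
Proof.
move=> r1; have r0 : 0 < r by apply: lt_le_trans r1.
rewrite ltnW // -(ltr_nat R); apply: le_lt_trans (slackP r).
have r20 : 0 <= 2 * r by lra.
have : 0 <= 6 * n%:R * (2 * r) ^+ 2 by apply: mulr_ge0; [rewrite mulr_ge0 ?ler0n | exact: exprn_ge0].
rewrite /distortion; move: (6 * _ * _) => t t0.
have : 0 <= r * t by rewrite mulr_ge0 // ltW.
lra.
Qed.

(** The number of cubes of side [h / M] in a cube of side [M * h], where [M] is
    [slack r]: pieces of the former size can be moved into a cube of side [h]. *)
Definition crowding r : R := ((slack r * slack r) ^ n)%:R.

(** Cut [Y] into cubes of side [h / slack r]; each of them moves into the given cube. *)
Lemma cube_comparison r c h c' Y : 1 <= r -> small_side n r h -> near_cube r c h ->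
  measurable Y -> Y `<=` hball r -> Y `<=` klein_cube c' ((slack r)%:R * h) ->
  vol Y <= crowding r * vol (klein_cube c h : set vec).
Proof.
move=> r1 sm nc mY Yr Yc; set M := slack r in Yc *.
have r0 : 0 < r by apply: lt_le_trans r1.
have h0 : 0 < h by case: sm.
have M0 : 0 < M%:R :> R by rewrite ltr0n.
have LM : (0 < M * M)%N by rewrite muln_gt0.
pose T (a : {ffun 'I_n -> 'I_(M * M)}) :=
  Y `&` klein_cube (subcorner c' (M%:R * h) a) (M%:R * h / (M * M)%:R).
have mT a : measurable (T a) by apply: measurableI => //; exact: measurable_cube.
have bY : bounded_set Y by exists r.
apply: le_trans (vol_le_sum (T := T) mT _ mY _) _.
- by move=> a; apply: bounded_subset bY => x [].
- move=> x Yx; have [a _ xa] := subcube_cover LM (mulr_gt0 M0 h0) (Yc _ Yx).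
  by exists a.
have [q [hq qr qk]] := near_cube_center r1 sm nc.
have hE : M%:R * (M%:R * h / (M * M)%:R) = h by rewrite natrM; field; rewrite gt_eqF.
have bC : bounded_set (klein_cube c h : set vec).
  by exists (2 * r); exact: near_cube_hball.
apply: le_trans (_ : \sum_(a : {ffun 'I_n -> 'I_(M * M)}) vol (klein_cube c h : set vec) <= _).
  apply: ler_sum => a _; have [->|/set0P nT] := eqVneq (T a) set0; first by rewrite vol0 vol_ge0.
  have r21 : 1 <= 2 * r by lra.
  have [] := @move_into_cube R n D (2 * r) M (subcorner c' (M%:R * h) a)
    (M%:R * h / (M * M)%:R) c q (T a) Dp Dd r21 (slackP r) _ _ _ nT hq qr _.
  - by rewrite divr_gt0 ?mulr_gt0 // ltr0n.
  - by move=> x [].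
  - by move=> x [/Yr[_ xr] _]; apply: le_trans xr _; rewrite ler_peMl ?ltW //; lra.
  - by move=> i; rewrite hE.
  move=> g Dg; rewrite hE => gT; have [hg _] := Dp Dg.
  rewrite -(vol_isom hg (mT a)); apply: vol_sub => //.
    by apply: measurable_imageM => //; exact: hisom_unit.
  exact: measurable_cube.
by rewrite sumr_const card_ffun !card_ord -mulr_natl.
Qed.

Lemma slack_side r L : (0 < L)%N -> (slack r)%:R * (2 / (L * slack r)%:R) = 2 / L%:R :> R.
Proof.
by move=> L0; rewrite natrM; field; rewrite !pnatr_eq0 /= -lt0n L0.
Qed.

(** Points spread along one Klein axis give as many disjoint fine cubes as the
    grid is wide, each of at least a fixed proportion of the volume of the
    given cube; together they fit into [hball (2 * r)]. *)
Lemma grid_cube_small r e : (0 < n)%N -> 2 <= r -> 0 < e ->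
  exists L0, forall L, (L0 <= L)%N -> forall a : {ffun 'I_n -> 'I_L},
    vol (grid_cube a `&` hball r : set vec) <= e.
Proof.
move=> n0 r2 e0; have r1 : 1 <= r by lra.
set M := slack r; pose B := crowding r * vol (hball (2 * r) : set vec).
have [L1 hL1] := grid_small_side n r1.
exists (maxn L1 (Num.truncn (B / e)).+1) => L; rewrite geq_max => /andP[LL1 LB] a.
have L0 : (0 < L)%N by exact: leq_trans LB.
have LR : 0 < L%:R :> R by rewrite ltr0n.
have M0 : (0 < M)%N by [].
have LM : (0 < L * M)%N by rewrite muln_gt0 L0.
have sm : small_side n r (2 / (L * M)%:R) by apply: hL1; apply: leq_trans LL1 _; exact: leq_pmulr.
pose i0 := Ordinal n0.
have pP (j : 'I_L) : exists p : vec, [/\ hspace p, p ord0 ord0 <= r & klein p i0 = j%:R / (2 * L%:R)].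
  have j2 : (0 : R) <= j%:R / (2 * L%:R) <= (2^-1 : R).
    have L20 : (0 : R) < 2 * L%:R by rewrite mulr_gt0.
    apply/andP; split; first by rewrite divr_ge0 // ltW.
    by rewrite ler_pdivrMr // mulrA mulVf ?pnatr_eq0 // mul1r ler_nat ltnW.
  have [||p [hp p1 pk]] := @klein_point R n (fun i => if i == i0 then j%:R / (2 * L%:R) else 0) 1.
  - by [].
  - rewrite (bigD1 i0) //= ?eqxx big1 ?addr0; last by move=> i /negbTE ->; rewrite expr0n.
    move: j2; move: (_ / _) => t /andP[t0 t1].
    have : t ^+ 2 <= 2^-1 ^+ 2 by rewrite ler_sqr ?nnegrE.
    by rewrite expr1n; lra.
  by exists p; split=> //; apply: le_trans p1 _; lra.
have [p hp] := choice pP.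
have bP (j : 'I_L) : exists b : {ffun 'I_n -> 'I_(L * M)}, grid_cube b (p j).
  by have [hpj _ _] := hp j; have [b _ hb] := grid_cover LM hpj; exists b.
have [b hb] := choice bP.
(* Neighbouring points are [1 / (2 * L)] apart, more than the side [2 / (L * M)] of
   a fine cube. *)
have b_inj j k : j != k -> b j != b k.
  apply: contra_neqN => /eqP bjk; apply/val_inj/eqP; rewrite -(eqr_nat R); apply: contraT => jk.
  have [_ _ kj] := hp j; have [_ _ kk] := hp k.
  have s0 : 0 <= 2 / (L * M)%:R :> R by rewrite divr_ge0.
  have hbk : grid_cube (b j) (p k) by rewrite bjk.
  have := klein_cube_diam i0 s0 (hb j) hbk; rewrite kj kk -mulrBl normrM.
  have M16 : 16 <= M%:R :> R by rewrite ler_nat; exact: slack_ge.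
  have d1 : 1 <= `|k%:R - j%:R| :> R.
    have : (j : nat) != k by rewrite -(eqr_nat R).
    rewrite neq_ltn => /orP[] lt_jk.
      by apply: le_trans (ler_norm _); rewrite lerBrDl natr1 ler_nat.
    rewrite distrC; apply: le_trans (ler_norm _).
    by rewrite lerBrDl natr1 ler_nat.
  have L20 : 0 < (2 * L%:R)^-1 :> R by rewrite invr_gt0 mulr_gt0.
  rewrite (gtr0_norm L20) natrM => hle.
  have : `|k%:R - j%:R| * M%:R <= 4 :> R.
    have -> : `|k%:R - j%:R| * M%:R = `|k%:R - j%:R| / (2 * L%:R) * (2 * L%:R * M%:R) :> R.
      by field; rewrite gt_eqF.
    apply: le_trans (ler_wpM2r _ hle) _; first by rewrite !mulr_ge0 ?ler0n.
    rewrite le_eqVlt; apply/orP; left; apply/eqP; field.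
    by rewrite !gt_eqF //; lra.
  have : 1 * M%:R <= `|k%:R - j%:R| * M%:R :> R by rewrite ler_wpM2r ?ler0n.
  by move=> h3 h4; exfalso; lra.
set Y := _ `&` _.
have mY : measurable Y by apply: measurableI; [exact: measurable_grid_cube | exact: measurable_hball].
have ncb j : near_cube r (grid_corner R (b j)) (2 / (L * M)%:R).
  by exists (p j); [exact: hb | have [] := hp j].
have Ycmp j : vol Y <= crowding r * vol (grid_cube (b j) : set vec).
  apply: (cube_comparison (c' := grid_corner R a)) => //; first by move=> x [].
  by rewrite slack_side // => x [].
(* All [L] fine cubes found lie in [hball (2 * r)]. *)
have tot : L%:R * vol Y <= B.
  apply: le_trans (_ : \sum_(j < L) crowding r * vol (grid_cube (b j) : set vec) <= _).
    by rewrite mulr_natl -[in leLHS](card_ord L) -sumr_const; apply: ler_sum.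
  rewrite -mulr_sumr; apply: ler_wpM2l; first exact: ler0n.
  apply: (vol_bigcup_le (T := fun j => grid_cube (b j))).
  - by move=> j; exact: measurable_grid_cube.
  - by move=> j; exact: near_cube_hball (ncb j).
  - exact: measurable_hball.
  - by exists (2 * r).
  - by move=> j k /b_inj jk; rewrite grid_disjoint //; exact: thin0.
have LBR : B / e <= L%:R.
  by apply: ltW; apply: lt_le_trans (truncnS_gt (B / e)) _; rewrite ler_nat.
rewrite -(ler_pM2l LR); apply: le_trans tot _.
by rewrite -ler_pdivrMr.
Qed.

End CubeComparison.

(** * Tilings of families of sets *)

Section Tilings.
Variables (R : realType) (n : nat).
Local Notation vec := 'cV[R]_n.+1.
Implicit Types (x : vec) (r : R).

(** The map [f] says in which set of the target family each piece lies, like the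
    map of index sets underlying a morphism of tuples. Stacks are what is known
    of a packing before the leftovers are added to it, which makes it a tiling. *)
Definition stacks (I J : Type) (X : I -> set vec) (f : I -> J) (Y : J -> set vec) :=
  (forall i, X i `<=` Y (f i)) /\
  (forall i i', i <> i' -> f i = f i' -> thin (X i `&` X i')).

Definition tiles (I J : Type) (X : I -> set vec) (f : I -> J) (Y : J -> set vec) :=
  stacks X f Y /\ forall j, Y j `<=` \bigcup_(i in [set i | f i = j]) X i.

Definition family_sum (I J : Type) (T : Type) (X : I -> T) (Y : J -> T) (k : I + J) : T :=
  match k with inl i => X i | inr j => Y j end.

Lemma tiles_comp (I J K : Type) (X : I -> set vec) (Y : J -> set vec) (Z : K -> set vec) f g :
  tiles X f Y -> tiles Y g Z -> tiles X (g \o f) Z.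
Proof.
move=> [[XY dX] cX] [[YZ dY] cY]; split; last first.
  by move=> k x /cY[j /= <-] /cX[i /= <-] Xx; exists i.
split=> [i x /XY /YZ //|i i' ii /= gf].
have [ff|ff] := pselect (f i = f i'); first exact: dX.
by apply: thin_sub (dY _ _ ff gf) => x [/XY Xx /XY Xx'].
Qed.

Lemma stacks_sum (I J K : Type) (X : I -> set vec) (Y : J -> set vec) (Z : K -> set vec)
    (I' : Type) (X' : I' -> set vec) f g f' :
  stacks (family_sum X Y) (family_sum f g) Z -> stacks X' f' Y ->
  stacks (family_sum X X') (family_sum f (g \o f')) Z.
Proof.
move=> [sZ dZ] [sY dY]; split=> [[i|i]|].
- exact: sZ (inl i).
- by move=> x /sY /(sZ (inr (f' i))).
move=> [i|i] [i'|i'] ne /= ff.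
- by apply: (dZ (inl i) (inl i')) => // -[ii]; apply: ne; rewrite ii.
- by apply: thin_sub (dZ (inl i) (inr (f' i')) _ ff) => // x [Xx /sY].
- by apply: thin_sub (dZ (inr (f' i)) (inl i') _ ff) => // x [/sY].
have [e|ne'] := pselect (f' i = f' i'); first by apply: dY => // ii; apply: ne; rewrite ii.
apply: thin_sub (dZ (inr (f' i)) (inr (f' i')) _ ff) => [x [/sY ? /sY ?] //|].
by move=> [].
Qed.

Lemma tiles_vol (I J : finType) (X : I -> set vec) (f : I -> J) (Y : J -> set vec) :
  (forall i, is_polytope (X i)) -> tiles X f Y -> \sum_j vol (Y j) = \sum_i vol (X i).
Proof.
move=> pX [[XY dX] cX]; rewrite [RHS](partition_big f predT) //=; apply: eq_bigr => j _.
pose T i := if f i == j then X i else set0.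
have -> : Y j = \bigcup_(i in [set: I]) T i.
  apply/seteqP; split => [x /cX[i /= fi Xx]|x [i _]].
    by exists i => //; rewrite /T fi eqxx.
  by rewrite /T; case: eqP => // <-; exact: XY.
rewrite vol_bigcup.
- rewrite [RHS]big_mkcond /=; apply: eq_bigr => i _; rewrite /T; case: ifP => //.
  by rewrite vol0.
- by move=> i; rewrite /T; case: ifP => _; [exact: measurable_polytope | exact: measurable0].
- move=> i; rewrite /T; case: ifP => _; first exact: bounded_polytope.
  by exists 0.
- move=> i i' /eqP ii; rewrite /T; case: eqP => e; last by rewrite set0I; exact: thin0.
  case: eqP => e'; last by rewrite setI0; exact: thin0.
  by apply: dX => //; rewrite e e'.
Qed.

(** What remains of a polytope when non-overlapping polytopes are removed is,
    up to a thin set, a polytope. *)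
Lemma stacks_leftover (I J : finType) (X : I -> set vec) (f : I -> J) (Y : J -> set vec) :
  (forall i, is_polytope (X i)) -> (forall j, is_polytope (Y j)) -> stacks X f Y ->
  exists Z : J -> polytope R n,
    tiles (family_sum X (fun j => sval (Z j))) (family_sum f id) Y.
Proof.
move=> pX pY [XY dX].
pose U j := \bigcup_(i in [set: I]) (if f i == j then X i else set0).
have pU j : is_polytope (U j).
  by apply: is_polytope_bigcup => i; case: ifP => // _; exact: is_polytope0.
have [Z hZ] := @polyhedral_choice R n _ (fun j => Y j `\` U j)
  (fun j => polyhedralD (polyhedral_polytope (pY j)) (polyhedral_polytope (pU j))).
exists Z.
have ZY j : sval (Z j) `<=` Y j.
  apply: (polytope_ae_sub (Q := exist _ _ (pY j)) (hZ j)).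
  by apply: thin_sub (@thin0 R n) => x [[]].
have ZX i j : f i = j -> thin (X i `&` sval (Z j)).
  move=> fi; apply: thin_sub (hZ j).2 => x [Xx Zx]; split=> // -[_]; apply.
  by exists i => //; rewrite fi eqxx.
split; first split.
- by case.
- move=> [i|j] [i'|j'] ne /= e.
  + by apply: dX => // ii; apply: ne; rewrite ii.
  + exact: ZX.
  + by rewrite setIC; exact: ZX.
  + by case: ne; rewrite e.
move=> j; have -> : \bigcup_(k in [set k | family_sum f id k = j])
    family_sum X (fun j0 => sval (Z j0)) k = U j `|` sval (Z j).
  apply/seteqP; split => x.
    move=> [[i|j'] /= <- kx]; [left|by right].
    by exists i => //; rewrite eqxx.
  move=> [[i _]|Zx]; last by exists (inr j).
  by case: eqP => // fi Xx; exists (inl i).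
have pZ : is_polytope (U j `|` sval (Z j)).
  have -> : U j `|` sval (Z j) = \bigcup_(b in [set: bool]) (if b then U j else sval (Z j)).
    apply/seteqP; split => x; first by move=> [Ux|Zx]; [exists true | exists false].
    by move=> [[] _ ?]; [left | right].
  by apply: is_polytope_bigcup => -[]; [exact: pU | exact: svalP].
apply: (polytope_sub (pY j) pZ); apply: thin_sub (hZ j).1 => x [Yx nx].
by split; [split=> // Ux; apply: nx; left | move=> Zx; apply: nx; right].
Qed.

End Tilings.

Section TilingMorphisms.
Variables (R : realType) (n : nat) (G : set 'M[R]_n.+1) (hG : is_isom_group G).
Local Notation AA := (hyp_assembler hG).
Notation "A @* X" := [set A *m x | x in X] (at level 40, left associativity).

Lemma wmor_of_tiles (P Q : wtuple AA) (f : idx P -> idx Q) (g : idx P -> 'M[R]_n.+1) :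
  (forall i, G (g i)) ->
  tiles (fun i => g i @* sval (@part AA P i)) f (fun j => sval (@part AA Q j)) ->
  inhabited (wmor P Q).
Proof.
move=> Gg [[sPQ dP] cP].
pose m i := s2val (hom_of_mx (Gg i) (sPQ i)).
have mE i : image_hom (m i) = g i @* sval (@part AA P i).
  by rewrite /m; case: hom_of_mx.
have castE j i (e : f i = j) : image_hom (hom_cast (A := AA) e (m i)) = g i @* sval (@part AA P i).
  by subst j.
constructor; apply: (@WMor _ P Q f m) => j; split.
  rewrite /covering /=; apply/seteqP; split => x.
    by move=> [k _]; exact: image_hom_sub.
  move=> /cP[i /= fi Px]; exists (exist _ i (introT eqP fi)) => //.
  by rewrite castE.
move=> k k' kk; apply/disjoint_morP; rewrite !castE; apply: dP.
  by move=> e; move/eqP: kk; apply; exact: val_inj.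
by rewrite (eqP (valP k)) (eqP (valP k')).
Qed.

End TilingMorphisms.

(** * Packing one polytope *)

Section Packings.
Variables (R : realType) (n : nat).
Local Notation vec := 'cV[R]_n.+1.
Local Notation mat := 'M[R]_n.+1.
Implicit Types (x : vec) (r e : R) (G D : set mat).
Notation "A @* X" := [set A *m x | x in X] (at level 40, left associativity).

(** A scissors congruence of the [X i] with a part of the [Y j]. *)
Definition packs G (I J : Type) (X : I -> set vec) (Y : J -> set vec) :=
  exists (K : finType) (S : K -> set vec) (a : K -> I) (b : K -> J) (g : K -> mat),
  [/\ forall k, is_polytope (S k), forall k, G (g k),
      tiles S a X & stacks (fun k => g k @* S k) b Y].

Variables (D : set mat).
Hypotheses (Dp : D `<=` @hisom_plus R n) (Dd : @hisom_plus R n `<=` closure D).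

Section OnePolytope.
Variables (r : R) (X : set vec) (J : finType) (Q : J -> set vec).
Hypotheses (r1 : 1 <= r) (pX : is_polytope X) (Xr : X `<=` hball r).
Hypotheses (pQ : forall j, is_polytope (Q j)) (Qr : forall j, Q j `<=` hball r).

Definition touched L : {set {ffun 'I_n -> 'I_L}} := [set b | meets X b]%SET.
Definition slots L : {set J * {ffun 'I_n -> 'I_L}} :=
  [set s | meets (Q s.1) s.2 && inside (Q s.1) s.2]%SET.

(** Every slot has at most [crowding r] times the volume of every fine cube
    touched by [X]. Were there fewer slots than touched cubes, the slots could
    not fill enough of the [Q j]. *)
Lemma enough_slots : crowding n r * vol X < \sum_j vol (Q j) ->
  exists L, [/\ (0 < L)%N, small_side n r (2 / L%:R) &
                (#|touched (L * slack n r)| <= #|slots L|)%N].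
Proof.
set C := crowding n r; set M := slack n r => CX.
have C0 : 0 <= C by exact: ler0n.
(* The errors at the boundaries of [X] and of the [Q j] add up to at most
   [(#|J| + C) * e], less than the gap between the volumes. *)
pose e := (\sum_j vol (Q j) - C * vol X) / (#|J|%:R + C + 1).
have N0 : 0 < #|J|%:R + C + 1 by rewrite ltr_wpDl // addr_ge0 ?ler0n.
have e0 : 0 < e by rewrite divr_gt0 // subr_gt0.
have [L1 hL1] := outer_cubes pX Xr r1 e0.
have [L2 hL2] := choice (fun j => inner_cubes (pQ j) (@Qr j) r1 e0).
have [L3 hL3] := grid_small_side n r1.
pose L := (L1 + \sum_j L2 j + L3).+1.
have LL1 : (L1 <= L)%N by rewrite /L -addnA ltnW // ltnS leq_addr.
have LL3 : (L3 <= L)%N by rewrite /L ltnW // ltnS leq_addl.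
have LL2 j : (L2 j <= L)%N.
  rewrite /L ltnW // ltnS (bigD1 j) //=; apply: leq_trans (leq_addr _ _).
  by apply: leq_trans (leq_addl _ _); exact: leq_addr.
have LM : (L <= L * M)%N by exact: leq_pmulr.
exists L; split=> //; first exact: hL3.
have sm : small_side n r (2 / (L * M)%:R) by apply: hL3; exact: leq_trans LM.
rewrite leqNgt; apply/negP => lt_slots.
pose U := touched (L * M); pose S := slots L.
have cmp s b : s \in S -> b \in U ->
    vol (grid_cube s.2 : set vec) <= C * vol (grid_cube b : set vec).
  rewrite !inE => /andP[_ /asboolP sQ] bX.
  apply: (cube_comparison Dp Dd (c := grid_corner R b) (h := 2 / (L * M)%:R) (c' := grid_corner R s.2)) => //.
  - by case: bX => x [bx /Xr[_ xr]]; exists x.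
  - exact: measurable_grid_cube.
  - by move=> x /sQ /Qr.
  - by rewrite slack_side.
have hU := hL1 _ (leq_trans LL1 LM).
have hS : \sum_j vol (Q j) - #|J|%:R * e <= \sum_(s in S) vol (grid_cube s.2 : set vec).
  apply: le_trans (_ : \sum_j \sum_(a : {ffun 'I_n -> 'I_L} | meets (Q j) a && inside (Q j) a)
     vol (grid_cube a : set vec) <= _).
    rewrite mulr_natl -sumr_const -sumrB; apply: ler_sum => j _; exact: hL2.
  rewrite pair_big_dep /= le_eqVlt; apply/orP; left; apply/eqP.
  by apply: eq_bigl => s; rewrite inE.
have U0 : (0 : R) < #|U|%:R by rewrite ltr0n; exact: leq_ltn_trans lt_slots.
(* The comparison of a slot with a touched cube, summed over all such pairs. *)
have tot : #|U|%:R * \sum_(s in S) vol (grid_cube s.2 : set vec) <=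
    #|S|%:R * (C * \sum_(b in U) vol (grid_cube b : set vec)).
  rewrite mulr_natl -sumr_const mulr_natl -sumr_const mulr_sumr.
  rewrite exchange_big /=; apply: ler_sum => b bU; apply: ler_sum => s sS.
  exact: cmp.
have bnd : \sum_(s in S) vol (grid_cube s.2 : set vec) <=
    C * \sum_(b in U) vol (grid_cube b : set vec).
  rewrite -(ler_pM2l U0); apply: le_trans tot _; apply: ler_wpM2r.
    by rewrite mulr_ge0 // sumr_ge0 // => b _; exact: vol_ge0.
  by rewrite ler_nat ltnW.
have hU' : \sum_(b in U) vol (grid_cube b : set vec) <= vol X + e.
  by apply: le_trans hU; rewrite le_eqVlt; apply/orP; left; apply/eqP; apply: eq_bigl => b; rewrite inE.
have : \sum_j vol (Q j) - #|J|%:R * e <= C * (vol X + e).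
  by apply: le_trans hS _; apply: le_trans bnd _; exact: ler_wpM2l.
have : e * (#|J|%:R + C + 1) = \sum_j vol (Q j) - C * vol X by rewrite divfK // gt_eqF.
lra.
Qed.

(** Each touched cube of the fine grid is assigned its own slot, a cube of the
    coarse grid contained in some [Q j], and the part of [X] in it is moved
    there. *)
Lemma pack_one : crowding n r * vol X < \sum_j vol (Q j) -> packs D (fun _ : unit => X) Q.
Proof.
move=> /enough_slots[L [L0 sm le_slots]]; set M := slack n r in le_slots.
pose u (k : 'I_#|touched (L * M)|) : {ffun 'I_n -> 'I_(L * M)} := enum_val k.
pose s (k : 'I_#|touched (L * M)|) : J * {ffun 'I_n -> 'I_L} := enum_val (widen_ord le_slots k).
have u_inj : injective u by exact: enum_val_inj.
have s_inj : injective s by move=> k k' /enum_val_inj /(congr1 val) /= /val_inj.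
have uX k : meets X (u k) by have := enum_valP k; rewrite inE.
have sQ k : meets (Q (s k).1) (s k).2 && inside (Q (s k).1) (s k).2.
  by have := enum_valP (widen_ord le_slots k); rewrite inE.
pose W k := X `&` grid_cube (u k).
have hW k : polyhedral (W k) by apply: polyhedral_cube; exact: polyhedral_polytope.
have [T hT] := polyhedral_choice hW.
have r0 : 0 < r by apply: lt_le_trans r1.
have r21 : 1 <= 2 * r by apply: le_trans r1 _; rewrite ler_peMl ?ltW // ltr1n.
have LM0 : (0 < L * M)%N by rewrite muln_gt0 L0.
have mv k : exists g, D g /\ g @* W k `<=` grid_cube (s k).2.
  have /andP[mQ _] := sQ k; have nc := meets_hball (@Qr _) mQ.
  have [q [hq qr qk]] := near_cube_center r1 sm nc.
  have [] := @move_into_cube R n D (2 * r) M (grid_corner R (u k)) (2 / (L * M)%:R)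
    (grid_corner R (s k).2) q (W k) Dp Dd r21 (slackP n r) _ _ _ _ hq qr _.
  - by rewrite divr_gt0 // ltr0n.
  - by move=> x [].
  - by move=> x [/Xr[_ xr] _]; apply: le_trans xr _; rewrite ler_peMl ?ltW //; lra.
  - by have /asboolP[x [xu Xx]] := uX k; exists x.
  - by move=> i; rewrite slack_side.
  by move=> g Dg; rewrite slack_side // => gW; exists g.
have [g hg] := choice mv.
have hisg k : hisom (g k) by have [] := Dp (hg k).1.
have TX k : sval (T k) `<=` X.
  apply: (polytope_ae_sub (Q := exist _ _ pX) (hT k)).
  by apply: thin_sub (@thin0 R n) => x [[]].
(* [T k] equals [W k] only up to a thin set; inclusions and overlaps are read off
   [W k] and transferred. *)
have tg k : thin (g k @* (sval (T k) `\` W k)) by apply: thin_image; [exact: hisom_unit | exact: (hT k).2].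
exists 'I_#|touched (L * M)|, (fun k => sval (T k)), (fun=> tt), (fun k => (s k).1), g.
split.
- by move=> k; exact: svalP.
- by move=> k; have [] := hg k.
- split; first split.
  + exact: TX.
  + move=> k k' kk _; apply: thin_sub (thinU (hT k).2 (hT k').2) => x [Tx Tx'].
    have [Wx|] := pselect (W k x); last by left.
    right; split=> // Wx'; have : (grid_cube (u k) `&` grid_cube (u k')) x by split; [case: Wx|case: Wx'].
    by rewrite grid_disjoint //; apply/eqP => /u_inj.
  + move=> [] x Xx; have [|k _ Tx] := polytope_ae_cover (Q := exist _ _ pX) hT _ Xx; last by exists k.
    apply: thin_sub (@thin0 R n) => y [/= Xy]; apply.
    have hy : hspace y by have [] := Xr Xy.
    have [b _ yb] := grid_cover LM0 hy.
    have bU : b \in touched (L * M) by rewrite inE; apply/asboolP; exists y.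
    by exists (enum_rank_in bU b) => //; split=> //; rewrite /u enum_rankK_in.
- split=> [k|k k' kk /= ss].
    apply: polytope_sub => //.
      by apply: hisom_image_polytope => //; exact: svalP.
    apply: thin_sub (tg k) => _ [[x Tx <-] nQ]; exists x => //; split=> // Wx; apply: nQ.
    by have /andP[_ /asboolP] := sQ k; apply; apply: (hg k).2; exists x.
  apply: thin_sub (thinU (tg k) (tg k')) => y [[x Tx xy] [x' Tx' xy']].
  have [Wx|nx] := pselect (W k x); last by left; exists x.
  right; exists x' => //; split=> // Wx'.
  have : (grid_cube (s k).2 `&` grid_cube (s k').2) y.
    by split; [apply: (hg k).2; exists x | apply: (hg k').2; exists x'].
  rewrite grid_disjoint //; apply/eqP => e; apply: kk; apply: s_inj.
  by rewrite [LHS]surjective_pairing [RHS]surjective_pairing ss e.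
Qed.

End OnePolytope.
End Packings.

(** * The two volume axioms *)

Section TilingSums.
Variables (R : realType) (n : nat).
Local Notation vec := 'cV[R]_n.+1.

Lemma tiles_id (I : Type) (X : I -> set vec) : tiles X id X.
Proof. by split; [split=> [i|i i' ne /ne] | move=> i x Xx; exists i]. Qed.

Lemma tiles_sum (I J I' J' : Type) (X : I -> set vec) f (Y : J -> set vec)
    (X' : I' -> set vec) f' (Y' : J' -> set vec) :
  tiles X f Y -> tiles X' f' Y' ->
  tiles (family_sum X X') (family_sum (inl \o f) (inr \o f')) (family_sum Y Y').
Proof.
move=> [[sX dX] cX] [[sX' dX'] cX']; split; first split.
- by move=> [i|i]; [exact: sX | exact: sX'].
- move=> [i|i] [i'|i'] ne //= [] ff.
    by apply: dX => // ii; apply: ne; rewrite ii.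
  by apply: dX' => // ii; apply: ne; rewrite ii.
- by move=> [j|j] x /=; [move=> /cX[i /= <- Xx]; exists (inl i) | move=> /cX'[i /= <- Xx]; exists (inr i)].
Qed.

End TilingSums.

Section CubePieces.
Variables (R : realType) (n : nat).
Local Notation vec := 'cV[R]_n.+1.
Implicit Types (r e : R).

Lemma cube_pieces (J : finType) (Q : J -> polytope R n) L : (0 < L)%N ->
  exists T : J * {ffun 'I_n -> 'I_L} -> polytope R n,
    tiles (fun k => sval (T k)) fst (fun j => sval (Q j)) /\
    forall k, vol (sval (T k)) = vol (sval (Q k.1) `&` grid_cube k.2).
Proof.
move=> L0; have [T hT] := @polyhedral_choice R n _ (fun k : J * {ffun 'I_n -> 'I_L} =>
    sval (Q k.1) `&` grid_cube k.2) (fun k => polyhedral_cube _ _ (polyhedral_sval (Q k.1))).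
exists T; split; last first.
  move=> k; apply: vol_congr; [|apply: measurableI|exact: (hT k).2|exact: (hT k).1].
  - by apply: measurable_polytope; exact: svalP.
  - by apply: measurable_polytope; exact: svalP.
  - exact: measurable_grid_cube.
split; first split.
- move=> k; apply: polytope_ae_sub (hT k) _.
  by apply: thin_sub (@thin0 R n) => x [[]].
- move=> k k' kk e; apply: thin_sub (thinU (hT k).2 (hT k').2) => x [Tx Tx'].
  have [Wx|] := pselect ((sval (Q k.1) `&` grid_cube k.2) x); last by left.
  right; split=> // Wx'; have : (grid_cube k.2 `&` grid_cube k'.2) x by split; [case: Wx|case: Wx'].
  rewrite grid_disjoint //; apply/eqP => e'; apply: kk.
  by rewrite [k]surjective_pairing [k']surjective_pairing e e'.
- move=> j x Qx; have [|a _ Tx] := polytope_ae_cover (fun a => hT (j, a)) _ Qx; last by exists (j, a).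
  apply: thin_sub (@thin0 R n) => y [Qy]; apply.
  have hy : hspace y by have [r /(_ _ Qy)[]] := bounded_polytope (svalP (Q j)).
  by have [a _ ya] := grid_cover L0 hy; exists a.
Qed.

Lemma small_pieces (D : set 'M[R]_n.+1) (J : finType) (Q : J -> polytope R n) r e :
  D `<=` @hisom_plus R n -> @hisom_plus R n `<=` closure D ->
  (0 < n)%N -> 2 <= r -> (forall j, sval (Q j) `<=` hball r) -> 0 < e ->
  exists (K : finType) (T : J * K -> polytope R n),
    tiles (fun k => sval (T k)) fst (fun j => sval (Q j)) /\
    forall k, vol (sval (T k)) <= e.
Proof.
move=> Dp Dd n0 r2 Qr e0; have [L hL] := grid_cube_small Dp Dd n0 r2 e0.
have [T [tT vT]] := cube_pieces Q (ltn0Sn L).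
exists {ffun 'I_n -> 'I_L.+1}, T; split=> // k; rewrite vT.
apply: le_trans (hL _ (leqnSn L) k.2).
have mC : measurable (grid_cube k.2 : set vec) by exact: measurable_grid_cube.
apply: vol_sub.
- by apply: measurableI => //; apply: measurable_polytope; exact: svalP.
- by apply: measurableI => //; exact: measurable_hball.
- by exists r => x [].
- by move=> x [/Qr].
Qed.

End CubePieces.

Section PackMany.
Variables (R : realType) (n : nat) (D : set 'M[R]_n.+1).
Hypotheses (Dp : D `<=` @hisom_plus R n) (Dd : @hisom_plus R n `<=` closure D).
Variables (r : R) (I J : finType) (X : I -> set 'cV[R]_n.+1) (Q : J -> set 'cV[R]_n.+1).
Hypotheses (r1 : 1 <= r) (pX : forall i, is_polytope (X i)) (Xr : forall i, X i `<=` hball r).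
Hypotheses (pQ : forall j, is_polytope (Q j)) (Qr : forall j, Q j `<=` hball r).
Notation "A @* X" := [set A *m x | x in X] (at level 40, left associativity).

(** Pack the [X i] one after the other, each into what the previous ones left
    of the [Q j]. *)
Lemma pack_many e : (forall i, vol (X i) <= e) ->
  \sum_i vol (X i) + crowding n r * e < \sum_j vol (Q j) -> packs D X Q.
Proof.
move=> Xe hlt; pose Xs (s : seq I) i := if i \in s then X i else set0.
have pXs s i : is_polytope (Xs s i) by rewrite /Xs; case: ifP => // _; exact: is_polytope0.
suff h s : uniq s -> packs D (Xs s) Q.
  have <- : Xs (enum I) = X by apply: funext => i; rewrite /Xs mem_enum.
  exact/h/enum_uniq.
elim: s => [_|i s IH /= /andP[nis us]].
  exists void, (fun=> set0), (of_void _), (of_void _), (fun=> 0).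
  split=> [[]|[]||]; last by split=> [[]|[]].
  by split=> [|i x]; [split=> [[]|[]] | rewrite /Xs in_nil].
have [K [S [a [b [g [pS Dg tS sS]]]]]] := IH us.
have hg k : hisom (g k) by have [] := Dp (Dg k).
have pgS k : is_polytope (g k @* S k) by exact: hisom_image_polytope.
have [Z tZ] := stacks_leftover pgS pQ sS.
have ZQ j : sval (Z j) `<=` Q j by exact: tZ.1.1 (inr j).
have volZ : \sum_j vol (Q j) = \sum_i vol (Xs s i) + \sum_j vol (sval (Z j)).
  rewrite (tiles_vol _ tZ); last by move=> [k|j]; [exact: pgS | exact: (svalP (Z j))].
  rewrite big_sumType /= (tiles_vol pS tS); congr (_ + _); apply: eq_bigr => k _.
  by apply: vol_isom => //; exact: measurable_polytope.
have [||K' [S' [a' [b' [g' [pS' Dg' tS' sS']]]]]] :=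
    @pack_one R n D Dp Dd r (X i) J (fun j => sval (Z j)) r1 (pX i) (@Xr i) (fun j => svalP (Z j)) _ _.
- by move=> j; exact: subset_trans (ZQ j) (@Qr j).
- apply: (@le_lt_trans _ _ (crowding n r * e)); first by apply: ler_wpM2l; rewrite ?ler0n.
  have : \sum_i vol (Xs s i) <= \sum_i vol (X i).
    by apply: ler_sum => i' _; rewrite /Xs; case: ifP; rewrite ?vol0 ?vol_ge0.
  move: hlt; rewrite volZ; lra.
exists (K + K')%type, (family_sum S S'), (family_sum a (fun=> i)), (family_sum b b'), (family_sum g g').
split.
- by case.
- by case.
- have [[sa da] ca] := tS; have [[sa' da'] ca'] := tS'; split; first split.
  + move=> [k|k] x /=.
      by move=> /sa; rewrite /Xs /= in_cons; case: (boolP (a k \in s)) => //=; rewrite orbT.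
    by move=> /sa'; rewrite /Xs mem_head.
  + have Si k x : a k = i -> ~ S k x.
      by move=> ak /sa; rewrite /Xs ak (negbTE nis).
    move=> [k|k] [k'|k'] ne /= ee.
    * by apply: da => // kk; apply: ne; rewrite kk.
    * by apply: thin_sub (@thin0 R n) => x [/Si-/(_ ee)].
    * by apply: thin_sub (@thin0 R n) => x [_ /Si-/(_ (esym ee))].
    * by apply: da' => [kk|]; [apply: ne; rewrite kk | case: (a' k) (a' k') => -[]].
  + move=> i' x; rewrite /Xs inE; case: eqP => [-> /= Xx|_ /= Xx].
      by have [k _ Sx] := ca' tt x Xx; exists (inr k).
    by have [k /= ak Sx] := ca i' x Xx; exists (inl k).
have -> : (fun k => family_sum g g' k @* family_sum S S' k) =
    family_sum (fun k => g k @* S k) (fun k => g' k @* S' k) by apply: funext; case.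
exact: (stacks_sum tZ.1 sS').
Qed.

End PackMany.

Section EA.
Variables (R : realType) (n : nat) (G : set 'M[R]_n.+1) (hG : is_isom_group G).
Variables (D : set 'M[R]_n.+1).
Hypotheses (n_gt0 : (0 < n)%N) (DG : D `<=` G).
Hypotheses (Dp : D `<=` @hisom_plus R n) (Dd : @hisom_plus R n `<=` closure D).
Local Notation AA := (hyp_assembler hG).
Notation "A @* X" := [set A *m x | x in X] (at level 40, left associativity).

Definition body (P : wtuple AA) (i : idx P) : set 'cV[R]_n.+1 := sval (@part AA P i).

Lemma tvolE (P : wtuple AA) : tvol (@hyp_vol R n G hG) P = \sum_i vol (@body P i).
Proof. by apply: eq_bigr => i _; rewrite hyp_volE. Qed.

Lemma bounded_tuple (P : wtuple AA) : exists2 r, 2 <= r & forall i, @body P i `<=` hball r.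
Proof.
have [|r hr] := @bounded_bigcup R n _ (@body P).
  by move=> i; apply: bounded_polytope; exact: svalP.
exists (Num.max 2 r) => [|i x ix]; first by rewrite le_max lexx.
by apply: (@hball_le _ _ r); [rewrite le_max lexx orbT | apply: hr; exists i].
Qed.

Lemma wmor_of_subtiles (P Q : wtuple AA) (f : idx P -> idx Q) :
  tiles (@body P) f (@body Q) -> inhabited (wmor P Q).
Proof.
move=> h; apply: (@wmor_of_tiles _ _ _ hG P Q f (fun=> 1%:M)); first by move=> _; exact: isog_1 hG.
rewrite (_ : (fun i => _) = @body P) //.
by apply: funext => i; rewrite image1.
Qed.

(** The pieces of [P] are so small that [pack_many] applies; the complement of [P]
    consists of what the packing leaves of [Q]. *)
Lemma hyp_EA_E (P Q : wtuple AA) : tvol (@hyp_vol R n G hG) P < tvol (@hyp_vol R n G hG) Q ->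
  exists P' : wtuple AA, scissors_congruent (tsum P P') Q.
Proof.
rewrite !tvolE => PQ.
have [r1 r12 Pr1] := bounded_tuple P; have [r2 r22 Qr2] := bounded_tuple Q.
pose r := Num.max r1 r2; have rr : 2 <= r by rewrite le_max r12.
have Pr i : @body P i `<=` hball r.
  by move=> x /Pr1; apply: hball_le; rewrite le_max lexx.
have Qr j : @body Q j `<=` hball r.
  by move=> x /Qr2; apply: hball_le; rewrite le_max lexx orbT.
pose C := crowding n r; have C0 : 0 <= C by exact: ler0n.
(* Small enough for [C * e] to be less than the difference of the volumes. *)
pose e := (\sum_j vol (@body Q j) - \sum_i vol (@body P i)) / (C + 1).
have C10 : 0 < C + 1 by rewrite ltr_wpDl.
have e0 : 0 < e by rewrite divr_gt0 // subr_gt0.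
have [K [T [tT vT]]] := small_pieces Dp Dd n_gt0 rr Pr e0.
have pT k : is_polytope (sval (T k)) by exact: svalP.
have pQ j : is_polytope (@body Q j) by exact: svalP.
have TP k : sval (T k) `<=` hball r by apply: subset_trans (tT.1.1 k) (Pr _).
have r1' : 1 <= r by apply: le_trans rr; rewrite ler1n.
have [|K1 [S [a [b [g [pS Dg tS sS]]]]]] := pack_many Dp Dd r1' pT TP pQ Qr vT.
  rewrite -(tiles_vol pT tT) -/C.
  have : e * (C + 1) = \sum_j vol (@body Q j) - \sum_i vol (@body P i) by rewrite divfK // gt_eqF.
  by lra.
have hg k : hisom (g k) by have [] := Dp (Dg k).
have pgS k : is_polytope (g k @* S k) by exact: hisom_image_polytope.
have [Z tZ] := stacks_leftover pgS pQ sS.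
pose P' : wtuple AA := @WTuple AA (idx Q) Z.
pose W : wtuple AA := @WTuple AA (K1 + idx Q)%type
  (family_sum (fun k => exist _ (S k) (pS k) : polytope R n) Z).
exists P', W; split.
  apply: (@wmor_of_subtiles W (tsum P P') (family_sum (inl \o (fst \o a)) (inr \o id))).
  rewrite (_ : @body W = family_sum S (fun j => sval (Z j))); last by apply: funext; case.
  rewrite (_ : @body (tsum P P') = family_sum (@body P) (fun j => sval (Z j))); last by apply: funext; case.
  by apply: tiles_sum; [exact: tiles_comp tS tT | exact: tiles_id].
apply: (@wmor_of_tiles _ _ _ hG W Q (family_sum b id) (family_sum g (fun=> 1%:M))).
  by case=> [k|j] /=; [exact: DG | exact: isog_1 hG].
rewrite (_ : (fun i => _) = family_sum (fun k => g k @* S k) (fun j => sval (Z j))) //.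
by apply: funext; case=> [k|j] //=; rewrite image1.
Qed.

(** The cover consists of one-element tuples, the pieces of [Q] in the cubes of a
    fine grid. *)
Lemma hyp_EA_A (P : wtuple AA) : 0 < tvol (@hyp_vol R n G hG) P -> forall Q : wtuple AA,
  exists (K : finType) (Qs : K -> wtuple AA),
    inhabited (wmor (tbigsum Qs) Q) /\
    forall k, 2 * tvol (@hyp_vol R n G hG) (Qs k) <= tvol (@hyp_vol R n G hG) P.
Proof.
move=> P0 Q; set v := tvol _ P in P0 *.
have [r r2 Qr] := bounded_tuple Q.
have v2 : 0 < v / 2 by rewrite divr_gt0.
have [K [T [tT vT]]] := small_pieces Dp Dd n_gt0 r2 Qr v2.
pose Qs (k : idx Q * K) : wtuple AA := @WTuple AA unit (fun=> T k).
exists (idx Q * K)%type, Qs; split.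
  apply: (@wmor_of_subtiles (tbigsum Qs) Q (fun x => (projT1 x).1)).
  apply: (tiles_comp (Y := fun k => sval (T k)) (f := fun x : idx (tbigsum Qs) => projT1 x)) tT; split; first split.
  - by move=> x.
  - by move=> [k []] [k' []] ne /= kk; case: ne; rewrite kk.
  - by move=> k x Tx; exists (existT _ k tt).
move=> k; rewrite tvolE (big_pred1 tt) /=; last by case.
by have := vT k; rewrite /body /=; lra.
Qed.

End EA.

Theorem theorem5p12 (R : realType) (n : nat) (n_gt0 : (0 < n)%N)
    (G : set 'M[R]_n.+1) (hG : is_isom_group G)
    (hdense : exists D : set 'M[R]_n.+1,
      [/\ is_isom_group D, D `<=` G, D `<=` @hisom_plus R n &
          @hisom_plus R n `<=` closure D]) :
  is_EA_assembler (@hyp_vol R n G hG).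
Proof.
have [D [_ DG Dp Dd]] := hdense; split.
- exact: hyp_is_assembler.
- exact: hyp_is_volume.
- exact: (hyp_EA_E n_gt0 DG Dp Dd).
- exact: (hyp_EA_A n_gt0 Dp Dd).
Qed.
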